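(* Let $\xi$ be a non-degenerate real random variable such that $\mathbf E e^{\lambda\xi}<\infty$ for every $\lambda\in\mathbb R$. Let $\xi_1,\xi_2,\dots$ be i.i.d. copies of $\xi$, $S_0:=0$, $S_k:=\xi_1+\dots+\xi_k$ for $k\ge1$, and let $x=x(n)$ be a fixed sequence of positive constants with $x(n)\sim n$ as $n\to\infty$. Let $s_n=s_n(t)$, $t\ge0$, be the random continuous piecewise linear function going through the nodes $\left(\frac kn,\frac{S_k}{x}\right)$, $k=0,1,2,\dots$. Then $s_n$ satisfies the large deviation principle in the space $(\mathbb C,\rho_\kappa)$ with $\kappa=0$ with rate function $$I(f)=\begin{cases}\displaystyle\int_0^\infty\Lambda(f'(t))\,dt, & f(0)=0,\ f\text{ absolutely continuous},\\ +\infty,&\text{otherwise},\end{cases}$$ that is, for every measurable $B\subset\mathbb C$ $$\limsup_{n\to\infty}\frac1n\ln\mathbf P(s_n\in B)\le -I([B]),\qquad \liminf_{n\to\infty}\frac1n\ln\mathbf P(s_n\in B)\ge -I((B)).$$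
   Context: $\mathbb C$ is the space of continuous functions $f:[0,\infty)\to\mathbb R$ with $\rho_\kappa(f,g):=\sup_{t\ge0}\frac{|f(t)-g(t)|}{1+t^{1+\kappa}}$; here $\kappa=0$ ($\rho_\kappa$ may equal $+\infty$ for some pairs; the topology is the one generated by open balls of finite radius). $[B]$ and $(B)$ are the closure and interior of $B$ in $\rho_0$; measurable means Borel; $I(B):=\inf_{f\in B}I(f)$, $I(\emptyset):=\infty$. ''Rate function'' means good rate function: lower semicontinuous with values in $[0,\infty]$ and with compact level sets $\{I\le r\}$, $r\ge0$. The deviation function of $\xi$ is $\Lambda(\alpha):=\sup_{\lambda\in\mathbb R}\{\lambda\alpha-A(\lambda)\}$, where $A(\lambda):=\ln\mathbf E e^{\lambda\xi}$. ''Absolutely continuous'' means absolutely continuous on every bounded interval $[0,T]$. *)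

(* Defs.v *)
From HB Require Import structures.
From mathcomp Require Import all_boot all_order all_algebra.
From mathcomp Require Import all_classical all_reals all_analysis.
From mathcomp Require Import ring lra.
Set Implicit Arguments.
Unset Strict Implicit.
Unset Printing Implicit Defensive.
Import Order.TTheory GRing.Theory Num.Theory.
Import numFieldNormedType.Exports.
Local Open Scope classical_set_scope.
Local Open Scope ring_scope.

Definition halfline (R : realType) : set R := `[0, +oo[.
Arguments halfline R : clear implicits.

Section weighted_path_space.
Context {R : realType}.

(* The continuous functions on the closed half-line.  The parameter kappa only
   selects the metric; the definition also hides the topology of pointwise
   convergence that the library puts on continuousType. *)
Definition Cspace (kappa : R) : Type := continuousType (halfline R) R.

Context {kappa : R}.
Implicit Types f g h : Cspace kappa.

HB.instance Definition _ := gen_eqMixin (Cspace kappa).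
HB.instance Definition _ := gen_choiceMixin (Cspace kappa).

Definition rho f g : \bar R :=
  ereal_sup [set (`|f t - g t| / (1 + \val t `^ (1 + kappa)))%:E
            | t in [set: halfline R]].

Definition rho_ball f (e : R) g : Prop := (rho f g < e%:E)%E.

Lemma rho_ball_center f (e : R) : 0 < e -> rho_ball f e f.
Proof.
move=> e0; apply: (@le_lt_trans _ _ 0%:E); last by rewrite lte_fin.
by apply: ge_ereal_sup => _ [t _ <-]; rewrite subrr normr0 mul0r.
Qed.

Lemma rho_ball_sym f g (e : R) : rho_ball f e g -> rho_ball g e f.
Proof.
rewrite /rho_ball => /le_lt_trans; apply; apply: ge_ereal_sup => _ [t _ <-].
by apply: ereal_sup_ubound; exists t => //; rewrite distrC.
Qed.

Lemma rho_ball_triangle f g h (e1 e2 : R) :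
  rho_ball f e1 g -> rho_ball g e2 h -> rho_ball f (e1 + e2) h.
Proof.
rewrite /rho_ball EFinD => fg gh; apply: le_lt_trans (lteD fg gh).
apply: ge_ereal_sup => _ [t _ <-].
apply: (@le_trans _ _ ((`|f t - g t| / (1 + \val t `^ (1 + kappa)))%:E +
   (`|g t - h t| / (1 + \val t `^ (1 + kappa)))%:E)%E); last first.
  by apply: leeD; apply: ereal_sup_ubound; exists t.
rewrite -EFinD lee_fin -mulrDl ler_wpM2r ?ler_distD//.
by rewrite invr_ge0 addr_ge0// powR_ge0.
Qed.

HB.instance Definition _ := hasNbhs.Build (Cspace kappa)
  (nbhs_ball_ rho_ball).

Lemma rho_nbhsE :
  @nbhs (Cspace kappa) (Cspace kappa) = nbhs_ (entourage_ rho_ball).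
Proof.
rewrite predeq2E => f A; split => [[e e0 eA]|[B [e e0 eB] BA]].
  exists [set xy | rho_ball xy.1 e xy.2]; first by exists e.
  by move=> g /xsectionP; exact: eA.
by exists e => // g eg; apply: BA; apply/xsectionP; exact: eB.
Qed.

HB.instance Definition _ := Nbhs_isPseudoMetric.Build R (Cspace kappa)
  rho_nbhsE rho_ball_center rho_ball_sym rho_ball_triangle erefl.

End weighted_path_space.

Section polygonal_path.
Context {R : realType}.
Implicit Types (S : nat -> R) (u c : R).

(* The linear interpolation of the nodes (k, S k), at u >= 0. *)
Definition polyline S u : R :=
  let k := Num.truncn u in S k + (u - k%:R) * (S k.+1 - S k).

Definition ramp (v : R) : R := (`|v| - `|v - 1| + 1) / 2.

Definition ramp_sum S m u : R :=
  S 0%N + \sum_(0 <= k < m) ramp (u - k%:R) * (S k.+1 - S k).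

Lemma ramp0 v : v <= 0 -> ramp v = 0.
Proof.
move=> v0; rewrite /ramp !ler0_norm//; first by lra.
by rewrite subr_le0 (le_trans v0).
Qed.

Lemma ramp1 v : 1 <= v -> ramp v = 1.
Proof. by move=> v1; rewrite /ramp !ger0_norm; [field|lra|lra]. Qed.

Lemma ramp_id v : 0 <= v <= 1 -> ramp v = v.
Proof.
by move=> /andP[v0 v1]; rewrite /ramp ger0_norm// ler0_norm; [field|lra].
Qed.

Lemma polyline_ramp S u m : 0 <= u -> u < m%:R -> polyline S u = ramp_sum S m u.
Proof.
move=> u0 um; rewrite /polyline; set k := Num.truncn u.
have /andP[ku uk] : k%:R <= u < k.+1%:R by exact: truncn_itv.
have km : (k < m)%N by rewrite truncn_lt_nat.
rewrite -natr1 in uk.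
rewrite /ramp_sum (@big_cat_nat _ _ _ k)//= ?(ltnW km)// (@big_ltn _ _ _ k)//.
rewrite [X in _ + (_ + (_ + X))]big_nat_cond.
rewrite [X in _ + (_ + (_ + X))]big1; last first.
  move=> i; rewrite andbT => /andP[ki _]; rewrite ramp0 ?mul0r//.
  by rewrite subr_le0 (le_trans (ltW uk))// natr1 ler_nat.
rewrite (eq_big_nat _ _ (F2 := fun i => S i.+1 - S i)); last first.
  move=> i /andP[_ ik]; rewrite ramp1 ?mul1r// lerBrDl natr1.
  by rewrite (le_trans _ ku)// ler_nat.
by rewrite telescope_sumr// ramp_id; [rewrite addr0 addrA subrKC|lra].
Qed.

Lemma ramp_sum_continuous S m : continuous (ramp_sum S m).
Proof.
move=> u; apply: cvgD; first exact: cvg_cst.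
elim: m => [|m IH].
  by under eq_fun do rewrite big_geq//; rewrite big_geq//; exact: cvg_cst.
under eq_fun do rewrite big_nat_recr//=; rewrite big_nat_recr//=.
apply: cvgD => //; apply: cvgM; last exact: cvg_cst.
apply: cvgM; last exact: cvg_cst.
apply: cvgD; last exact: cvg_cst.
have cu : x - m%:R @[x --> u] --> u - m%:R.
  by apply: cvgB; [exact: cvg_id|exact: cvg_cst].
apply: cvgB; apply: cvg_norm => //.
by apply: cvgB => //; exact: cvg_cst.
Qed.

Lemma polyline_continuous S c : 0 <= c ->
  continuous (fun t : halfline R => polyline S (c * \val t)).
Proof.
move=> c0 t.
have cval : continuous (fun t : halfline R => c * \val t).
  move=> s; apply: continuous_comp; last exact: mulrl_continuous.
  exact: initial_continuous.
have val0 (s : halfline R) : 0 <= c * \val s.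
  by rewrite mulr_ge0//; have := set_valP s; rewrite /halfline/= in_itv/= andbT.
pose m := (Num.truncn (c * \val t)).+1.
have ctm : c * \val t < m%:R by exact: truncnS_gt.
rewrite /continuous_at (polyline_ramp S (val0 t) ctm).
have := continuous_comp (cval t) (@ramp_sum_continuous S m _).
apply: cvg_trans; apply: near_eq_cvg; first exact: nbhs_filter.
have : \forall s \near t, c * \val s < m%:R.
  by apply: (cval t [set u | u < m%:R]); exact: lt_nbhsl.
apply: (@filterS _ _ (nbhs_filter t)) => s sm.
by rewrite (@polyline_ramp S _ m).
Qed.

(* The path through the nodes (k / c, S k). *)
Definition polygonal_path (kappa : R) S c (c0 : 0 <= c) : Cspace kappa :=
  mkcts (@polyline_continuous S c c0).

End polygonal_path.

Section large_deviations.
Context {R : realType} {E : topologicalType}.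
Local Open Scope ereal_scope.

Definition good_rate_function (I : E -> \bar R) : Prop :=
  [/\ forall f, 0 <= I f,
      lower_semicontinuous I
    & forall r : R, (0 <= r)%R -> compact [set f | I f <= r%:E]].

Definition borel_set (B : set E) : Prop := <<s open >> B.

(* The probability of Z n in B is read in the completion of P: mu_ext P is the
   outer measure of P, which agrees with P on measurable events and with the
   completed probability on events that are measurable up to a null set.  E need
   not be separable, so such events need not be measurable for P itself.
   For n = 0 the value is 0 * lne _, which the limits below do not see. *)
Definition scaled_log_prob d (T : measurableType d) (P : probability T R)
    (Z : nat -> T -> E) (B : set E) (n : nat) : \bar R :=
  (n%:R^-1)%:E * lne (mu_ext P (Z n @^-1` B)).

Definition satisfies_LDP d (T : measurableType d) (P : probability T R)
    (Z : nat -> T -> E) (I : E -> \bar R) : Prop :=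
  good_rate_function I /\
  forall B : set E, borel_set B ->
    limn_esup (scaled_log_prob P Z B) <= - ereal_inf (I @` closure B) /\
    - ereal_inf (I @` B°) <= limn_einf (scaled_log_prob P Z B).

End large_deviations.

Section random_walk.
Context {R : realType} d {T : measurableType d}.
Variable P : probability T R.

Definition nondegenerate_rv (xi : T -> R) : Prop :=
  forall c : R, ~ {ae P, forall w, xi w = c}.

Definition log_mgf (xi : T -> R) (l : R) : \bar R := lne (mmt_gen_fun P xi l).

Definition deviation (xi : T -> R) (a : R) : \bar R :=
  ereal_sup [set ((l * a)%:E - log_mgf xi l)%E | l in [set: R]].

Definition mutually_independent (X : nat -> {RV P >-> R}) : Prop :=
  forall (J : seq nat) (A : nat -> set R), uniq J ->
    (forall j, j \in J -> measurable (A j)) ->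
    P (\bigcap_(j in [set` J]) (X j @^-1` A j)) =
    (\prod_(j <- J) P (X j @^-1` A j))%E.

(* X i is the step of index i.+1 in the usual numbering. *)
Definition random_walk (X : nat -> {RV P >-> R}) (w : T) (k : nat) : R :=
  \sum_(i < k) X i w.

Definition walk_path (kappa : R) (X : nat -> {RV P >-> R}) (x : nat -> R)
    (n : nat) (w : T) : Cspace kappa :=
  polygonal_path kappa (fun k => random_walk X w k / x n) (ler0n R n).

End random_walk.

Section rate.
Context {R : realType}.

Definition absolutely_continuous_on (a b : R) (f : R -> R) : Prop :=
  forall e : R, 0 < e -> exists2 d : R, 0 < d &
    forall (n : nat) (u v : 'I_n -> R),
      (forall i, [/\ a <= u i, u i <= v i & v i <= b]) ->
      trivIset [set: 'I_n] (fun i => `]u i, v i[%classic) ->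
      \sum_(i < n) (v i - u i) < d ->
      \sum_(i < n) `|f (v i) - f (u i)| < e.

(* The extension by 0 to the real line, so that the library's derivative and
   integral apply; only the values on the half-line matter below. *)
Definition extend (kappa : R) (f : Cspace kappa) : R -> R := 'valL_0 f.

(* f^`() takes a junk value where f is not differentiable, which for f
   absolutely continuous is a null set. *)
Definition rate_function d (T : measurableType d) (P : probability T R)
    (xi : T -> R) (kappa : R) (f : Cspace kappa) : \bar R :=
  if `[< extend f 0 = 0 /\
         forall b, 0 < b -> absolutely_continuous_on 0 b (extend f) >]
  then (\int[lebesgue_measure]_(t in halfline R)
          deviation P xi ((extend f)^`()%classic t))%E
  else +oo%E.

End rate.

(* Main.v *)
Require Import Defs.
From HB Require Import structures.
From mathcomp Require Import finmap.
From mathcomp Require Import all_boot all_order all_algebra.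
From mathcomp Require Import all_classical all_reals all_analysis.
From mathcomp Require Import measurable_realfun.
From mathcomp Require Import ring lra.
Set Implicit Arguments.
Unset Strict Implicit.
Unset Printing Implicit Defensive.
Import Order.TTheory GRing.Theory Num.Theory.
Import numFieldNormedType.Exports.
Local Open Scope classical_set_scope.
Local Open Scope ring_scope.

(* Everything is reduced to exponential moments of linear functionals of the steps.
   By duality, [I f <= r] says that [f 0 = 0] and that
   [sum_i (l_i (f v_i - f u_i) - (v_i - u_i) A l_i) <= r] for all disjoint intervals
   [(u_i, v_i)] and multipliers [l_i], where [A] is the logarithm of the moment
   generating function; in this form lower semicontinuity and compactness of the
   level sets are visible, and the tail estimate [f t = a t + o(t)], uniform on
   level sets, makes the weight [1 + t] harmless.  Cut the steps into [S m] blocks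
   of about [n / m] steps.  Outside an event of probability [e^(- n Q)] the path is
   determined, up to a small weighted distance, by the block averages.  The upper
   bound rounds the averages to a finite grid and applies Chernoff's inequality to
   each grid point.  The lower bound tilts all the blocks simultaneously; the
   tilting parameters are approximate minimisers of [A l - l z] plus a small
   multiple of [|l|], which exist even where the supremum defining the deviation
   function is not attained. *)

(** * Densities of absolutely continuous functions *)

(** The upper bound for a closed set [F] does not cover [F] by small balls, since [F] need not be
    compact. If [I > r] on [F], the compact level set [I <= r] lies at a positive distance from [F];
    a grid path closer than that to a point of [F] has rate above [r], and the dual form hands over
    the multipliers for Chernoff's inequality. The number of blocks and the grid are fixed before
    [n] grows, so the union over grid points costs only a constant factor. Chernoff's inequality
    controls half-lines, not points: each average is rounded towards the mean, so that it lies
    beyond its grid value.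

    In the lower bound the penalty keeps the multiplier under control, and a one-sided bound on
    second differences of [A] leaves a strict gap in both directions. This gap makes the tilted law
    concentrate exponentially fast in the block length, with no law of large numbers for a tilted
    measure.

    The block length is rounded up, so [S m] blocks cover at least [S n] steps; the price is a clock
    that is off by a factor tending to 1. *)

Section interval_families.
Context {R : realType}.
Implicit Types (f : R -> R) (p q : R * R) (l : seq (R * R)).

Definition nonoverlapping : rel (R * R) :=
  [rel p q | (p.2 <= q.1) || (q.2 <= p.1)].

Definition interval_family l :=
  all [pred p | p.1 <= p.2] l && pairwise nonoverlapping l.

Definition total_length l : R := \sum_(p <- l) (p.2 - p.1).

Definition total_increment f l : R := \sum_(p <- l) `|f p.2 - f p.1|.

Definition uniformly_ac f := forall e, 0 < e -> exists2 d, 0 < d &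
  forall l, interval_family l -> total_length l < d -> total_increment f l < e.

(** For [a <= b], the retraction of the line onto [[a, b]]. It is monotone and does not increase
    lengths, so composing with it extends absolute continuity on an interval to the whole line. *)
Definition clamp (a b x : R) : R := Num.max a (Num.min b x).

Lemma clamp_homo a b : {homo clamp a b : x y / x <= y}.
Proof. by move=> x y xy; rewrite /clamp le_max2// le_min2. Qed.

Lemma clamp_ge a b x : a <= clamp a b x.
Proof. by rewrite /clamp le_max lexx. Qed.

Lemma clamp_le a b x : a <= b -> clamp a b x <= b.
Proof. by move=> ab; rewrite /clamp ge_max ab ge_min lexx. Qed.

Lemma clamp_id a b x : a <= x <= b -> clamp a b x = x.
Proof. by move=> /andP[ax xb]; rewrite /clamp (min_idPr xb) (max_idPr ax). Qed.

Lemma clamp_length a b x y : a <= b -> x <= y ->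
  clamp a b y - clamp a b x <= y - x.
Proof.
move=> ab xy; rewrite /clamp.
by case: (leP b x) => ?; case: (leP b y) => ?;
  repeat case: (leP a _) => ?; lra.
Qed.

Lemma interval_family_clamp a b l : a <= b -> interval_family l ->
  interval_family [seq (clamp a b p.1, clamp a b p.2) | p <- l].
Proof.
move=> ab /andP[lle ldis]; apply/andP; split.
  by rewrite all_map; apply: sub_all lle => p /=; exact: clamp_homo.
rewrite pairwise_map; apply: sub_pairwise ldis => p q /= /orP[] h.
  by apply/orP; left; exact: clamp_homo.
by apply/orP; right; exact: clamp_homo.
Qed.

Lemma total_length_clamp a b l : a <= b -> interval_family l ->
  total_length [seq (clamp a b p.1, clamp a b p.2) | p <- l] <= total_length l.
Proof.
move=> ab /andP[/allP lle _]; rewrite /total_length big_map !big_seq.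
by apply: ler_sum => p /lle; exact: clamp_length.
Qed.

Lemma absolutely_continuous_clamp b f : 0 < b ->
  absolutely_continuous_on 0 b f -> uniformly_ac (f \o clamp 0 b).
Proof.
move=> b0 acf e e0; have [d d0 fd] := acf e e0; exists d => // l0 fl0 l0d.
set l := [seq (clamp 0 b p.1, clamp 0 b p.2) | p <- l0].
have fl : interval_family l by apply: interval_family_clamp => //; exact: ltW.
have ld : total_length l < d.
  by apply: le_lt_trans l0d; apply: total_length_clamp => //; exact: ltW.
have -> : total_increment (f \o clamp 0 b) l0 = total_increment f l.
  by rewrite /total_increment big_map.
have bl p : p \in l -> 0 <= p.1 /\ p.2 <= b.
  by move=> /mapP[q _ ->] /=; rewrite clamp_ge clamp_le// ltW.
move: fl ld; rewrite /total_length /total_increment !(big_nth (0, 0)) !big_mkord.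
move=> /andP[/allP lle ldis] ld.
apply: (fd (size l) (fun i => (nth (0, 0) l i).1)
  (fun i => (nth (0, 0) l i).2)) => //.
  move=> i; have il : nth (0, 0) l i \in l by rewrite mem_nth.
  by have [? ?] := bl _ il; split => //; exact: lle.
move=> i j _ _ [z [/=]]; rewrite !in_itv/= => /andP[iz zi] /andP[jz zj].
have dis (s t : 'I_(size l)) : (s < t)%N ->
    nonoverlapping (nth (0, 0) l s) (nth (0, 0) l t).
  by move: ldis => /(pairwiseP (0, 0)); apply; rewrite inE ltn_ord.
have [/dis|/dis|/val_inj//] := ltngtP i j;
  by move=> /orP[] h; exfalso; move: h iz zi jz zj; lra.
Qed.

Lemma uniformly_acB f g :
  uniformly_ac f -> uniformly_ac g -> uniformly_ac (f \- g).
Proof.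
move=> acf acg e e0; have e20 : 0 < e / 2 by rewrite divr_gt0.
have [d d0 fd] := acf _ e20; have [d' d'0 gd] := acg _ e20.
exists (Num.min d d'); first by rewrite lt_min d0.
move=> l fl; rewrite lt_min => /andP[ld ld'].
apply: (@le_lt_trans _ _ (total_increment f l + total_increment g l)).
  rewrite /total_increment -big_split/=; apply: ler_sum => p _ /=.
  have -> : f p.2 - g p.2 - (f p.1 - g p.1) =
    (f p.2 - f p.1) - (g p.2 - g p.1) by ring.
  exact: ler_normB.
by rewrite [e]splitr ltrD// ?fd ?gd.
Qed.

Lemma uniformly_ac_dist f : uniformly_ac f -> forall e, 0 < e ->
  exists2 d, 0 < d & forall x y, `|x - y| < d -> `|f x - f y| < e.
Proof.
move=> acf e e0; have [d d0 fd] := acf e e0; exists d => //.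
have key x y : x <= y -> y - x < d -> `|f y - f x| < e.
  move=> xy xyd; have := fd [:: (x, y)].
  rewrite /interval_family /total_length /total_increment !big_seq1/= !andbT.
  exact.
move=> x y; have [xy|/ltW yx] := leP x y.
  by rewrite distrC ger0_norm ?subr_ge0// => /(key _ _ xy); rewrite distrC.
by rewrite ger0_norm ?subr_ge0// => /(key _ _ yx).
Qed.

Lemma uniformly_ac_continuous f : uniformly_ac f -> continuous f.
Proof.
move=> /uniformly_ac_dist acf x; apply/cvgrPdist_lt => e /acf[d d0 fd].
exists d => //= y; exact: fd.
Qed.

(** Accumulator form: the cells of a partition land in front of an existing family [l], so that one
    interval of a family can be refined while the others stay. *)
Fixpoint subdivide (x : R) (s : seq R) l : seq (R * R) :=
  if s is y :: s' then subdivide y s' ((x, y) :: l) else l.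

Lemma itv_partition_family a b s l : itv_partition a b s ->
  interval_family ((a, b) :: l) -> interval_family (subdivide a s l).
Proof.
elim: s a l => [a l /itv_partition_nil <-|x s IH a l abs].
  by move=> /andP[/andP[_ lle] /andP[_ ldis]]; apply/andP.
have ax : a < x by case: abs => /= /andP[].
have xbs := itv_partition_cons abs; have xb := itv_partition_le xbs.
move=> /andP[/= /andP[_ lle] /andP[/allP ldis ldis']].
apply: IH => //; apply/andP; split.
  by apply/and3P; split => //=; exact: ltW.
apply/andP; split; last first.
  apply/andP; split => //; apply/allP => q ql.
  have /orP[/= h|/= h] := ldis _ ql; apply/orP; first by left; exact: le_trans h.
  by right.
apply/andP; split; first by apply/orP; right => /=.
apply/allP => q ql.
have /orP[/= h|/= h] := ldis _ ql; apply/orP; [by left|right => /=].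
by apply: le_trans h _; exact: ltW.
Qed.

Lemma total_length_subdivide a b s l : itv_partition a b s ->
  total_length (subdivide a s l) = b - a + total_length l.
Proof.
elim: s a l => [a l /itv_partition_nil <-|x s IH a l abs] /=.
  by rewrite subrr add0r.
rewrite (IH _ _ (itv_partition_cons abs)) /total_length big_cons/=; ring.
Qed.

Lemma total_increment_subdivide f a b s l : itv_partition a b s ->
  total_increment f (subdivide a s l) = variation a b f s + total_increment f l.
Proof.
elim: s a l => [a l _|x s IH a l abs] /=; first by rewrite variation_nil add0r.
rewrite (IH _ _ (itv_partition_cons abs)) /total_increment big_cons/=.
by rewrite addrA; congr (_ + _); rewrite addrC [in RHS]/variation/= big_nat_recl.
Qed.

Lemma subdivide_cat x s l1 l2 :
  subdivide x s (l1 ++ l2) = subdivide x s l1 ++ l2.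
Proof. by elim: s x l1 => //= y s IH x l1; rewrite -IH. Qed.

Lemma nonoverlapping_catC l1 l2 :
  pairwise nonoverlapping (l1 ++ l2) = pairwise nonoverlapping (l2 ++ l1).
Proof.
rewrite !pairwise_cat allrelC.
rewrite (@eq_allrel _ _ _ nonoverlapping) => [|p q]; last exact: orbC.
by case: (allrel _ _ _); case: (pairwise _ l1); case: (pairwise _ l2).
Qed.

Lemma interval_family_catC l1 l2 :
  interval_family (l1 ++ l2) = interval_family (l2 ++ l1).
Proof.
by rewrite /interval_family nonoverlapping_catC !all_cat (andbC (all _ l1)).
Qed.

Lemma interval_family_cons_catC p l1 l2 :
  interval_family (p :: l1 ++ l2) = interval_family (p :: l2 ++ l1).
Proof.
rewrite /interval_family !pairwise_cons nonoverlapping_catC /=.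
by rewrite !all_cat (andbC (all _ l1)) (andbC (all (nonoverlapping p) l1)).
Qed.

(** Refining an interval preserves disjointness and total length, so the increments of every
    refinement stay below [e]; the suprema over refinements are taken one interval at a time. *)
Lemma uniformly_ac_total_variation f : uniformly_ac f ->
  forall e, 0 < e -> exists2 d, 0 < d & forall l, interval_family l ->
    total_length l < d ->
    (\sum_(p <- l) total_variation p.1 p.2 f <= e%:E)%E.
Proof.
move=> acf e e0; have [d d0 fd] := acf e e0; exists d => //.
have swap := interval_family_catC; have swap1 := interval_family_cons_catC.
(* [l1] collects the intervals already refined, whose increments are counted; those in [l2] carry
   their total variation. *)
suff key l1 l2 : interval_family (l2 ++ l1) -> total_length (l2 ++ l1) < d ->
    ((total_increment f l1)%:E + \sum_(p <- l2) total_variation p.1 p.2 f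
      <= e%:E)%E.
  move=> l fl ld; have := key [::] l; rewrite cats0 => /(_ fl ld).
  by rewrite /total_increment big_nil add0e.
elim: l2 l1 => [l1|[u v] l IH l1] fl ll.
  by rewrite big_nil adde0 lee_fin ltW// fd.
have uv : u <= v by move: fl => /andP[/= /andP[]].
have sub s : itv_partition u v s -> ((variation u v f s + total_increment f l1)%:E
    + \sum_(p <- l) total_variation p.1 p.2 f <= e%:E)%E.
  move=> uvs; rewrite -(total_increment_subdivide f l1 uvs); apply: IH.
  - rewrite swap -subdivide_cat; apply: (itv_partition_family uvs).
    by rewrite swap1.
  - move: ll; rewrite /total_length !big_cat big_cons/=.
    have := total_length_subdivide l1 uvs; rewrite /total_length => ->.
    by rewrite /=; lra.
have TV0 : (0 <= \sum_(p <- l) total_variation p.1 p.2 f)%E.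
  rewrite big_seq; apply: sume_ge0 => p pl; apply: total_variation_ge0.
  have /andP[/allP/(_ p) + _] := fl.
  by apply; rewrite inE mem_cat pl orbT.
(* The remaining sum must be finite before it can change sides. A degenerate interval admits only
   the empty partition and is treated apart. *)
have [r r0 lr] : exists2 r, 0 <= r &
    (\sum_(p <- l) total_variation p.1 p.2 f)%E = r%:E.
  have : (\sum_(p <- l) total_variation p.1 p.2 f <= e%:E)%E.
    have [uv'|uv'] := eqVneq u v.
      apply: le_trans (sub [::] _); last by split => //=; rewrite uv'.
      by rewrite leeDr// lee_fin variation_nil add0r sumr_ge0.
    have uvs : itv_partition u v [:: v] by apply: itv_partition1; rewrite lt_neqAle uv'.
    apply: le_trans (sub _ uvs).
    by rewrite leeDr// lee_fin addr_ge0 ?variation_ge0 ?sumr_ge0.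
  move: TV0; case: (\sum_(p <- l) _)%E => // r; rewrite !lee_fin => r0 _.
  by exists r.
rewrite big_cons/= lr addeCA -EFinD -leeBrDr// -EFinB.
apply: ge_ereal_sup => _ [_ [s uvs <-] <-].
have := sub s uvs; rewrite lr -EFinD !lee_fin; lra.
Qed.

End interval_families.

Lemma measure_bigcup_series d (T : measurableType d) (R : realType)
    (m : {measure set T -> \bar R}) (F : nat -> set T) :
  (forall k, measurable (F k)) -> trivIset setT F ->
  m (\bigcup_k F k) = (\sum_(0 <= k <oo) m (F k))%E.
Proof.
move=> mF tF; apply/esym/cvg_lim => //; apply: measure_semi_sigma_additive => //.
exact: bigcup_measurable.
Qed.

(** * Stieltjes measures and Radon-Nikodym densities *)

Section absolutely_continuous_measure.
Context {R : realType}.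
Local Notation mu := (@lebesgue_measure R).

Lemma open_interval_bounded (J : set R) : open J -> is_interval J ->
  (mu J < +oo)%E -> exists2 p : R * R, p.1 <= p.2 & J = `]p.1, p.2[%classic.
Proof.
move=> oJ iJ muJ.
have JE : J = [set` Rhull J] by rewrite RhullK// inE.
have [J0|/set0P J0] := eqVneq J set0.
  by exists (0, 0) => //; rewrite set_itvoo0.
have lbJ x : J x -> exists2 y, J y & y < x.
  move=> /oJ[e /= e0 xeJ]; exists (x - e / 2); last by rewrite ltrBlDr ltrDl divr_gt0.
  apply: xeJ => /=; rewrite opprB addrC subrK gtr0_norm ?divr_gt0//.
  by rewrite ltr_pdivrMr// ltr_pMr// ltr1n.
have ubJ x : J x -> exists2 y, J y & x < y.
  move=> /oJ[e /= e0 xeJ]; exists (x + e / 2); last by rewrite ltrDl divr_gt0.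
  apply: xeJ => /=; rewrite opprD addNKr normrN gtr0_norm ?divr_gt0//.
  by rewrite ltr_pdivrMr// ltr_pMr// ltr1n.
move: muJ; rewrite JE lebesgue_measure_itv.
case: (Rhull J) JE => [[b x|[|]] [b' y|[|]]] JE /=; rewrite ?lte_fin ?ltNyr ?ltry//.
- move=> _; have [z Jz] := J0; have xy : x <= y.
    move: Jz; rewrite JE/= itv_boundlr => /andP[/= xz zy].
    by apply: (@le_trans _ _ z); [case: (b) xz|case: (b') zy] => //=; rewrite bnd_simp // => /ltW.
  exists (x, y) => //=; apply/seteqP; split => t /=; last first.
    rewrite !in_itv/= => /andP[xt ty].
    by case: (b); case: (b') => /=; rewrite ?xt ?ty ?ltW.
  move=> Jt; have Jt' : J t by rewrite JE.
  have [s Js st] := lbJ _ Jt'; have [s' Js' ts'] := ubJ _ Jt'.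
  rewrite in_itv/=; apply/andP; split.
    apply: le_lt_trans st; move: Js; rewrite JE/= itv_boundlr => /andP[+ _].
    by case: (b) => /=; rewrite bnd_simp// => /ltW.
  apply: lt_le_trans ts' _; move: Js'; rewrite JE/= itv_boundlr => /andP[_].
  by case: (b') => /=; rewrite bnd_simp// => /ltW.
all: by move=> _; have [z] := J0; rewrite JE /= itv_boundlr => /andP[].
Qed.

Lemma stieltjes_measure_itvoc (F : cumulative R R) (a b : R) : a <= b ->
  lebesgue_stieltjes_measure F (`]a, b] : set R)%classic = (F b - F a)%:E.
Proof.
move=> ab; rewrite /lebesgue_stieltjes_measure/= /measure_extension/=.
rewrite measurable_mu_extE/=; last exact: is_ocitv.
by rewrite wlength_itv_bnd.
Qed.

(** A null set has an open neighbourhood of length below [d]. Any finitely many of its components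
    form an interval family, so absolute continuity bounds their Stieltjes mass by [e], and hence
    that of the whole neighbourhood. *)
Lemma stieltjes_measure_dominated (F : cumulative R R) : uniformly_ac F ->
  lebesgue_stieltjes_measure F `<< mu.
Proof.
move=> acF; apply/null_content_dominatesP => A mA muA0.
pose nu : {measure set (measurableTypeR R) -> \bar R} :=
  lebesgue_stieltjes_measure F.
change (nu A = 0%E); apply/eqP; rewrite eq_le measure_ge0 andbT; apply/lee_addgt0Pr => e e0.
rewrite add0e; have [d d0 Fd] := acF e e0.
have [|U [oU AU muU]] := lebesgue_regularity_outer mA _ d0.
  by rewrite muA0 ltry.
have mU : measurable U by exact: measurable_realfun.open_measurable.
have {}muU : (mu U < d%:E)%E.
  apply: le_lt_trans muU.
  have UE : U = (U `\` A) `|` A by rewrite setDKU.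
  apply: (@le_trans _ _ (mu (U `\` A) + mu A)%E); last by rewrite [mu A]muA0 adde0.
  rewrite [in leLHS]UE.
  by apply: measureU2 => //; exact: measurableD.
pose J := open_disjoint_itv oU.
have mJ k : measurable (J k).
  by apply: measurable_realfun.open_measurable; exact: open_disjoint_itv_open.
have UJ : U = \bigcup_k J k by exact: open_disjoint_itv_bigcup.
have tJ : trivIset setT J by exact: open_disjoint_itv_trivIset.
have muJU n : (\sum_(0 <= k < n) mu (J k) <= mu U)%E.
  rewrite UJ measure_bigcup_series//.
  exact: nneseries_lim_ge.
have /choice[p pP] k : exists p : R * R, p.1 <= p.2 /\ J k = `]p.1, p.2[%classic.
  have muJk : (mu (J k) < +oo)%E.
    apply: le_lt_trans (lt_trans muU (ltry _)).
    apply: le_measure; rewrite ?inE; [exact: mJ|exact: mU|].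
    by rewrite UJ; exact: bigcup_sup.
  have oJ : open (J k) by exact: open_disjoint_itv_open.
  have iJ : is_interval (J k) by exact: open_disjoint_itv_is_interval.
  have [p p12 JE] := open_interval_bounded oJ iJ muJk.
  by exists p.
apply: (@le_trans _ _ (nu U)); first by apply: le_measure; rewrite ?inE.
have -> : nu U = (\sum_(0 <= k <oo) nu (J k))%E.
  by rewrite [in LHS]UJ; exact: measure_bigcup_series.
apply: lime_le.
  exact: is_cvg_nneseries.
apply: nearW => n.
(* Empty components are dropped: a degenerate pair [(z, z)] with [z] inside another component would
   violate [nonoverlapping]. *)
pose l := [seq p k | k <- index_iota 0 n & (p k).1 < (p k).2].
have fl : interval_family l.
  apply/andP; split; first by apply/allP => _ /mapP[k _ ->] /=; exact: (pP k).1.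
  rewrite pairwise_map.
  apply: (@sub_in_pairwise _ [pred k | (p k).1 < (p k).2] ltn).
  - move=> i j; rewrite !inE /= => pi pj ij.
    apply/orP; have [|ji'] := leP (p i).2 (p j).1; [by left|right].
    rewrite leNgt; apply/negP => ij'.
    pose z := (Num.max (p i).1 (p j).1 + Num.min (p i).2 (p j).2) / 2.
    have [z1 z2] : Num.max (p i).1 (p j).1 < z /\ z < Num.min (p i).2 (p j).2.
      suff : Num.max (p i).1 (p j).1 < Num.min (p i).2 (p j).2.
        by move=> h; rewrite /z; split; lra.
      by rewrite gt_max !lt_min pi pj ji' ij'.
    have Jz : (J i `&` J j) z.
      move: z1 z2; rewrite gt_max lt_min => /andP[? ?] /andP[? ?].
      by split; rewrite (pP _).2 /= in_itv/=; apply/andP.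
    have : i = j by apply: (tJ i j) => //; exists z.
    by move=> eij; move: ij; rewrite eij ltnn.
  - by apply/allP => k; rewrite mem_filter => /andP[].
  - apply: pairwise_filter; rewrite -sorted_pairwise; last exact: ltn_trans.
    exact: iota_ltn_sorted.
have muJ k : mu (J k) = ((p k).2 - (p k).1)%:E.
  rewrite (pP k).2 lebesgue_measure_itv/= lte_fin; case: ifPn => // h.
  by congr EFin; have := (pP k).1; lra.
have nuJ k : (nu (J k) <= (F (p k).2 - F (p k).1)%:E)%E.
  rewrite -stieltjes_measure_itvoc ?(pP k).1//; apply: le_measure.
  - by rewrite inE; exact: mJ.
  - by rewrite inE; exact: measurable_itv.
  - by rewrite (pP k).2; apply: subset_itv; rewrite bnd_simp.
apply: (@le_trans _ _ (total_increment F l)%:E).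
  rewrite /total_increment big_map big_filter -sumEFin [leRHS]big_mkcond/=.
  apply: lee_sum => k _; case: ifPn => h; last first.
    rewrite (pP k).2 set_itv_ge ?measure0// bnd_simp; exact: h.
  by apply: le_trans (nuJ k) _; rewrite lee_fin ler_norm.
rewrite lee_fin ltW//; apply: Fd => //; rewrite -lte_fin.
apply: le_lt_trans muU; apply: le_trans (muJU n).
rewrite /total_length big_map big_filter -sumEFin [leLHS]big_mkcond/=.
by apply: lee_sum => k _; rewrite muJ; case: ifPn => // _; rewrite lee_fin subr_ge0 (pP k).1.
Qed.

Lemma nondecreasing_uniformly_ac_density (F : R -> R) (b : R) : 0 <= b ->
  {homo F : x y / x <= y} -> uniformly_ac F ->
  exists2 g : R -> R, mu.-integrable setT (EFin \o g) &
    forall s t, 0 <= s -> s <= t -> t <= b ->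
      (F t - F s)%:E = (\int[mu]_(x in `]s, t]) (g x)%:E)%E.
Proof.
move=> b0 ndF acF.
have rcF : right_continuous F.
  by apply: right_continuousW; exact: uniformly_ac_continuous.
pose G : cumulative R R := HB.pack F (isCumulative.Build R _ R F ndF rcF).
have nuE s t : s <= t ->
    lebesgue_stieltjes_measure G (`]s, t] : set R)%classic = (F t - F s)%:E.
  by move=> st; rewrite stieltjes_measure_itvoc.
have m0b : measurable (`]0, b]%classic : set (measurableTypeR R)).
  exact: measurable_itv.
have fin0b : (lebesgue_stieltjes_measure G (`]0%R, b]%classic : set R) < +oo)%E.
  by rewrite nuE ?ltry.
(* The restriction to []0, b]] has finite mass, which makes its density integrable on the whole
   line. *)
pose nu := mfrestr m0b fin0b.
have dom : nu `<< mu.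
  apply/null_content_dominatesP => A mA muA.
  have /null_content_dominatesP := @stieltjes_measure_dominated G acF; apply => //.
    exact: measurableI.
  by apply/eqP; rewrite eq_le measure_ge0 andbT -muA; apply: le_measure;
    rewrite ?inE//; exact: measurableI.
have [f [f0 ffin intf fE]] := radon_nikodym_sigma_finite dom.
have EFinf : EFin \o (fine \o f) = f.
  by apply/funext => x /=; rewrite fineK.
exists (fine \o f); first by rewrite EFinf.
move=> s t s0 st tb.
transitivity (nu `]s, t]%classic).
  rewrite /nu /mfrestr /mrestr /= setIidl ?nuE//.
  by apply: subset_itv; rewrite bnd_simp.
transitivity (\int[mu]_(x in `]s, t]) f x)%E.
  by apply: fE; exact: measurable_itv.
by apply: eq_integral => x _; rewrite -[in LHS]EFinf.
Qed.

(** [V] is the total variation of the clamped path up to the clamped argument. Variation dominates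
    the increments of the path, and small total length forces small variation. *)
Lemma total_variation_decomposition (f : R -> R) (b : R) : 0 < b ->
  uniformly_ac (f \o clamp 0 b) ->
  exists V : R -> R, [/\ {homo V : x y / x <= y}, uniformly_ac V &
    {homo (V \- (f \o clamp 0 b)) : x y / x <= y}].
Proof.
move=> b0 acf; set fc := f \o clamp 0 b; pose c := clamp 0 b.
have c0 x : 0 <= c x by exact: clamp_ge.
have cb x : c x <= b by apply: clamp_le; exact: ltW.
have cle x y : x <= y -> c x <= c y by exact: clamp_homo.
have fcc x : fc (c x) = fc x by rewrite /fc/= [clamp 0 b (c x)]clamp_id// c0 cb.
have fin x : total_variation 0 (c x) fc \is a fin_num.
  have [d d0 dTV] := uniformly_ac_total_variation acf ltr01.
  (* An interval of length below [d] has variation at most 1, so finitely many steps of length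
     [d / 2] reach every point. *)
  have step n : total_variation 0 (c (n%:R * (d / 2))) fc \is a fin_num.
    elim: n => [|n IH].
      by rewrite mul0r /c clamp_id ?lexx ?ltW// total_variationxx.
    have nn : c (n%:R * (d / 2)) <= c (n.+1%:R * (d / 2)).
      by apply: cle; rewrite ler_pM2r ?divr_gt0// ler_nat.
    rewrite (total_variationD fc (c0 _) nn) fin_numD IH/=.
    rewrite ge0_fin_numE ?total_variation_ge0//.
    have := dTV [:: (c (n%:R * (d / 2)), c (n.+1%:R * (d / 2)))].
    rewrite /interval_family /total_length !big_seq1/= !andbT => h.
    apply: le_lt_trans (h nn _) (ltry _).
    apply: (@le_lt_trans _ _ (d / 2)); last by rewrite ltr_pdivrMr// ltr_pMr// ltr1n.
    apply: le_trans (clamp_length (ltW b0) _) _.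
      by rewrite ler_pM2r ?divr_gt0// ler_nat.
    by rewrite -mulrBl -[n.+1]addn1 natrD addrAC subrr add0r mul1r.
  have [n nx] : exists n, x <= n%:R * (d / 2).
    exists (Num.truncn (x / (d / 2))).+1; rewrite -ler_pdivrMr ?divr_gt0//.
    by rewrite ltW// truncnS_gt.
  rewrite ge0_fin_numE ?total_variation_ge0//.
  have := step n; rewrite ge0_fin_numE ?total_variation_ge0//; apply: le_lt_trans.
  by rewrite (total_variationD fc (c0 _) (cle _ _ nx)) leeDl// total_variation_ge0// cle.
pose V x := fine (total_variation 0 (c x) fc).
have VB x y : x <= y -> (V y - V x)%:E = total_variation (c x) (c y) fc.
  move=> xy; have := fin y; rewrite EFinB /V !fineK// (total_variationD fc (c0 _) (cle _ _ xy)).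
  by move=> _; rewrite addeAC subee// add0e.
have ndV : {homo V : x y / x <= y}.
  move=> x y xy; rewrite -subr_ge0 -lee_fin (VB _ _ xy).
  by rewrite total_variation_ge0// cle.
exists V; split => //.
- move=> e e0; have e20 : 0 < e / 2 by rewrite divr_gt0.
  have [d d0 dTV] := uniformly_ac_total_variation acf e20.
  exists d => // l fl ld.
  have := dTV _ (interval_family_clamp (ltW b0) fl)
    (le_lt_trans (total_length_clamp (ltW b0) fl) ld).
  rewrite big_map /= => h; apply: (@le_lt_trans _ _ (e / 2)); last by lra.
  rewrite -lee_fin; apply: le_trans h; rewrite /total_increment -sumEFin.
  rewrite !big_seq; apply: lee_sum => p pl.
  have p12 : p.1 <= p.2 by move: fl => /andP[/allP/(_ _ pl)].
  by rewrite ger0_norm ?subr_ge0 ?ndV// VB.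
- move=> x y xy /=.
  have : fc y - fc x <= V y - V x.
    rewrite -lee_fin VB//; apply: le_trans (total_variation_ge _ (cle _ _ xy)).
    by rewrite lee_fin !fcc ler_norm.
  by rewrite /fc /=; lra.
Qed.

(* [f] is a difference of two nondecreasing absolutely continuous functions, whose
   Stieltjes measures have Radon-Nikodym densities. *)
Lemma absolutely_continuous_density (f : R -> R) (b : R) : 0 < b ->
  absolutely_continuous_on 0 b f -> exists g : R -> R,
  [/\ mu.-integrable setT (EFin \o g),
    forall s t, 0 <= s -> s <= t -> t <= b ->
      (f t - f s)%:E = (\int[mu]_(x in `]s, t]) (g x)%:E)%E &
    {ae mu, forall x, 0 < x < b -> derivable f x 1 /\ f^`()%classic x = g x}].
Proof.
move=> b0 acf; have acfc := absolutely_continuous_clamp b0 acf.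
set fc := f \o clamp 0 b in acfc.
have [V [ndV acV ndVf]] := total_variation_decomposition b0 acfc.
have [g1 ig1 g1E] := nondecreasing_uniformly_ac_density (ltW b0) ndV acV.
have [g2 ig2 g2E] := nondecreasing_uniformly_ac_density (ltW b0) ndVf
  (uniformly_acB acV acfc).
have ig : mu.-integrable setT (EFin \o (g1 \- g2)).
  have := integrableB measurableT ig1 ig2; apply: eq_integrable => //.
have gE s t : 0 <= s -> s <= t -> t <= b ->
    (f t - f s)%:E = (\int[mu]_(x in `]s, t]) ((g1 \- g2) x)%:E)%E.
  move=> s0 st tb; transitivity
      (\int[mu]_(x in `]s, t]) (g1 x)%:E - \int[mu]_(x in `]s, t]) (g2 x)%:E)%E.
    rewrite -g1E// -g2E// -EFinB; congr EFin.
    rewrite /= !clamp_id ?s0 ?tb ?(le_trans s0 st) ?(le_trans st tb)//; ring.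
  apply/esym/integralB_EFin; first exact: measurable_itv.
  - by apply: integrableS ig1 => //; exact: measurable_itv.
  - by apply: integrableS ig2 => //; exact: measurable_itv.
exists (g1 \- g2); split => //.
pose G x := (\int[mu]_(t in [set` Interval (BRight 0) (BRight x)]) (g1 \- g2) t)%R.
have igy y : mu.-integrable [set` Interval (BRight 0) (BRight y)]
    (EFin \o (g1 \- g2)).
  by apply: integrableS ig => //; exact: measurable_itv.
(* Lebesgue differentiation gives the derivative of the indefinite integral [G] almost everywhere;
   near a point of []0, b[], [f] differs from [G] by the constant [f 0]. *)
have := FTC1 igy (open_integrable_locally openT ig).
apply: filterS; first exact: (ae_filter_ringOfSetsType mu).
move=> x h /andP[x0 xb]; have [//|dG GE] := h _.
have near_eq : \forall y \near x, f y = G y + f 0.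
  have : \forall y \near x, 0 < y < b by apply: near_in_itvoo; rewrite in_itv/= x0.
  apply: filterS => y /andP[y0 yb]; apply/eqP; rewrite -subr_eq; apply/eqP.
  by rewrite /G /Rintegral -gE// ?ltW.
have [dfG dfE] : is_derive x 1 f (G^`()%classic x).
  apply: (@near_eq_is_derive _ _ _ (fun y => G y + f 0)).
    by apply: filterS near_eq => y ->.
  rewrite -[X in is_derive _ _ _ X]addr0; apply: is_deriveD.
  by rewrite derive1E; apply: DeriveDef.
by split => //; rewrite derive1E dfE GE.
Qed.

End absolutely_continuous_measure.

(** * The rate function in dual form *)

Section lower_integral.
Context d (T : measurableType d) (R : realType).
Variable m : {measure set T -> \bar R}.
Local Open Scope ereal_scope.
Import HBNNSimple.

(* The library's monotonicity lemmas ask for measurability; the integral of a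
   nonnegative function is a supremum over the simple functions below it, so it is
   monotone without it.  The derivative of a path takes junk values on a null set,
   where its measurability is unclear. *)
Lemma ge0_le_integral_sup (D : set T) (f g : T -> \bar R) :
  (forall x, D x -> 0 <= f x) -> (forall x, D x -> f x <= g x) ->
  \int[m]_(x in D) f x <= \int[m]_(x in D) g x.
Proof.
move=> f0 fg; have g0 x : D x -> 0 <= g x by move=> Dx; exact: le_trans (f0 _ Dx) (fg _ Dx).
rewrite !ge0_integralE//; apply: le_ereal_sup => _ [h hf <-]; exists h => // x.
apply: le_trans (hf x) _; rewrite !patchE; case: ifPn => // xD.
by apply: fg; exact: set_mem.
Qed.

Lemma ge0_subset_integral_sup (D E : set T) (f : T -> \bar R) :
  D `<=` E -> (forall x, E x -> 0 <= f x) ->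
  \int[m]_(x in D) f x <= \int[m]_(x in E) f x.
Proof.
move=> DE f0; rewrite integral_mkcond [leRHS]integral_mkcond.
apply: ge0_le_integral_sup => x _.
  by rewrite patchE; case: ifPn => // /set_mem /DE; exact: f0.
rewrite !patchE; case: ifPn => [/set_mem /DE xE|_]; first by rewrite mem_set.
by case: ifPn => // /set_mem; exact: f0.
Qed.

(** A simple function below [f] is measurable even if [f] is not, so the exceptional null set can be
    cut out of its integral before comparing with [g]. *)
Lemma ge0_ae_le_integral (D : set T) (f g : T -> \bar R) :
  (forall x, D x -> 0 <= f x) -> (forall x, D x -> 0 <= g x) ->
  {ae m, forall x, D x -> f x <= g x} ->
  \int[m]_(x in D) f x <= \int[m]_(x in D) g x.
Proof.
move=> f0 g0 [N [mN N0 fgN]].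
rewrite ge0_integralE//; apply: ge_ereal_sup => _ [h hf <-].
rewrite -integralT_nnsfun (ge0_negligible_integral mN)//=; last 2 first.
- by apply/measurable_EFinP.
- by move=> x _; rewrite lee_fin.
rewrite setTD [leRHS]integral_mkcond integral_mkcond.
apply: ge0_le_integral_sup => x _.
  by rewrite patchE; case: ifPn => // _; rewrite lee_fin.
rewrite patchE; case: ifPn => [|_]; last first.
  by rewrite patchE; case: ifPn => // xD; apply: g0; exact: set_mem.
rewrite in_setC => xN; apply: le_trans (hf x) _.
rewrite !patchE; case: ifPn => // xD.
apply: contrapT => fg; move: xN; rewrite notin_setE; apply; apply: fgN => /=.
by move=> h'; apply: fg; apply: h'; exact: set_mem.
Qed.

End lower_integral.

Section step_functions.
Context {R : realType}.
Local Notation mu := (@lebesgue_measure R).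
Implicit Types (h : R) (c : nat -> \bar R).

Definition mesh h k : set R := `[k%:R * h, k.+1%:R * h[%classic.

Definition step h c (x : R) : \bar R := c (Num.truncn (x / h)).

Lemma mesh_truncn h k x : 0 < h -> mesh h k x -> Num.truncn (x / h) = k.
Proof.
move=> h0; rewrite /mesh /= in_itv/= => /andP[kx xk].
by apply: truncn_def; rewrite ler_pdivlMr// ltr_pdivrMr// kx.
Qed.

Lemma truncn_mesh h x : 0 < h -> 0 <= x -> mesh h (Num.truncn (x / h)) x.
Proof.
move=> h0 x0; have /andP[kx xk] := truncn_itv (divr_ge0 x0 (ltW h0)).
by rewrite /mesh/= in_itv/= -ler_pdivlMr// kx -ltr_pdivrMr.
Qed.

Lemma halfline_mesh h : 0 < h -> halfline R = \bigcup_k mesh h k.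
Proof.
move=> h0; apply/seteqP; split => x.
  by rewrite /halfline/= in_itv/= andbT => x0; eexists; last exact: truncn_mesh.
move=> [k _]; rewrite /mesh /halfline /= !in_itv/= andbT => /andP[+ _].
by apply: le_trans; rewrite mulr_ge0// ltW.
Qed.

Lemma trivIset_mesh h : 0 < h -> trivIset setT (mesh h).
Proof.
by move=> h0 i j _ _ [x [/(mesh_truncn h0) <- /(mesh_truncn h0) <-]].
Qed.

Lemma step_measurable h c : 0 < h -> measurable_fun (halfline R) (step h c).
Proof.
move=> h0; rewrite (halfline_mesh h0); apply/measurable_fun_bigcup => [k|k].
  exact: measurable_itv.
apply: (eq_measurable_fun (cst (c k))) => [x /set_mem xk|].
  by rewrite /step (mesh_truncn h0 xk).
exact: measurable_cst.
Qed.

Lemma step_integral h c : 0 < h -> (forall k, 0 <= c k)%E ->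
  (\int[mu]_(x in halfline R) step h c x = \sum_(0 <= k <oo) h%:E * c k)%E.
Proof.
move=> h0 c0; have := step_measurable c h0; rewrite (halfline_mesh h0) => ms.
rewrite ge0_integral_bigcup//.
- apply: eq_eseriesr => k _.
  rewrite (eq_integral (cst (c k))); last first.
    by move=> x /set_mem xk; rewrite /step (mesh_truncn h0 xk).
  rewrite integral_cst; last exact: measurable_itv.
  rewrite [X in (_ * X)%E]lebesgue_measure_itv/= lte_fin ltr_pM2r// ltr_nat ltnSn.
  rewrite muleC -EFinB; congr (_%:E * _)%E.
  by rewrite -mulrBl -[k.+1]addn1 natrD addrAC subrr add0r mul1r.
- by move=> k; exact: measurable_itv.
- by move=> x _; exact: c0.
- exact: trivIset_mesh.
Qed.

End step_functions.

Section limit_inferior.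
Context {R : realType}.
Implicit Types (w : (\bar R)^nat) (c : \bar R).

Lemma limn_einf_ge w c : (\forall n \near \oo, c <= w n)%E ->
  (c <= limn_einf w)%E.
Proof.
move=> [N _ cw]; rewrite limn_einf_lim; apply: lime_ge; first exact: is_cvg_einfs.
exists N => // n /= Nn; apply: le_ereal_inf_tmp => _ [k /= nk <-].
by apply: cw; exact: leq_trans Nn nk.
Qed.

Lemma limn_esup_le w c : (\forall n \near \oo, w n <= c)%E ->
  (limn_esup w <= c)%E.
Proof.
move=> [N _ cw]; rewrite limn_esup_lim; apply: lime_le; first exact: is_cvg_esups.
exists N => // n /= Nn; apply: ge_ereal_sup => _ [k /= nk <-].
by apply: cw; exact: leq_trans Nn nk.
Qed.

Lemma limn_einf_ge_cvg w (u : R^nat) (l : R) : u @ \oo --> l ->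
  (forall n, ((u n)%:E <= w n)%E) -> (l%:E <= limn_einf w)%E.
Proof.
move=> ul uw; apply/lee_subgt0Pr => e e0; apply: limn_einf_ge.
have le : l - e < l by rewrite ltrBlDr ltrDl.
apply: filterS (cvgr_ge l ul (l - e) le) => n lu.
by apply: le_trans (uw n); rewrite lee_fin.
Qed.

End limit_inferior.

Section derivative_quotients.
Context {R : realType}.

Lemma derivable_linear_approx (f : R -> R) (x : R) : derivable f x 1 ->
  forall e, 0 < e -> exists2 d, 0 < d & forall y, `|y - x| < d ->
    `|f y - f x - f^`()%classic x * (y - x)| <= e * `|y - x|.
Proof.
move=> dfx e e0; rewrite derive1E.
have /cvgrPdist_le/(_ _ e0)[d /= d0 fd] : h^-1 *: ((f \o shift x) (h *: 1) - f x)
    @[h --> 0^'] --> 'D_1 f x by exact: dfx.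
exists d => // y yx; have [->|yx0] := eqVneq y x.
  by rewrite !subrr mulr0 subrr !normr0 mulr0.
have yx0' : y - x != 0 by rewrite subr_eq0.
have := fd (y - x); rewrite /= sub0r normrN => /(_ yx yx0').
rewrite [_ *: 1]mulr1 subrK distrC => h.
have -> : f y - f x - 'D_1 f x * (y - x) =
    ((y - x)^-1 *: (f y - f x) - 'D_1 f x) * (y - x).
  by rewrite mulrBl [_ *: _]mulrC divfK.
by rewrite normrM ler_wpM2r.
Qed.

Definition mesh_quotient (f : R -> R) (h x : R) : R :=
  let k := Num.truncn (x / h) in (f (k.+1%:R * h) - f (k%:R * h)) / h.

(** The cell around [x] need not have [x] as an endpoint. The linear approximation errors at its two
    ends are at most [e] times their distances to [x], and these distances add up to [h]. *)
Lemma mesh_quotient_cvg (f : R -> R) (x : R) : 0 <= x -> derivable f x 1 ->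
  mesh_quotient f n.+1%:R^-1 x @[n --> \oo] --> f^`()%classic x.
Proof.
move=> x0 dfx; apply/cvgrPdist_le => e e0.
have [d d0 fd] := derivable_linear_approx dfx e0.
have : \forall n \near \oo, n.+1%:R^-1 < d.
  have := @cvg_harmonic R => /cvgrPdist_lt/(_ _ d0); apply: filterS => n.
  by rewrite sub0r normrN ger0_norm// invr_ge0.
apply: filterS => n; have : 0 < n.+1%:R^-1 :> R by rewrite invr_gt0.
move: (n.+1%:R^-1) => h h0 hd; rewrite /mesh_quotient; set k := Num.truncn _.
have := truncn_mesh h0 x0; rewrite -/k /mesh/= in_itv/= => /andP[kx xk].
have khE : k.+1%:R * h = k%:R * h + h by rewrite -[k.+1]addn1 natrD mulrDl mul1r.
have fv := fd (k.+1%:R * h); have fu := fd (k%:R * h).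
rewrite khE in xk fv *; move: (k%:R * h) kx xk fv fu => u ux xu.
rewrite (@gtr0_norm _ (u + h - x)) ?subr_gt0// (@ler0_norm _ (u - x)) ?subr_le0//.
have hv : u + h - x < d by lra.
have hu : - (u - x) < d by lra.
move=> /(_ hv) fv /(_ hu) fu.
rewrite distrC.
have -> : (f (u + h) - f u) / h - f^`()%classic x =
  ((f (u + h) - f x - f^`()%classic x * (u + h - x)) -
   (f u - f x - f^`()%classic x * (u - x))) / h.
  field; exact: lt0r_neq0.
rewrite normrM normfV (gtr0_norm h0) ler_pdivrMr//.
apply: le_trans (ler_normB _ _) _; lra.
Qed.

End derivative_quotients.

(** * The Legendre transform and its integral along a path *)

Section legendre.
Context {R : realType}.
Local Notation mu := (@lebesgue_measure R).
Variable A : R -> R.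
Implicit Types (a l r : R) (f : R -> R).

Definition legendre a : \bar R :=
  ereal_sup [set (l * a - A l)%:E | l in [set: R]].

Lemma legendre_ge l a : ((l * a - A l)%:E <= legendre a)%E.
Proof. by apply: ereal_sup_ubound; exists l. Qed.

Lemma legendre_le a r :
  (legendre a <= r%:E)%E <-> forall l, l * a - A l <= r.
Proof.
split=> [ar l|ar]; first by rewrite -lee_fin (le_trans (legendre_ge _ _)).
by apply: ge_ereal_sup => _ [l _ <-]; rewrite lee_fin.
Qed.

Lemma legendre_gt a r : (r%:E < legendre a)%E -> exists l, r < l * a - A l.
Proof. by move=> /ereal_sup_gt[_ [l _ <-]]; rewrite lte_fin; exists l. Qed.

Lemma legendre_lsc : lower_semicontinuous legendre.
Proof.
move=> a r /legendre_gt[l rl].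
exists [set b | r < l * b - A l]; last first.
  by move=> b rb; apply: lt_le_trans (legendre_ge l b); rewrite lte_fin.
have : l * b - A l @[b --> a] --> l * a - A l.
  apply: cvgB; last exact: cvg_cst.
  by apply: cvgM; [exact: cvg_cst|exact: cvg_id].
by move=> /(_ [set y | r < y]); apply; exact: lt_nbhsr.
Qed.

Lemma legendre_measurable : measurable_fun setT legendre.
Proof. by apply: lower_semicontinuous_measurable; exact: legendre_lsc. Qed.

(* The dual form of [\int_0^oo legendre A (f' t) dt <= r], which needs no derivative. *)
Definition energy_le f r : Prop := f 0 = 0 /\
  forall n (u v l : 'I_n -> R), (forall i, 0 <= u i /\ u i <= v i) ->
    trivIset [set: 'I_n] (fun i => `]u i, v i[%classic) ->
    \sum_(i < n) (l i * (f (v i) - f (u i)) - (v i - u i) * A (l i)) <= r.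

Lemma energy_le_itv f r : energy_le f r -> forall l u v, 0 <= u -> u <= v ->
  l * (f v - f u) - (v - u) * A l <= r.
Proof.
move=> [_ fr] l u v u0 uv.
have := fr 1%N (fun=> u) (fun=> v) (fun=> l); rewrite big_ord1; apply => //.
by move=> i j _ _ _; rewrite !ord1.
Qed.

Lemma energy_le_ge0 f r : energy_le f r -> 0 <= r.
Proof.
move=> [_ fr]; have := fr 0%N (fun=> 0) (fun=> 0) (fun=> 0).
by rewrite big_ord0; apply => [[]|[]].
Qed.

Lemma energy_le_mesh f r : energy_le f r -> forall h, 0 < h -> forall N (l : nat -> R),
  \sum_(0 <= k < N) (l k * (f (k.+1%:R * h) - f (k%:R * h)) - h * A (l k)) <= r.
Proof.
move=> [_ fr] h h0 N l; rewrite big_mkord; apply: le_trans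
  (fr N (fun i => i%:R * h) (fun i => i.+1%:R * h) (fun i => l i) _ _).
- rewrite le_eqVlt; apply/orP; left; apply/eqP; apply: eq_bigr => i _.
  congr (_ - _ * _).
  by rewrite -mulrBl -[i.+1]addn1 natrD addrAC subrr add0r mul1r.
- move=> i; split; first by rewrite mulr_ge0// ltW.
  by rewrite ler_pM2r// ler_nat.
move=> i j _ _ [x [/= xi xj]].
have sub (k : nat) : `]k%:R * h, k.+1%:R * h[%classic `<=` mesh h k.
  by apply: subset_itv; rewrite bnd_simp.
apply: val_inj; transitivity (Num.truncn (x / h)); last exact: mesh_truncn (sub _ _ xj).
by apply/esym; exact: mesh_truncn (sub _ _ xi).
Qed.

(** The supremum of a sum over independent multipliers is the sum of the suprema: with the last
    multiplier fixed, its term moves into the bound and induction handles the others. *)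
Lemma legendre_sum_le N (al w : nat -> R) r : (forall k, 0 <= w k) ->
  (forall l : nat -> R, \sum_(0 <= k < N) w k * (l k * al k - A (l k)) <= r) ->
  A 0 = 0 ->
  (\sum_(0 <= k < N) (w k)%:E * legendre (al k) <= r%:E)%E.
Proof.
move=> w0 + A0; elim: N r => [r /(_ (fun=> 0))|N IH r hr]; first by rewrite !big_geq.
have L0 k : (0 <= legendre (al k))%E.
  by apply: le_trans (legendre_ge 0 _); rewrite mul0r A0 subr0.
have sub l : (\sum_(0 <= k < N) (w k)%:E * legendre (al k)
    <= (r - w N * (l * al N - A l))%:E)%E.
  apply: IH => l'; have := hr (fun k => if k == N then l else l' k).
  rewrite big_nat_recr//= eqxx -lerBrDr; apply: le_trans.
  rewrite !big_nat le_eqVlt; apply/orP; left; apply/eqP; apply: eq_bigr => k kN.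
  by rewrite lt_eqF.
rewrite big_nat_recr//=.
have S0 : (0 <= \sum_(0 <= k < N) (w k)%:E * legendre (al k))%E.
  by apply: sume_ge0 => k _; rewrite mule_ge0 ?lee_fin.
move: S0 sub; case: (\sum_(0 <= k < N) _)%E => // [s s0 sub|_ /(_ 0)]; last first.
  by rewrite leye_eq.
(* With weight 0 the value [legendre (al N)] may be [+oo]; the convention [0 * +oo = 0] settles this
   case. *)
have [->|wN] := eqVneq (w N) 0.
  rewrite mul0e adde0; have := sub 0; rewrite mul0r A0 subr0 mulr0 subr0.
  by [].
have wN0 : 0 < w N by rewrite lt_neqAle eq_sym wN w0.
have : (legendre (al N) <= ((r - s) / w N)%:E)%E.
  apply/legendre_le => l; rewrite ler_pdivlMr//.
  by have := sub l; rewrite lee_fin => ?; lra.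
move=> /(lee_wpmul2l (_ : (0 <= (w N)%:E)%E)) -/(_ (w0 _)).
move=> /(leeD2l s%:E) /le_trans; apply.
by rewrite -EFinM -EFinD lee_fin mulrCA divff// mulr1 subrKC.
Qed.

Lemma energy_le_mesh_legendre f r : A 0 = 0 -> energy_le f r ->
  forall h, 0 < h -> forall N,
  (\sum_(0 <= k < N) h%:E * legendre ((f (k.+1%:R * h) - f (k%:R * h)) / h)%R
    <= r%:E)%E.
Proof.
move=> A0 fr h h0 N; apply: (@legendre_sum_le _ _ (fun=> h)) => // [_|l].
  exact: ltW.
apply: le_trans (energy_le_mesh fr h0 N l); rewrite le_eqVlt; apply/orP; left.
apply/eqP; apply: eq_bigr => k _; field; exact: lt0r_neq0.
Qed.

(** Off a null set the derivative is a density [g]; integrating [l * g - A l <= legendre g] over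
    each interval gives its term of the dual sum. *)
Lemma energy_le_integral f r : A 0 = 0 -> f 0 = 0 ->
  (forall b, 0 < b -> absolutely_continuous_on 0 b f) ->
  (\int[mu]_(x in halfline R) legendre (f^`()%classic x) <= r%:E)%E ->
  energy_le f r.
Proof.
move=> A0 f00 acf fr; split => // n u v l uv tuv.
have L0 a : (0 <= legendre a)%E.
  by apply: le_trans (legendre_ge 0 _); rewrite mul0r A0 subr0.
pose b := 1 + \sum_(i < n) v i.
have v0 i : 0 <= v i by have [u0 /(le_trans u0)] := uv i.
have b0 : 0 < b by rewrite ltr_pwDl// sumr_ge0.
have vb i : v i <= b.
  by rewrite /b (bigD1 i)//= addrCA lerDl addr_ge0// sumr_ge0.
have [g [ig gE aeg]] := absolutely_continuous_density b0 (acf _ b0).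
pose Lg x := legendre (g x).
have mg : measurable_fun setT g by apply/measurable_EFinP; exact: measurable_int ig.
have mLg : measurable_fun setT Lg by exact: measurableT_comp legendre_measurable mg.
have key i : ((l i * (f (v i) - f (u i)) - (v i - u i) * A (l i))%:E <=
    \int[mu]_(x in `]u i, v i[) Lg x)%E.
  have [u0 uvi] := uv i.
  have mi : measurable (`]u i, v i] : set (measurableTypeR R))%classic.
    exact: measurable_itv.
  have igi : mu.-integrable `]u i, v i] (EFin \o g).
    by apply: integrableS ig => //; exact: measurable_itv.
  rewrite integral_itv_bndo_bndc; last exact: measurable_funTS.
  have mui : mu `]u i, v i]%classic = (v i - u i)%:E.
    rewrite lebesgue_measure_itv/= lte_fin; case: ifPn => // h.
    by congr EFin; move: h; lra.
  have iA : mu.-integrable `]u i, v i] (cst (A (l i))%:E).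
    apply/integrableP; split; first exact: measurable_cst.
    by rewrite /= integral_cst//= [X in (_ * X)%E]mui -EFinM ltry.
  have igl : mu.-integrable `]u i, v i] (fun x => (l i)%:E * (g x)%:E)%E.
    exact: integrableZl.
  have <- : (\int[mu]_(x in `]u i, v i]) ((l i)%:E * (g x)%:E - (A (l i))%:E) =
      (l i * (f (v i) - f (u i)) - (v i - u i) * A (l i))%:E)%E.
    transitivity (\int[mu]_(x in `]u i, v i]) ((l i)%:E * (g x)%:E) -
        \int[mu]_(x in `]u i, v i]) cst (A (l i))%:E x)%E.
      by apply: integralB.
    rewrite integralZl// integral_cst// -gE// [X in (_ - _ * X)%E]mui.
    by rewrite -!EFinM -EFinB [A _ * _]mulrC.
  have [iL|iL] := pselect (mu.-integrable `]u i, v i] Lg).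
    apply: le_integral => // [|x _]; first exact: integrableB.
    by rewrite -EFinM -EFinB; exact: legendre_ge.
  suff -> : (\int[mu]_(x in `]u i, v i]) Lg x = +oo)%E by rewrite leey.
  apply/eqP; apply: contra_notT iL => iL; apply/integrableP; split.
    exact: measurable_funTS.
  suff -> : (\int[mu]_(x in `]u i, v i]) `|Lg x| = \int[mu]_(x in `]u i, v i]) Lg x)%E.
    by rewrite ltey.
  by apply: eq_integral => x _; rewrite gee0_abs// L0.
have LF x : (0 <= legendre (f^`()%classic x))%E by exact: L0.
rewrite -lee_fin -sumEFin.
apply: (@le_trans _ _ (\sum_(i < n) \int[mu]_(x in `]u i, v i[) Lg x)%E).
  exact: lee_sum.
rewrite -(ge0_integral_bigsetU)//=.
- apply: le_trans fr; apply: (@le_trans _ _ (\int[mu]_(x in `]0%R, b[) Lg x)%E).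
    apply: ge0_subset_integral_sup => x; last by move=> _; exact: L0.
    rewrite -bigcup_seq => -[i _] /=; rewrite !in_itv/= => /andP[uix xvi].
    by have [u0 _] := uv i; rewrite (le_lt_trans u0)// (lt_le_trans xvi).
  apply: (@le_trans _ _ (\int[mu]_(x in `]0%R, b[) legendre (f^`()%classic x))%E).
    apply: ge0_ae_le_integral => [x _|x _|]; [exact: L0|exact: L0|move: aeg].
    apply: filterS; first exact: (ae_filter_ringOfSetsType mu).
    by move=> x h xb; rewrite (h xb).2.
  apply: ge0_subset_integral_sup => x; last by move=> _; exact: L0.
  by rewrite /halfline/= !in_itv/= andbT => /andP[/ltW].
- exact: index_enum_uniq.
- by apply: sub_trivIset tuv.
- exact: measurable_funTS.
- by move=> x _; exact: L0.
Qed.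

Lemma energy_le_ac f r b : energy_le f r ->
  absolutely_continuous_on 0 b f.
Proof.
move=> fr e e0; have r0 := energy_le_ge0 fr.
(* Multipliers [c] and [- c], matching the signs of the increments, turn the dual sum into a bound
   [r + 1] for [c] times the total increment; [(r + 1) / c = e / 2]. *)
pose c := 2 * (r + 1) / e; have c0 : 0 < c by rewrite divr_gt0// mulr_gt0// ltr_wpDl.
pose K := `|A c| + `|A (- c)|; have K0 : 0 <= K by exact: addr_ge0.
exists (K + 1)^-1 => [|n u v uvb tuv uvd]; first by rewrite invr_gt0 ltr_wpDl.
pose l i := if 0 <= f (v i) - f (u i) then c else - c.
have := fr.2 n u v l (fun i => let: And3 a b _ := uvb i in conj a b) tuv.
rewrite sumrB => fl.
have : \sum_(i < n) (v i - u i) * A (l i) <= \sum_(i < n) (v i - u i) * K.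
  apply: ler_sum => i _; apply: ler_wpM2l.
    by have [_ uv _] := uvb i; rewrite subr_ge0.
  rewrite /l /K; case: ifP => _; apply: le_trans (ler_norm _) _.
    by rewrite lerDl.
  by rewrite lerDr.
rewrite -mulr_suml => fK.
have fc : \sum_(i < n) l i * (f (v i) - f (u i)) =
    c * \sum_(i < n) `|f (v i) - f (u i)|.
  rewrite mulr_sumr; apply: eq_bigr => i _; rewrite /l.
  by case: ifPn => [f0|]; [rewrite ger0_norm|rewrite -ltNge => f0; rewrite ltr0_norm// mulrN mulNr].
rewrite fc in fl.
have dK : (\sum_(i < n) (v i - u i)) * K <= 1.
  apply: (@le_trans _ _ ((K + 1)^-1 * K)); first by rewrite ler_wpM2r// ltW.
  by rewrite mulrC ler_pdivrMr ?mul1r ?ltr_wpDl// lerDl.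
have : c * \sum_(i < n) `|f (v i) - f (u i)| <= r + 1 by lra.
rewrite -ler_pdivlMl// => /le_lt_trans; apply.
have -> : c^-1 * (r + 1) = e / 2 by rewrite /c; field; apply/andP; split; lra.
by rewrite ltr_pdivrMr// ltr_pMr// ltr1n.
Qed.

Lemma energy_le_derivable f r : energy_le f r ->
  {ae mu, forall x, 0 < x -> derivable f x 1}.
Proof.
move=> fr.
have : {ae mu, forall x, forall n : nat, 0 < x < n.+1%:R -> derivable f x 1}.
  apply: ae_foralln => n.
  have [g [_ _]] := absolutely_continuous_density (ltr0Sn R n) (energy_le_ac _ fr).
  apply: filterS; first exact: (ae_filter_ringOfSetsType mu).
  by move=> x h /h[].
apply: filterS; first exact: (ae_filter_ringOfSetsType mu).
move=> x h x0; apply: (h (Num.truncn x)).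
by rewrite x0 truncnS_gt.
Qed.

(** Fatou's lemma for the step functions built from mesh quotients: the quotients converge to the
    derivative almost everywhere, each affine minorant of [legendre] passes to the limit, and every
    step function has integral at most [r]. *)
Lemma integral_energy_le f r : A 0 = 0 -> energy_le f r ->
  (\int[mu]_(x in halfline R) legendre (f^`()%classic x) <= r%:E)%E.
Proof.
move=> A0 fr.
have L0 a : (0 <= legendre a)%E.
  by apply: le_trans (legendre_ge 0 _); rewrite mul0r A0 subr0.
pose h n : R := n.+1%:R^-1; have h0 n : 0 < h n by rewrite invr_gt0.
pose F n := step (h n) (fun k =>
  legendre ((f (k.+1%:R * h n) - f (k%:R * h n)) / h n)%R).
apply: (@le_trans _ _ (\int[mu]_(x in halfline R) limn_einf (F^~ x))%E).
  apply: ge0_ae_le_integral => //.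
    by move=> x _; apply: limn_einf_ge; apply: nearW => n; exact: L0.
  have := energy_le_derivable fr.
  (* Differentiability is known only at [x > 0], while the half-line contains 0. *)
  have : {ae mu, forall x, x != 0}.
    exists [set 0]; split => //; first exact: lebesgue_measure_set1.
    by move=> x /= /negP; rewrite negbK => /eqP.
  apply: filterS2; first exact: (ae_filter_ringOfSetsType mu).
  move=> x xn0 dfx; rewrite /halfline/= in_itv/= andbT => x0.
  have {}dfx : derivable f x 1 by apply: dfx; rewrite lt_neqAle eq_sym xn0.
  apply: ge_ereal_sup => _ [l _ <-].
  apply: (@limn_einf_ge_cvg _ _ (fun n => l * mesh_quotient f (h n) x - A l)).
    apply: cvgB; last exact: cvg_cst.
    by apply: cvgM; [exact: cvg_cst|exact: mesh_quotient_cvg].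
  by move=> n; exact: legendre_ge.
apply: le_trans (fatou _ _ _ _) _ => //.
- by rewrite /halfline; exact: measurable_itv.
- by move=> n; exact: step_measurable.
- by move=> n x _; exact: L0.
apply: le_trans (limn_einf_sup _) _; apply: limn_esup_le; apply: nearW => n.
rewrite step_integral//; apply: lime_le.
  by apply: is_cvg_nneseries => k _ _; rewrite mule_ge0// lee_fin ltW.
by apply: nearW => N; exact: energy_le_mesh_legendre.
Qed.

End legendre.

(** * Uniform estimates on the level sets *)

Section cumulant.
Context {R : realType}.
Variables (A : R -> R) (a : R).
Implicit Types (f : R -> R) (r e t : R).

(* What the argument retains of the cumulant generating function A of a law with
   mean a; the last clause, one-sided second-order smoothness, takes over the role
   of differentiability. *)
Definition cumulant_like : Prop := [/\ A 0 = 0, (forall l, l * a <= A l) &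
  forall B, exists2 C, 0 <= C & forall l h, `|l| <= B -> `|h| <= 1 ->
    A (l + h) + A (l - h) - 2 * A l <= C * h ^+ 2].

Hypothesis cA : cumulant_like.

(** [A c - c * a] and [A (- c) + c * a] are nonnegative, and their sum is the second difference of
    [A] at 0, hence at most [C * c ^+ 2]. *)
Lemma cumulant_slope e : 0 < e -> exists2 c, 0 < c &
  A c - c * a <= e * c /\ A (- c) + c * a <= e * c.
Proof.
have [A0 Aa /(_ 0)[C C0 AC]] := cA => e0.
pose c := Num.min 1 (e / (C + 1)).
have C1 : 0 < C + 1 by rewrite ltr_wpDl.
have c0 : 0 < c by rewrite lt_min ltr01 divr_gt0.
have c1 : c <= 1 by rewrite ge_min lexx.
have ce : C * c <= e.
  apply: (@le_trans _ _ ((C + 1) * c)); first by rewrite ler_wpM2r ?lerDl// ltW.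
  by rewrite mulrC -ler_pdivlMr// /c ge_min lexx orbT.
have := AC 0 c; rewrite normr0 lexx gtr0_norm// c1 add0r sub0r A0 mulr0 subr0.
move=> /(_ isT isT) h; exists c => //.
have := Aa c; have := Aa (- c); have : C * c ^+ 2 <= e * c.
  by rewrite expr2 mulrA ler_wpM2r// ltW.
by split; lra.
Qed.

Lemma energy_le_increment f r c u v : energy_le A f r -> 0 <= u -> u <= v -> 0 < c ->
  `|f v - f u| <= (r + (v - u) * (`|A c| + `|A (- c)|)) / c.
Proof.
move=> fr u0 uv c0; rewrite ler_pdivlMr// -(gtr0_norm c0) -normrM (gtr0_norm c0).
have h1 := energy_le_itv fr c u0 uv; have h2 := energy_le_itv fr (- c) u0 uv.
have vu : 0 <= v - u by rewrite subr_ge0.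
have k1 := ler_wpM2l vu (ler_norm (A c)).
have k2 := ler_wpM2l vu (ler_norm (A (- c))).
have k3 := mulr_ge0 vu (normr_ge0 (A c)).
have k4 := mulr_ge0 vu (normr_ge0 (A (- c))).
by rewrite ler_norml; apply/andP; split; lra.
Qed.

Lemma energy_le_equicontinuous r e : 0 < e -> exists2 d, 0 < d &
  forall f, energy_le A f r -> forall u v, 0 <= u -> 0 <= v -> `|v - u| < d ->
    `|f v - f u| < e.
Proof.
move=> e0; pose c := 2 * (`|r| + 1) / e.
have c0 : 0 < c by rewrite divr_gt0// mulr_gt0// ltr_wpDl.
pose K := `|A c| + `|A (- c)|; have K0 : 0 <= K by exact: addr_ge0.
have K1 : 0 < K + 1 by rewrite ltr_wpDl.
exists (K + 1)^-1; first by rewrite invr_gt0.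
move=> f fr; suff key u v : 0 <= u -> u <= v -> v - u < (K + 1)^-1 -> `|f v - f u| < e.
  move=> u v u0 v0; have [uv|/ltW vu] := leP u v.
    by rewrite ger0_norm ?subr_ge0//; exact: key.
  by rewrite distrC ger0_norm ?subr_ge0// distrC; exact: key.
move=> u0 uv uvd; apply: le_lt_trans (energy_le_increment fr u0 uv c0) _.
have uvK : (v - u) * K <= 1.
  apply: (@le_trans _ _ ((K + 1)^-1 * K)); first by rewrite ler_wpM2r// ltW.
  by rewrite mulrC ler_pdivrMr ?mul1r// lerDl.
rewrite ltr_pdivrMr// -/K; apply: (@le_lt_trans _ _ (`|r| + 1)).
  by rewrite lerD// ler_norm.
have -> : e * c = 2 * (`|r| + 1) by rewrite /c; field; exact: lt0r_neq0.
by rewrite ltr_pMl ?ltr1n// ltr_wpDl.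
Qed.

(** The multipliers [c] and [- c] on [[0, t]] give [|f t - a t| <= r / c + e t / 2], and [T] makes
    the first term at most [e t / 2]. *)
Lemma energy_le_tail r e : 0 < e -> exists2 T, 0 < T &
  forall f, energy_le A f r -> forall t, T <= t -> `|f t - a * t| <= e * t.
Proof.
move=> e0; have e20 : 0 < e / 2 by rewrite divr_gt0.
have [c c0 [ac ac']] := cumulant_slope e20.
exists (2 * (`|r| + 1) / (e * c)) => [|f fr t Tt].
  by rewrite divr_gt0 ?mulr_gt0// ltr_wpDl.
have t0 : 0 <= t.
  by apply: le_trans Tt; rewrite ltW// divr_gt0 ?mulr_gt0// ltr_wpDl.
move: Tt; rewrite ler_pdivrMr ?mulr_gt0// => Tt.
have h1 := energy_le_itv fr c (lexx 0) t0.
have h2 := energy_le_itv fr (- c) (lexx 0) t0.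
have f0 : f 0 = 0 by case: fr.
have k1 := ler_wpM2l t0 ac; have k2 := ler_wpM2l t0 ac'.
have rr := ler_norm r.
rewrite -(ler_pM2l c0) -{1}(gtr0_norm c0) -normrM.
by rewrite ler_norml f0 in h1 h2 *; apply/andP; split; lra.
Qed.

Lemma energy_sum_cvg (X : Type) (F : set_system X) {FF : Filter F}
    (ev : X -> R -> R) f : (forall t, 0 <= t -> ev g t @[g --> F] --> f t) ->
  forall n (u v l : 'I_n -> R), (forall i, 0 <= u i /\ u i <= v i) ->
  \sum_(i < n) (l i * (ev g (v i) - ev g (u i)) - (v i - u i) * A (l i)) @[g --> F]
    --> \sum_(i < n) (l i * (f (v i) - f (u i)) - (v i - u i) * A (l i)).
Proof.
move=> evf n u v l uv; apply: cvg_big => [|i _]; first exact: add_continuous.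
have [u0 uvi] := uv i.
apply: cvgB; last exact: cvg_cst.
apply: cvgM; first exact: cvg_cst.
by apply: cvgB; apply: evf => //; exact: le_trans uvi.
Qed.

Lemma energy_le_cvg (X : Type) (F : set_system X) {FF : ProperFilter F}
    (ev : X -> R -> R) f r : (forall t, 0 <= t -> ev g t @[g --> F] --> f t) ->
  (\forall g \near F, energy_le A (ev g) r) -> energy_le A f r.
Proof.
move=> evf er; split.
  apply: (@cvg_unique R (@Rhausdorff R) (ev g 0 @[g --> F]) _); first exact: evf.
  have c0 : (fun=> 0 : R) @ F --> (0 : R) by exact: cvg_cst.
  by apply: cvg_trans c0; apply: near_eq_cvg; apply: filterS er => g [-> _].
move=> n u v l uv tuv.
have /(_ FF) := @energy_sum_cvg X F (@filter_filter _ F _) ev f evf n u v l uv.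
move=> sc; rewrite leNgt; apply/negP => rs.
have near_gt := @cvgr_gt _ _ _ (@filter_filter _ F FF) _ _ sc _ rs.
have [g [rg [_ /(_ n u v l uv tuv)]]] := filter_ex (filterI near_gt er).
by rewrite leNgt rg.
Qed.

End cumulant.

Lemma energy_le_eq (R : realType) (A f g : R -> R) (r : R) :
  (forall t, 0 <= t -> g t = f t) -> energy_le A f r -> energy_le A g r.
Proof.
move=> gf [f0 fr]; split; first by rewrite gf.
move=> n u v l uv tuv; apply: le_trans (fr n u v l uv tuv).
rewrite le_eqVlt; apply/orP; left; apply/eqP; apply: eq_bigr => i _.
by have [u0 uvi] := uv i; rewrite !gf// (le_trans u0).
Qed.

Lemma ultra_fmap (X Y : Type) (f : X -> Y) (F : set_system X) :
  UltraFilter F -> UltraFilter (f @ F).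
Proof.
move=> UF; split; first exact: fmap_proper_filter.
move=> G GP FG; apply/seteqP; split => // B GB.
have [//|FB] := in_ultra_setVsetC (f @^-1` B) UF.
have /FG GB' : (f @ F) (~` B) by [].
have : G set0 by rewrite -(setICr B); exact: filterI.
by move=> /filter_not_empty.
Qed.

(** * The rate function on the weighted path space *)

Section weighted_paths.
Context {R : realType}.
Local Notation paths := (Cspace (0 : R)).
Implicit Types (f g : paths) (e t : R).

Lemma extendE f (s : halfline R) : extend f (\val s) = f s.
Proof. exact: (congr1 (fun h => h s) (valLK 0 f)). Qed.

Lemma extend_halfline f t (t0 : halfline R t) : extend f t = f (SigSub (mem_set t0)).
Proof. by rewrite -extendE. Qed.

Lemma rho_ballP f g e : rho_ball f e g ->
  forall t, 0 <= t -> `|extend f t - extend g t| < e * (1 + t).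
Proof.
move=> fge t t0; have ht : halfline R t by rewrite /halfline/= in_itv/= t0.
rewrite -ltr_pdivrMr ?ltr_wpDr// -lte_fin; apply: le_lt_trans fge.
apply: ereal_sup_ubound; exists (SigSub (mem_set ht)) => //=.
by rewrite !extend_halfline addr0 powRr1.
Qed.

Lemma rho_ballW f g e e' : e < e' ->
  (forall t, 0 <= t -> `|extend f t - extend g t| <= e * (1 + t)) ->
  rho_ball f e' g.
Proof.
move=> ee' fg; apply: (@le_lt_trans _ _ e%:E); last by rewrite lte_fin.
apply: ge_ereal_sup => _ [s _ <-].
have s0 : 0 <= \val s by have := set_valP s; rewrite /halfline/= in_itv/= andbT.
by rewrite lee_fin addr0 powRr1// ler_pdivrMr ?ltr_wpDr// -!extendE fg.
Qed.

Lemma nbhs_rho_ball f e : 0 < e -> nbhs f [set g | rho_ball f e g].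
Proof. by move=> e0; exact: (@nbhsx_ballx _ paths f e e0). Qed.

Lemma nbhs_rho f (U : set paths) : nbhs f U ->
  exists2 e, 0 < e & forall g, rho_ball f e g -> U g.
Proof. by move=> /nbhs_ballP[e /= e0 eU]; exists e. Qed.

Lemma extend_cvg f t : 0 <= t -> extend g t @[g --> f] --> extend f t.
Proof.
move=> t0; have FF : Filter (nbhs f) by exact: nbhs_filter.
apply/(@cvgrPdist_lt _ _ _ _ FF) => e e0.
have t1 : 0 < 1 + t by rewrite ltr_wpDr.
have := nbhs_rho_ball f (divr_gt0 e0 t1); apply: filterS => g.
by move=> /rho_ballP/(_ _ t0); rewrite divfK// lt0r_neq0.
Qed.

Section rate.
Variables (d : measure_display) (T : measurableType d) (P : probability T R).
Variables (xi : T -> R) (A : R -> R) (a : R).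
Hypothesis devA : deviation P xi = legendre A.
Hypothesis cA : cumulant_like A a.
Local Notation I := (rate_function P xi (kappa := 0)).

Lemma rate_function_leP f (r : R) : (I f <= r%:E)%E <-> energy_le A (extend f) r.
Proof.
have [A0 _ _] := cA.
rewrite /rate_function; case: asboolP => [[f0 fac]|nf].
  rewrite devA; split; first exact: energy_le_integral.
  exact: integral_energy_le.
split; first by rewrite leye_eq.
by move=> fr; exfalso; apply: nf; split; [case: fr|move=> b _; exact: energy_le_ac fr].
Qed.

Lemma rate_function_ge0 f : (0 <= I f)%E.
Proof.
rewrite /rate_function; case: ifP => _; last exact: leey.
apply: integral_ge0 => t _; rewrite devA; have [A0 _ _] := cA.
by apply: le_trans (legendre_ge A 0 _); rewrite mul0r A0 subr0.
Qed.

(** Exceeding [r >= 0] is witnessed by a nonzero [f 0] or by one finite dual sum above [r]; both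
    witnesses persist near [f] because evaluation at a time is continuous. *)
Lemma rate_function_lsc : lower_semicontinuous I.
Proof.
move=> f r rf; have [r0|r0] := ltP r 0.
  exists setT; first exact: filterT.
  by move=> g _; apply: lt_le_trans (rate_function_ge0 g); rewrite lte_fin.
have FF : Filter (nbhs f) by exact: nbhs_filter.
suff nearf : nbhs f [set g | ~ energy_le A (extend g) r].
  eexists; first exact: nearf.
  by move=> g /= ng; rewrite ltNge; apply/negP => /rate_function_leP.
have : ~ energy_le A (extend f) r by move/rate_function_leP; rewrite leNgt rf.
move=> /not_andP[/eqP f0|/existsNP[n] /existsNP[u] /existsNP[v] /existsNP[l]].
  have := @extend_cvg f _ (lexx 0).
  move=> /(@cvgr_neq0 _ _ _ _ FF)/(_ f0); apply: filterS => g /eqP g0 [].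
  by move=> ? _; exact: g0.
move=> /not_implyP[uv] /not_implyP[tuv] /negP; rewrite -ltNge => rsum.
have := @energy_sum_cvg R A paths (nbhs f) FF _ _ (@extend_cvg f) n u v l uv.
move=> sumcvg; have := @cvgr_gt _ _ _ FF _ _ sumcvg _ rsum.
apply: filterS => g rg [_ /(_ n u v l uv tuv)].
by rewrite leNgt rg.
Qed.

(** After time [D] both paths follow [a t] up to [e t], which the weight absorbs; before [D],
    equicontinuity carries the estimate over from the nodes, which are [h / 2] apart. *)
Lemma rho_close (r e : R) : 0 < e -> exists s : seq R, (forall t, t \in s -> 0 <= t) /\
  forall f g, energy_le A (extend f) r -> energy_le A (extend g) r ->
    (forall t, t \in s -> `|extend f t - extend g t| < e) -> rho_ball f (4 * e) g.
Proof.
move=> e0; have [D D0 tail] := energy_le_tail cA r e0.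
have [h h0 equi] := energy_le_equicontinuous A r e0.
pose N := (Num.truncn (2 * D / h)).+1.
exists [seq k%:R * (h / 2) | k <- iota 0 N]; split.
  by move=> _ /mapP[k _ ->]; rewrite mulr_ge0// divr_ge0// ltW.
move=> f g fr gr fg; apply: (@rho_ballW _ _ (3 * e)); first by rewrite ltr_pM2r// ltr_nat.
move=> t t0; have et : 0 <= e * t by rewrite mulr_ge0// ltW.
have [tD|Dt] := ltP t D; last first.
  have := tail _ fr _ Dt; have := tail _ gr _ Dt.
  rewrite distrC => gt ft.
  have -> : extend f t - extend g t = (extend f t - a * t) + (a * t - extend g t) by ring.
  by apply: le_trans (ler_normD _ _) _; lra.
have h2 : 0 < h / 2 by rewrite divr_gt0.
pose k := Num.truncn (t / (h / 2)).
have /andP[kt tk] : k%:R <= t / (h / 2) < k.+1%:R.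
  by apply: truncn_itv; rewrite divr_ge0// ltW.
rewrite ler_pdivlMr// in kt; rewrite ltr_pdivrMr// -[k.+1]addn1 natrD mulrDl mul1r in tk.
set u := k%:R * (h / 2) in kt tk.
have u0 : 0 <= u by rewrite mulr_ge0// ltW.
have us : u \in [seq k%:R * (h / 2) | k <- iota 0 N].
  apply/mapP; exists k => //; rewrite mem_iota add0n leq0n /= /N ltnS.
  apply: le_truncn; rewrite ler_pdivrMr//.
  have -> : 2 * D / h * (h / 2) = D by field; exact: lt0r_neq0.
  exact: ltW.
have tu : `|t - u| < h by rewrite ger0_norm ?subr_ge0//; lra.
have := equi _ fr _ _ u0 t0 tu; have := equi _ gr _ _ u0 t0 tu; have := fg _ us.
rewrite (distrC (extend g t)) => h1 h3 h4.
have -> : extend f t - extend g t = (extend f t - extend f u) +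
  (extend f u - extend g u) + (extend g u - extend g t) by ring.
apply: le_trans (ler_normD _ _) _; have := ler_normD (extend f t - extend f u)
  (extend f u - extend g u); lra.
Qed.

Lemma energy_le_path (f : R -> R) (r : R) : energy_le A f r ->
  exists g : paths, forall t, 0 <= t -> extend g t = f t.
Proof.
move=> fr.
have val0 (s : halfline R) : 0 <= \val s.
  by have := set_valP s; rewrite /halfline/= in_itv/= andbT.
have cf : continuous (fun s : halfline R => f (\val s)).
  move=> s; have FF : Filter (nbhs s) by exact: nbhs_filter.
  apply/(@cvgrPdist_lt _ _ _ _ FF) => e e0; have [d0 d00 equi] := energy_le_equicontinuous A r e0.
  have cval : \val s' @[s' --> s] --> (\val s : R) by exact: initial_continuous.
  have /(@cvgrPdist_lt _ _ _ _ FF)/(_ _ d00) := cval; apply: filterS => s' ss'.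
  exact: equi.
exists (mkcts cf) => t t0.
have ht : halfline R t by rewrite /halfline/= in_itv/= t0.
by rewrite (extend_halfline _ ht).
Qed.

(** Along an ultrafilter in the level set the values at each time are bounded, hence converge. The
    limit keeps the energy bound, so it is a continuous path, and [rho_close] upgrades pointwise
    convergence to convergence in the metric. *)
Lemma rate_function_compact (r : R) : compact [set f | (I f <= r%:E)%E].
Proof.
rewrite compact_ultra => F UF Fr.
have {}Fr : \forall f \near F, energy_le A (extend f) r.
  by apply: filterS Fr => f /rate_function_leP.
have lims t : exists y : R, 0 <= t -> extend f t @[f --> F] --> y.
  have [t0|t0] := leP 0 t; last by exists 0.
  pose M := r + t * (`|A 1| + `|A (- 1)|).
  have := @segment_compact R (- M) M; rewrite compact_ultra.
  move=> /(_ (extend f t @[f --> F]) (ultra_fmap _ _)) [|y [_ Fy]]; last by exists y.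
  apply: filterS Fr => f fr; rewrite /= in_itv/= -ler_norml.
  have := energy_le_increment fr (lexx 0) t0 ltr01.
  by rewrite (fr.1) subr0 divr1 subr0.
have /choice[phi Fphi] := lims.
have phir : energy_le A phi r.
  by apply: (energy_le_cvg (ev := fun f t => extend f t) Fphi).
have [g gphi] := energy_le_path phir.
have gr : energy_le A (extend g) r by apply: energy_le_eq phir => t /gphi.
exists g; split; first exact/rate_function_leP.
move=> U /nbhs_rho[e e0 gU].
have [|s [s0 close]] := @rho_close r (e / 4); first by rewrite divr_gt0.
have : \forall f \near F, forall t, t \in s -> `|extend g t - extend f t| < e / 4.
  elim: s s0 {close} => [_|t s IH s0]; first by apply: nearW => f t; rewrite in_nil.
  have ht : \forall f \near F, `|extend g t - extend f t| < e / 4.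
    have t0 : 0 <= t by apply: s0; rewrite mem_head.
    have /cvgrPdist_lt := Fphi t t0; rewrite -gphi//; apply; exact: divr_gt0.
  have hs := IH (fun t' ts => s0 t' (mem_behead (s := t :: s) ts)).
  apply: filterS2 ht hs => f ft fs t'; rewrite in_cons => /predU1P[->//|]; exact: fs.
apply: filterS2 Fr => f fr fs; apply: gU; have := close g f gr fr fs.
by rewrite mulrC divfK.
Qed.

Lemma rate_function_good : good_rate_function I.
Proof.
split; [exact: rate_function_ge0|exact: rate_function_lsc|].
by move=> r _; exact: rate_function_compact.
Qed.

End rate.

End weighted_paths.

(** * Polygonal paths *)

Section polygons.
Context {R : realType}.
Implicit Types (S : nat -> R) (u v t e : R) (k n p : nat).

(** The right endpoint is included: there [Num.truncn] jumps to [k.+1], but both formulas give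
    [S k.+1]. *)
Lemma polyline_itv S k u : k%:R <= u <= k.+1%:R ->
  polyline S u = S k + (u - k%:R) * (S k.+1 - S k).
Proof.
move=> /andP[ku]; rewrite le_eqVlt => /predU1P[->|uk]; last first.
  by rewrite /polyline (truncn_def (n := k)) ?ku.
rewrite /polyline (truncn_def (n := k.+1)); last by rewrite lexx ltr_nat ltnSn.
by rewrite subrr mul0r addr0 -[k.+1]addn1 natrD addrAC subrr add0r mul1r subrKC.
Qed.

Lemma polyline_node S k : polyline S k%:R = S k.
Proof. by rewrite (@polyline_itv _ k) ?subrr ?mul0r ?addr0// lexx ler_nat leqnSn. Qed.

Lemma polyline_lipschitz S (L : R) : (forall k, `|S k.+1 - S k| <= L) ->
  forall u v, 0 <= u -> u <= v -> `|polyline S v - polyline S u| <= L * (v - u).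
Proof.
move=> SL; suff key m u v : 0 <= u -> u <= v -> v <= (Num.truncn u).+1%:R + m%:R ->
    `|polyline S v - polyline S u| <= L * (v - u).
  move=> u v u0 uv; apply: (key (Num.truncn v).+1) => //.
  by rewrite (le_trans (ltW (truncnS_gt v)))// lerDr.
elim: m u => [|m IH] u u0 uv; set k := Num.truncn u => vk;
    have /andP[ku uk] : k%:R <= u < k.+1%:R by exact: truncn_itv.
  rewrite addr0 in vk; rewrite !(@polyline_itv S k) ?ku ?(ltW uk) ?vk ?(le_trans ku uv)//.
  have -> : S k + (v - k%:R) * (S k.+1 - S k) - (S k + (u - k%:R) * (S k.+1 - S k)) =
    (S k.+1 - S k) * (v - u) by ring.
  by rewrite normrM (ger0_norm (x := v - u)) ?subr_ge0// ler_wpM2r ?subr_ge0.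
have [vk'|kv] := leP v k.+1%:R.
  rewrite !(@polyline_itv S k) ?ku ?(ltW uk) ?vk' ?(le_trans ku uv)//.
  have -> : S k + (v - k%:R) * (S k.+1 - S k) - (S k + (u - k%:R) * (S k.+1 - S k)) =
    (S k.+1 - S k) * (v - u) by ring.
  by rewrite normrM (ger0_norm (x := v - u)) ?subr_ge0// ler_wpM2r ?subr_ge0.
have h1 : `|polyline S v - polyline S k.+1%:R| <= L * (v - k.+1%:R).
  apply: IH => //; first exact: ltW.
  by move: vk; rewrite natrK -!natr1; lra.
have h2 : `|polyline S k.+1%:R - polyline S u| <= L * (k.+1%:R - u).
  rewrite !(@polyline_itv S k) ?ku ?(ltW uk) ?ler_nat ?lexx ?leqnSn ?ltnSn//.
  have -> : S k + (k.+1%:R - k%:R) * (S k.+1 - S k) -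
      (S k + (u - k%:R) * (S k.+1 - S k)) = (S k.+1 - S k) * (k.+1%:R - u) by ring.
  have uk' : 0 <= k.+1%:R - u by rewrite subr_ge0 ltW.
  by rewrite normrM (ger0_norm uk') ler_wpM2r.
have -> : polyline S v - polyline S u = (polyline S v - polyline S k.+1%:R) +
  (polyline S k.+1%:R - polyline S u) by ring.
by apply: le_trans (ler_normD _ _) _; lra.
Qed.

Lemma lipschitz_absolutely_continuous (f : R -> R) (L b : R) :
  (forall u v, 0 <= u -> u <= v -> `|f v - f u| <= L * (v - u)) ->
  absolutely_continuous_on 0 b f.
Proof.
move=> fL e e0; have L1 : 0 < `|L| + 1 by rewrite ltr_wpDl.
exists (e / (`|L| + 1)); first by rewrite divr_gt0.
move=> n u v uvb _; rewrite ltr_pdivlMr// => uvd.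
apply: le_lt_trans uvd; rewrite mulr_suml; apply: ler_sum => i _.
have [u0 uv _] := uvb i; apply: le_trans (fL _ _ u0 uv) _.
rewrite mulrC ler_wpM2l ?subr_ge0//; have := ler_norm L; lra.
Qed.

(** Within a cell [f] varies by at most [e], and the interpolation weights average the node factors
    [1 + k / n] to exactly [1 + t]; the total is [2 e + e t]. *)
Lemma polyline_close S (f : R -> R) n e : (0 < n)%N -> 0 <= e ->
  (forall k, `|S k - f (k%:R / n%:R)| <= e * (1 + k%:R / n%:R)) ->
  (forall u v, 0 <= u -> 0 <= v -> `|v - u| <= n%:R^-1 -> `|f v - f u| <= e) ->
  forall t, 0 <= t -> `|polyline S (n%:R * t) - f t| <= 2 * e * (1 + t).
Proof.
move=> n0 e0 Sf fe t t0; have n0' : 0 < n%:R :> R by rewrite ltr0n.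
pose k := Num.truncn (n%:R * t).
have /andP[kt tk] : k%:R <= n%:R * t < k.+1%:R by apply: truncn_itv; rewrite mulr_ge0.
rewrite (@polyline_itv S k) ?kt ?(ltW tk)//.
set th := n%:R * t - k%:R; have th0 : 0 <= th by rewrite subr_ge0.
have th1 : 0 <= 1 - th by rewrite subr_ge0 lerBlDr addrC natr1 ltW.
have tE : t = (1 - th) * (k%:R / n%:R) + th * (k.+1%:R / n%:R).
  by rewrite /th -natr1; field; exact: lt0r_neq0.
have ft0 : `|f (k%:R / n%:R) - f t| <= e.
  apply: fe => //.
  have -> : k%:R / n%:R - t = - (th / n%:R) by rewrite /th; field; exact: lt0r_neq0.
  by rewrite normrN ger0_norm ?divr_ge0// ler_piMl ?invr_ge0//; lra.
have ft1 : `|f (k.+1%:R / n%:R) - f t| <= e.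
  apply: fe => //.
  have -> : k.+1%:R / n%:R - t = (1 - th) / n%:R.
    by rewrite /th -natr1; field; exact: lt0r_neq0.
  by rewrite ger0_norm ?divr_ge0// ler_piMl ?invr_ge0//; lra.
have -> : S k + th * (S k.+1 - S k) - f t =
  (1 - th) * ((S k - f (k%:R / n%:R)) + (f (k%:R / n%:R) - f t)) +
  th * ((S k.+1 - f (k.+1%:R / n%:R)) + (f (k.+1%:R / n%:R) - f t)) by ring.
have h k' x : 0 <= x -> `|f (k'%:R / n%:R) - f t| <= e ->
    `|x * (S k' - f (k'%:R / n%:R) + (f (k'%:R / n%:R) - f t))| <=
    x * (e * (1 + k'%:R / n%:R) + e).
  move=> x0 fk; rewrite normrM ger0_norm// ler_wpM2l//.
  by apply: le_trans (ler_normD _ _) _; exact: lerD.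
apply: le_trans (ler_normD _ _) _.
apply: le_trans (lerD (h _ _ th1 ft0) (h _ _ th0 ft1)) _.
have -> : (1 - th) * (e * (1 + k%:R / n%:R) + e) + th * (e * (1 + k.+1%:R / n%:R) + e) =
  2 * e + e * ((1 - th) * (k%:R / n%:R) + th * (k.+1%:R / n%:R)) by ring.
by rewrite -tE; have := mulr_ge0 e0 t0; lra.
Qed.

Lemma polyline_dist S S' n e : (0 < n)%N ->
  (forall k, `|S k - S' k| <= e * (1 + k%:R / n%:R)) ->
  forall t, 0 <= t -> `|polyline S (n%:R * t) - polyline S' (n%:R * t)| <= e * (1 + t).
Proof.
move=> n0 SS t t0; have n0' : 0 < n%:R :> R by rewrite ltr0n.
pose k := Num.truncn (n%:R * t).
have /andP[kt tk] : k%:R <= n%:R * t < k.+1%:R by apply: truncn_itv; rewrite mulr_ge0.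
rewrite !(@polyline_itv _ k) ?kt ?(ltW tk)//.
set th := n%:R * t - k%:R; have th0 : 0 <= th by rewrite subr_ge0.
have th1 : 0 <= 1 - th by rewrite subr_ge0 lerBlDr addrC natr1 ltW.
have tE : t = (1 - th) * (k%:R / n%:R) + th * (k.+1%:R / n%:R).
  by rewrite /th -natr1; field; exact: lt0r_neq0.
have -> : S k + th * (S k.+1 - S k) - (S' k + th * (S' k.+1 - S' k)) =
  (1 - th) * (S k - S' k) + th * (S k.+1 - S' k.+1) by ring.
apply: le_trans (ler_normD _ _) _; rewrite !normrM (ger0_norm th0) (ger0_norm th1).
apply: le_trans (lerD (ler_wpM2l th1 (SS k)) (ler_wpM2l th0 (SS k.+1))) _.
have -> : (1 - th) * (e * (1 + k%:R / n%:R)) + th * (e * (1 + k.+1%:R / n%:R)) =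
  e * (1 + ((1 - th) * (k%:R / n%:R) + th * (k.+1%:R / n%:R))) by ring.
by rewrite -tE.
Qed.

Lemma extend_polygonal S n t : 0 <= t ->
  extend (polygonal_path (0 : R) S (ler0n R n)) t = polyline S (n%:R * t).
Proof.
move=> t0; have ht : halfline R t by rewrite /halfline/= in_itv/= t0.
by rewrite (extend_halfline _ ht).
Qed.

(** The nodes of a path with slope [y i] during the [i]-th block of [p] steps. Dividing by [n] makes
    [y i] the true slope; the passage from [x n] to [n] is paid for separately. *)
Definition block_nodes (y : nat -> R) p n k : R := (\sum_(j < k) y (j %/ p)%N) / n%:R.

Lemma sum_blocks (V : nmodType) (F : nat -> V) p N :
  \sum_(0 <= k < N * p) F (k %/ p)%N = \sum_(0 <= i < N) F i *+ p.
Proof.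
elim: N => [|N IH]; first by rewrite mul0n !big_geq.
rewrite mulSn addnC (@big_cat_nat _ _ _ (N * p))/= ?leq_addr// IH big_nat_recr//=.
congr (_ + _); rewrite -{1}[(N * p)%N]add0n big_addn addnC addnK.
rewrite (eq_big_nat _ _ (F2 := fun=> F N)) ?sumr_const_nat ?subn0// => k /andP[_ kp].
by rewrite addnC divnMDl ?divn_small ?addn0// (leq_ltn_trans _ kp).
Qed.

Section rate.
Variables (d : measure_display) (T : measurableType d) (P : probability T R).
Variables (xi : T -> R) (A : R -> R) (a : R).
Hypothesis devA : deviation P xi = legendre A.
Hypothesis cA : cumulant_like A a.
Local Notation I := (rate_function P xi (kappa := 0)).

Lemma legendre_ge0 z : (0 <= legendre A z)%E.
Proof.
by have [A0 _ _] := cA; apply: le_trans (legendre_ge A 0 _); rewrite mul0r A0 subr0.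
Qed.

Lemma legendre_mean : legendre A a = 0%E.
Proof.
apply/eqP; rewrite eq_le legendre_ge0 andbT; apply/legendre_le => l.
by have [_ Aa _] := cA; rewrite subr_le0.
Qed.

(** Off the countable set of nodes the derivative is the slope of the cell; the Lipschitz bound [L]
    supplies absolute continuity. *)
Lemma polygonal_rate S n (L r : R) : (0 < n)%N -> S 0%N = 0 ->
  (forall k, `|S k.+1 - S k| <= L) ->
  (forall N, \sum_(0 <= k < N)
     (n%:R^-1)%:E * legendre A (n%:R * (S k.+1 - S k))%R <= r%:E)%E ->
  (I (polygonal_path 0 S (ler0n R n)) <= r%:E)%E.
Proof.
move=> n0 S0 SL Sr; set g := polygonal_path _ _ _.
have n0' : 0 < n%:R :> R by rewrite ltr0n.
have h0 : 0 < n%:R^-1 :> R by rewrite invr_gt0.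
have gE t : 0 <= t -> extend g t = polyline S (n%:R * t) by exact: extend_polygonal.
rewrite /rate_function; case: asboolP => [_|]; last first.
  case; split; first by rewrite gE// mulr0 -[0]/(0%:R) polyline_node.
  move=> b b0; apply: (@lipschitz_absolutely_continuous _ (L * n%:R)) => u v u0 uv.
  rewrite !gE ?(le_trans u0 uv)//.
  apply: le_trans (polyline_lipschitz SL _ _) _; rewrite ?mulr_ge0 ?ler_pM2l//.
  by rewrite -mulrBr mulrA.
rewrite devA.
pose c k := legendre A (n%:R * (S k.+1 - S k)).
apply: (@le_trans _ _ (\int[lebesgue_measure]_(t in halfline R) step n%:R^-1 c t)%E).
  apply: ge0_ae_le_integral => [t _|t _|]; [exact: legendre_ge0|exact: legendre_ge0|].
  pose N : set R := \bigcup_k [set k%:R * n%:R^-1].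
  have N0 : (@lebesgue_measure R) N = 0%E.
    apply: countable_lebesgue_measure0; exact: bigcup_countable.
  exists N; split => //.
    by apply: bigcup_measurable => k _; exact: measurable_set1.
  move=> t /= /not_implyP[]; rewrite /halfline/= in_itv/= andbT => t0 ht.
  pose k := Num.truncn (t / n%:R^-1); exists k => //=.
  apply: contrapT => tk; apply: ht.
  have := truncn_mesh h0 t0; rewrite /mesh/= in_itv/= -/k => /andP[kt tk'].
  have {kt tk}kt : k%:R * n%:R^-1 < t.
    by rewrite lt_neqAle kt andbT; apply/eqP => tk''; apply: tk.
  rewrite /step -/k /c; suff -> : (extend g)^`()%classic t = n%:R * (S k.+1 - S k) by [].
  set D := S k.+1 - S k.
  have near_eq : \forall s \near t, S k - k%:R * D + (n%:R * D) *: s = extend g s.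
    have : \forall s \near t, k%:R * n%:R^-1 < s < k.+1%:R * n%:R^-1.
      by apply: near_in_itvoo; rewrite in_itv/= kt.
    apply: filterS => s /andP[ks sk]; rewrite ltr_pdivrMr// in ks; rewrite ltr_pdivlMr// in sk.
    have s0 : 0 <= s by rewrite -(pmulr_lge0 _ n0') (le_trans _ (ltW ks)).
    rewrite gE// (@polyline_itv _ k) ?(mulrC n%:R) ?(ltW ks) ?(ltW sk)//.
    by rewrite /GRing.scale/= -/D; ring.
  rewrite derive1E; suff [_ ->] : is_derive t 1 (extend g) (n%:R * D) by [].
  apply: near_eq_is_derive near_eq _.
  rewrite -[X in is_derive _ _ _ X]add0r; apply: is_deriveD.
  by rewrite -[X in is_derive _ _ _ X]mulr1; apply: is_deriveZ.
rewrite step_integral// => [|k]; last exact: legendre_ge0.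
apply: lime_le; last by apply: nearW => N; exact: Sr.
apply: is_cvg_nneseries => k _ _; apply: mule_ge0; last exact: legendre_ge0.
by rewrite lee_fin ltW.
Qed.

(** From block [M] on the slope is [a], where [legendre A] vanishes, so only [M] blocks
    contribute. *)
Lemma block_path_rate n p M (y : nat -> R) (r : R) : (0 < n)%N -> (0 < p)%N ->
  (forall i, (M <= i)%N -> y i = a) ->
  (\sum_(0 <= i < M) (p%:R / n%:R)%:E * legendre A (y i) <= r%:E)%E ->
  (I (polygonal_path 0 (block_nodes y p n) (ler0n R n)) <= r%:E)%E.
Proof.
move=> n0 p0 ya yr; have n0' : 0 < n%:R :> R by rewrite ltr0n.
have inc k : block_nodes y p n k.+1 - block_nodes y p n k = y (k %/ p)%N / n%:R.
  by rewrite /block_nodes big_ord_recr/= -mulrBl addrAC subrr add0r.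
pose L := (`|a| + \sum_(0 <= i < M) `|y i|) / n%:R.
apply: (@polygonal_rate _ _ L) => //.
- by rewrite /block_nodes big_ord0 mul0r.
- move=> k; rewrite inc normrM normfV (gtr0_norm n0') ler_pM2r ?invr_gt0//.
  have [kM|Mk] := ltnP (k %/ p) M; last by rewrite ya// lerDl sumr_ge0.
  rewrite (bigD1_seq (k %/ p)%N)/= ?iota_uniq ?mem_index_iota//.
  by rewrite addrCA lerDl addr_ge0// sumr_ge0.
- move=> N; apply: le_trans yr.
  have cE k : ((n%:R^-1)%:E * legendre A (n%:R * (block_nodes y p n k.+1 -
      block_nodes y p n k))%R = (n%:R^-1)%:E * legendre A (y (k %/ p)%N))%E.
    by rewrite inc mulrC divfK// lt0r_neq0.
  rewrite (eq_bigr _ (fun k _ => cE k)).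
  have c0 k : (0 <= (n%:R^-1)%:E * legendre A (y k))%E.
    by rewrite mule_ge0 ?legendre_ge0// lee_fin invr_ge0.
  (* The range is enlarged to whole blocks, at least [M] of them. *)
  have NN : (N <= (N + M) * p)%N.
    by rewrite (leq_trans (leq_addr M N))// leq_pmulr.
  apply: (@le_trans _ _ (\sum_(0 <= k < (N + M) * p)
      (n%:R^-1)%:E * legendre A (y (k %/ p)%N))%E).
    by rewrite [leRHS](@big_cat_nat _ _ _ N)//= leeDl// sume_ge0.
  rewrite (sum_blocks (fun i => (n%:R^-1)%:E * legendre A (y i))%E).
  rewrite (@big_cat_nat _ _ _ M)//= ?leq_addl//.
  rewrite [X in (_ + X)%E]big_nat_cond [X in (_ + X)%E]big1 ?adde0; last first.
    move=> i /andP[/andP[Mi _] _].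
    by rewrite ya// legendre_mean mule0 mul0rn.
  apply: lee_sum => i _; rewrite -[X in (X <= _)%E]mule_natl muleA -EFinM.
  by [].
Qed.

End rate.

End polygons.

(** * Exponential moments of the walk *)

Section product_expectation.
Context d (T : measurableType d) (R : realType).
Variable P : probability T R.
Local Open Scope ereal_scope.
Import HBNNSimple.

(** Linearity extends the factorisation from indicators to simple functions, and monotone
    convergence from these to [f]. *)
Lemma ge0_integral_indic_factor (G : T -> R) (X : T -> R) (c : R) :
  measurable_fun setT G -> (forall w, 0 <= G w)%R -> measurable_fun setT X ->
  (0 <= c)%R ->
  (forall B : set R, measurable B ->
    \int[P]_w (G w * \1_B (X w))%:E = c%:E * \int[P]_w (\1_B (X w))%:E) ->
  forall f : R -> R, measurable_fun setT f -> (forall x, 0 <= f x)%R ->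
    \int[P]_w (G w * f (X w))%:E = c%:E * \int[P]_w (f (X w))%:E.
Proof.
move=> mG G0 mX c0 ind f mf f0.
have simple (h : {nnsfun R >-> R}) :
    \int[P]_w (G w * h (X w))%:E = c%:E * \int[P]_w (h (X w))%:E.
  have mset (r : R) : measurable (h @^-1` [set r]) by exact: measurable_funPTI.
  have mind (r : R) : measurable_fun setT (fun w => \1_(h @^-1` [set r]) (X w) : R).
    by apply: measurableT_comp mX; exact: measurable_indic.
  pose s : seq R := finmap.enum_fset (fset_set (h @` setT)).
  have s0 i : (0 <= s`_i)%R.
    have [lis|lsi] := ltnP i (size s); last by rewrite nth_default.
    have : s`_i \in fset_set (h @` setT) by exact: (mem_nth 0%R lis).
    by rewrite in_fset_set// => /set_mem[x _ <-].
  have hE x : h x = (\sum_(i < size s) s`_i * \1_(h @^-1` [set s`_i]) x)%R.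
    exact: fimfunEord.
  transitivity (\sum_(i < size s) \int[P]_w
      ((s`_i)%:E * (G w * \1_(h @^-1` [set s`_i]) (X w))%:E)).
    rewrite -ge0_integral_sum//.
    - apply: eq_integral => w _; rewrite sumEFin; congr EFin.
      by rewrite hE mulr_sumr; apply: eq_bigr => i _; rewrite mulrCA.
    - move=> i; apply: measurable_funeM; apply/measurable_EFinP.
      exact: measurable_funM.
    - by move=> i w _; apply: mule_ge0; rewrite lee_fin ?mulr_ge0.
  transitivity (c%:E * \sum_(i < size s) \int[P]_w
      ((s`_i)%:E * (\1_(h @^-1` [set s`_i]) (X w))%:E)); last first.
    congr (_ * _); rewrite -ge0_integral_sum//.
    - by apply: eq_integral => w _; rewrite sumEFin; congr EFin; rewrite hE.
    - by move=> i; apply: measurable_funeM; exact/measurable_EFinP.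
    - by move=> i w _; apply: mule_ge0; rewrite lee_fin.
  rewrite ge0_sume_distrr; last first.
    by move=> i _; apply: integral_ge0 => w _; apply: mule_ge0; rewrite lee_fin.
  apply: eq_bigr => i _; rewrite ge0_integralZl//.
  - rewrite (ind _ (mset _)).
    have -> : \int[P]_w ((s`_i)%:E * (\1_(h @^-1` [set s`_i]) (X w))%:E) =
        (s`_i)%:E * \int[P]_w (\1_(h @^-1` [set s`_i]) (X w))%:E.
      apply: ge0_integralZl => //; first by apply/measurable_EFinP; exact: mind.
      by rewrite lee_fin.
    by rewrite muleCA.
  - by apply/measurable_EFinP; exact: measurable_funM.
  - by move=> w _; rewrite lee_fin mulr_ge0.
  - by rewrite lee_fin.
have mf' : measurable_fun setT (EFin \o f) by exact/measurable_EFinP.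
pose h := nnsfun_approx measurableT mf'.
have hf x : EFin \o h^~ x @ \oo --> (f x)%:E.
  by apply: (cvg_nnsfun_approx measurableT mf') => // y _; rewrite lee_fin.
have mh n : measurable_fun setT (fun w => h n (X w)).
  exact: measurableT_comp mX.
have ndh : forall x, {homo (fun n => h n x) : m n / (m <= n)%N >-> (m <= n)%R}.
  by move=> x m n mn; exact/lefP/nd_nnsfun_approx.
transitivity (limn (fun n => \int[P]_w (G w * h n (X w))%:E)).
  rewrite -monotone_convergence//.
  - apply: eq_integral => w _; apply/esym/cvg_lim => //.
    under eq_fun do rewrite EFinM; rewrite EFinM.
    by apply: cvgeZl => //; exact: hf.
  - by move=> n; apply/measurable_EFinP; exact: measurable_funM.
  - by move=> n w _; rewrite lee_fin mulr_ge0.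
  - by move=> w _ m n mn; rewrite lee_fin ler_wpM2l// ndh.
transitivity (limn (fun n => c%:E * \int[P]_w (h n (X w))%:E)).
  by congr (limn _); apply/funext => n; exact: simple.
rewrite limeMl//; last first.
  apply: ereal_nondecreasing_is_cvgn => m n mn; apply: ge0_le_integral => //.
  - by move=> w _; rewrite lee_fin.
  - exact/measurable_EFinP.
  - exact/measurable_EFinP.
  - by move=> w _; rewrite lee_fin ndh.
congr (_ * _); rewrite -monotone_convergence//.
- by apply: eq_integral => w _; apply/cvg_lim => //; exact: hf.
- by move=> n; exact/measurable_EFinP.
- by move=> n w _; rewrite lee_fin.
- by move=> w _ m n mn; rewrite lee_fin ndh.
Qed.

Variable X : nat -> {RV P >-> R}.
Hypothesis iX : mutually_independent X.

Lemma expectation_prod N (f : nat -> R -> R) (m : nat -> R) :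
  (forall k, measurable_fun setT (f k)) -> (forall k x, 0 <= f k x)%R ->
  (forall k, \int[P]_w (f k (X k w))%:E = (m k)%:E) ->
  \int[P]_w (\prod_(k < N) f k (X k w))%:E = (\prod_(k < N) m k)%:E.
Proof.
have mX k : measurable_fun setT (X k) by [].
have mindX k B : measurable B -> measurable_fun setT (fun w => \1_B (X k w) : R).
  by move=> mB; apply: measurableT_comp (mX k); exact: measurable_indic.
have ind_fin k B : measurable B ->
    \int[P]_w (\1_B (X k w))%:E = (fine (P (X k @^-1` B)))%:E.
  move=> mB; have mXB : measurable (X k @^-1` B) by exact: measurable_funPTI.
  by rewrite (@integral_indic _ _ _ P setT measurableT _ mXB) setIT fineK// fin_num_measure.
move=> mf f0 fm.
(* Hybrid families: indices below [j] already carry [f k], the others still an indicator.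
   Independence is the case [j = 0], and one index is exchanged at a time. *)
pose g j (B : nat -> set R) k := if (k < j)%N then f k else \1_(B k).
pose e j (B : nat -> set R) k := if (k < j)%N then m k else fine (P (X k @^-1` (B k))).
have gm j B : (forall k, measurable (B k)) ->
    forall k, \int[P]_w (g j B k (X k w))%:E = (e j B k)%:E.
  by move=> mB k; rewrite /g /e; case: ifPn => _; [exact: fm|exact: ind_fin].
have mg j B : (forall k, measurable (B k)) -> forall k, measurable_fun setT (g j B k).
  by move=> mB k; rewrite /g; case: ifPn => _ //; exact: measurable_indic.
have g0 j B k x : (0 <= g j B k x)%R by rewrite /g; case: ifPn => _.
have e0 j B : (forall k, measurable (B k)) -> forall k, (0 <= e j B k)%R.
  by move=> mB k; rewrite -lee_fin -gm//; apply: integral_ge0 => w _; rewrite lee_fin.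
suff key j B : (forall k, measurable (B k)) -> (j <= N)%N ->
    \int[P]_w (\prod_(k < N) g j B k (X k w))%:E = (\prod_(k < N) e j B k)%:E.
  have := key N (fun=> setT) (fun=> measurableT) (leqnn N).
  rewrite (eq_bigr (fun k : 'I_N => m k)) => [<-|i _]; last by rewrite /e ltn_ord.
  apply: eq_integral => w _; congr EFin; apply: eq_bigr => i _.
  by rewrite /g ltn_ord.
elim: j B => [B mB _|j IH B mB jN].
  have mB' k : measurable (X k @^-1` B k) by exact: measurable_funPTI.
  pose C := \bigcap_(j in [set` iota 0 N]) (X j @^-1` B j).
  have mC : measurable C by apply: bigcap_measurableType.
  transitivity (\int[P]_w (\1_C w)%:E).
    apply: eq_integral => w _; congr EFin; rewrite indicE.
    have [wC|wC] := boolP (w \in C).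
      apply: big1 => k _; rewrite /g /= indicE mem_set//.
      by move/set_mem: wC => /(_ k); apply; rewrite /= mem_iota add0n ltn_ord.
    have [k kN kB] : exists2 k : nat, (k < N)%N & ~ B k (X k w).
      apply: contrapT => nB; move: wC; rewrite notin_setE; apply => k /=.
      rewrite mem_iota add0n => kN; apply: contrapT => kB; apply: nB.
      by exists k.
    rewrite (bigD1 (Ordinal kN))//= [X in (X * _)%R](_ : _ = 0%R) ?mul0r//.
    by rewrite /g /= indicE memNset.
  transitivity (P C); first by rewrite integral_indic// setIT.
  have -> : P C = \prod_(j <- iota 0 N) P (X j @^-1` B j).
    by apply: iX => //; exact: iota_uniq.
  rewrite -prodEFin.
  have -> : iota 0 N = index_iota 0 N by rewrite /index_iota subn0.
  rewrite big_mkord.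
  by apply: eq_bigr => k _; rewrite /e /= fineK// fin_num_measure.
pose j' := Ordinal jN.
have mG : measurable_fun setT (fun w => \prod_(k < N | k != j') g j B k (X k w))%R.
  under eq_fun do rewrite -big_filter.
  by apply: measurable_prod => k _; apply: measurableT_comp (mX k); exact: mg.
transitivity (\int[P]_w ((\prod_(k < N | k != j') g j B k (X k w)) * f j (X j w))%R%:E).
  apply: eq_integral => w _; congr EFin; rewrite (bigD1 j')//= mulrC; congr (_ * _)%R.
    apply: eq_bigr => k kj; rewrite /g ltnS leq_eqVlt.
    by have -> : (k == j :> nat) = false by apply/negbTE.
  by rewrite /g ltnSn.
rewrite (@ge0_integral_indic_factor _ _ (\prod_(k < N | k != j') e j B k)%R)//.
- rewrite fm -EFinM [in RHS](bigD1 j')//= [in RHS]mulrC; congr (_ * _)%R%:E; last first.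
    by rewrite /e ltnSn.
  apply: eq_bigr => k kj; rewrite /e [in RHS]ltnS [in RHS]leq_eqVlt.
  by have -> : (k == j :> nat) = false by apply/negbTE.
- by move=> w; exact: prodr_ge0.
- by apply: prodr_ge0 => k _; exact: e0.
(* The factorisation for an arbitrary measurable [C] is the induction hypothesis with [B j] replaced
   by [C]; this is why [key] quantifies over [B]. *)
- move=> C mC; pose B' k := if k == j then C else B k.
  have mB' k : measurable (B' k) by rewrite /B'; case: ifP.
  have Bg k : k != j -> g j B' k = g j B k by move=> kj; rewrite /g /B' (negbTE kj).
  have Be k : k != j -> e j B' k = e j B k by move=> kj; rewrite /e /B' (negbTE kj).
  have := IH B' mB' (ltnW jN); rewrite [in RHS](bigD1 j')//= EFinM muleC.
  rewrite (eq_bigr (fun k : 'I_N => e j B k)) => [|k kj]; last by rewrite Be.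
  have -> : e j B' j = fine (P (X j @^-1` C)) by rewrite /e ltnn /B' eqxx.
  rewrite -ind_fin// => <-; apply: eq_integral => w _; congr EFin.
  rewrite [in RHS](bigD1 j')//= mulrC; congr (_ * _)%R.
    by rewrite /g ltnn /B' eqxx.
  by apply: eq_bigr => k kj; rewrite Bg.
Qed.

End product_expectation.

(** * Second differences of exponentials and of the cumulant generating function *)

Section exponential_inequalities.
Context {R : realType}.
Implicit Types (u x l h b : R).

(** With [v = u / 2 >= 0] the left side is the square of [expR v - expR (- v)], which
    [1 - 2 v <= expR (- 2 v)] bounds by [2 v expR v]. *)
Lemma expR_second_difference u : expR u + expR (- u) - 2 <= u ^+ 2 * expR `|u|.
Proof.
wlog u0 : u / 0 <= u => [hw|].
  have [/hw//|/ltW u0] := leP 0 u.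
  by have := hw (- u); rewrite oppr_ge0 opprK normrN sqrrN => /(_ u0); lra.
rewrite ger0_norm//; set v := u / 2; have uE : u = v + v by rewrite /v; field.
have v0 : 0 <= v by rewrite divr_ge0.
have e1 : expR v * expR (- v) = 1 by rewrite -expRD subrr expR0.
have ev := expR_gt0 v; have evN := expR_gt0 (- v).
have h1 : 1 - 2 * v <= expR (- v) * expR (- v).
  rewrite -expRD -opprD -uE; have := expR_ge1Dx (- u); rewrite /v; lra.
have h2 : expR v - expR (- v) <= 2 * v * expR v.
  have ee : expR v * (expR (- v) * expR (- v)) = expR (- v) by rewrite mulrA e1 mul1r.
  by have := ler_wpM2l (ltW ev) h1; rewrite ee; lra.
have h3 : 0 <= expR v - expR (- v) by rewrite subr_ge0 ler_expR; lra.
rewrite uE opprD !expRD.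
have -> : expR v * expR v + expR (- v) * expR (- v) - 2 =
  (expR v - expR (- v)) ^+ 2 + 2 * (expR v * expR (- v) - 1) by ring.
rewrite e1 subrr mulr0 addr0.
have -> : (v + v) ^+ 2 * (expR v * expR v) = (2 * v * expR v) ^+ 2 by ring.
by rewrite ler_sqr// nnegrE (le_trans h3).
Qed.

Lemma sqr_le_expR x : x ^+ 2 <= 4 * expR `|x|.
Proof.
have h : `|x| / 2 <= expR (`|x| / 2) by have := expR_ge1Dx (`|x| / 2); lra.
have h0 : 0 <= `|x| / 2 by rewrite divr_ge0.
have : (`|x| / 2) ^+ 2 <= expR (`|x| / 2) ^+ 2 by rewrite ler_sqr// nnegrE (le_trans h0).
rewrite -expRM_natl -[x ^+ 2]real_normK ?num_real//.
have -> : 2 * (`|x| / 2) = `|x| by field.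
rewrite expr_div_n; lra.
Qed.

Lemma expR_norm_le x b : expR (b * `|x|) <= expR (b * x) + expR (- b * x).
Proof.
have [x0|x0] := leP 0 x; first by rewrite ger0_norm// lerDl expR_ge0.
by rewrite ltr0_norm// mulrN -mulNr lerDr expR_ge0.
Qed.

(** In [b + 2], [b] pays for the tilt [l], one unit for the exponential in [expR_second_difference]
    and one for bounding the square of [x]. *)
Lemma expR_tilted_second_difference x l h b : `|l| <= b -> `|h| <= 1 ->
  expR ((l + h) * x) + expR ((l - h) * x) - 2 * expR (l * x) <=
  4 * h ^+ 2 * (expR ((b + 2) * x) + expR (- (b + 2) * x)).
Proof.
move=> lb h1; have b0 : 0 <= b by rewrite (le_trans _ lb).
have -> : expR ((l + h) * x) + expR ((l - h) * x) - 2 * expR (l * x) =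
    expR (l * x) * (expR (h * x) + expR (- (h * x)) - 2).
  by rewrite mulrDl mulrBl !expRD; ring.
have hx : `|h * x| <= `|x| by rewrite normrM ler_piMl.
have s1 : expR (h * x) + expR (- (h * x)) - 2 <= h ^+ 2 * (4 * (expR `|x| * expR `|x|)).
  apply: le_trans (expR_second_difference _) _; rewrite exprMn -mulrA.
  apply: ler_wpM2l; first exact: sqr_ge0.
  rewrite mulrA; apply: ler_pM; [exact: sqr_ge0|exact: expR_ge0|exact: sqr_le_expR|].
  by rewrite ler_expR.
apply: le_trans (ler_wpM2l (expR_ge0 _) s1) _.
have s2 : expR (l * x) <= expR (b * `|x|).
  rewrite ler_expR; apply: le_trans (ler_norm _) _.
  by rewrite normrM ler_wpM2r.
have s3 : expR (l * x) * (expR `|x| * expR `|x|) <= expR ((b + 2) * `|x|).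
  have -> : (b + 2) * `|x| = b * `|x| + (`|x| + `|x|) by ring.
  by rewrite !expRD; apply: ler_wpM2r => //; apply: mulr_ge0; exact: expR_ge0.
have := expR_norm_le x (b + 2) => s4.
have := ler_wpM2l (mulr_ge0 (ler0n R 4) (sqr_ge0 h)) (le_trans s3 s4).
lra.
Qed.

End exponential_inequalities.

Section log_moment_generating_function.
Context d (T : measurableType d) (R : realType) (P : probability T R).
Variable xi : {RV P >-> R}.
Hypothesis xi_mgf : forall l : R, (mmt_gen_fun P xi l < +oo)%E.

Definition mgf (l : R) : R := \int[P]_w expR (l * xi w).
Definition cgf (l : R) : R := ln (mgf l).
Definition mean : R := \int[P]_w xi w.

Lemma expR_measurable l : measurable_fun setT (fun w => expR (l * xi w)).
Proof.
apply: measurableT_comp; first exact: measurable_expR.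
by apply: measurable_funM => //; exact: measurable_cst.
Qed.

Lemma mmt_gen_funE l : mmt_gen_fun P xi l = (\int[P]_w (expR (l * xi w))%:E)%E.
Proof.
rewrite /mmt_gen_fun unlock; apply: eq_integral => w _.
by rewrite /= mulrC.
Qed.

Lemma expR_integrable l : P.-integrable setT (EFin \o (fun w => expR (l * xi w))).
Proof.
apply/integrableP; split; first by apply/measurable_EFinP; exact: expR_measurable.
under eq_integral => w _ do rewrite /= ger0_norm ?expR_ge0//.
by rewrite -mmt_gen_funE; exact: xi_mgf.
Qed.

Lemma mgfE l : (\int[P]_w (expR (l * xi w))%:E = (mgf l)%:E)%E.
Proof.
by rewrite /mgf /Rintegral fineK//; exact: (integrable_fin_num measurableT (expR_integrable l)).
Qed.

Lemma xi_integrable : P.-integrable setT (EFin \o xi).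
Proof.
apply: (le_integrable measurableT _ _ (integrableD measurableT
  (expR_integrable 1) (expR_integrable (-1)))); first exact/measurable_EFinP.
move=> w _; rewrite /= lee_fin [leRHS]ger0_norm ?addr_ge0 ?expR_ge0//.
apply: le_trans (expR_norm_le _ _); rewrite mul1r.
by have := expR_ge1Dx `|xi w|; lra.
Qed.

(** Jensen's inequality: [f] is the tangent line of the exponential at [l * mean], evaluated at
    [l * xi]. *)
Lemma mgf_ge l : expR (l * mean) <= mgf l.
Proof.
have ixi := xi_integrable; have iexp := expR_integrable l.
have icst (c : R) : P.-integrable setT (EFin \o cst c).
  exact: finite_measure_integrable_cst.
pose f w := expR (l * mean) * (1 - l * mean) + (expR (l * mean) * l) * xi w.
have izi : P.-integrable setT (EFin \o (fun w => (expR (l * mean) * l) * xi w)).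
  by have := integrableZl measurableT (expR (l * mean) * l) ixi; apply: eq_integrable.
have if_ : P.-integrable setT (EFin \o f).
  by have := integrableD measurableT (icst (expR (l * mean) * (1 - l * mean))) izi;
    apply: eq_integrable.
have <- : \int[P]_w f w = expR (l * mean).
  transitivity (\int[P]_w cst (expR (l * mean) * (1 - l * mean)) w +
      \int[P]_w (expR (l * mean) * l * xi w)).
    by apply: RintegralD => //; exact: icst.
  rewrite RintegralZl// Rintegral_cst//.
  rewrite [X in _ * fine X + _]probability_setT -/mean /=; ring.
apply: le_Rintegral => // w _; rewrite /f.
have := ler_wpM2l (expR_ge0 (l * mean)) (expR_ge1Dx (l * xi w - l * mean)).
by rewrite -expRD subrKC; lra.
Qed.

Lemma mgf_gt0 l : 0 < mgf l.
Proof. exact: lt_le_trans (expR_gt0 _) (mgf_ge l). Qed.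

Lemma mgf_second_difference l h b : `|l| <= b -> `|h| <= 1 ->
  mgf (l + h) + mgf (l - h) - 2 * mgf l <=
  4 * h ^+ 2 * (mgf (b + 2) + mgf (- (b + 2))).
Proof.
move=> lb h1; have ie := expR_integrable.
have iD l1 l2 : P.-integrable setT
    (EFin \o (fun w => expR (l1 * xi w) + expR (l2 * xi w))).
  by have := integrableD measurableT (ie l1) (ie l2); apply: eq_integrable.
have iZ (c : R) l1 : P.-integrable setT (EFin \o (fun w => c * expR (l1 * xi w))).
  by have := integrableZl measurableT c (ie l1); apply: eq_integrable.
have iZD (c : R) l1 l2 : P.-integrable setT
    (EFin \o (fun w => c * (expR (l1 * xi w) + expR (l2 * xi w)))).
  by have := integrableZl measurableT c (iD l1 l2); apply: eq_integrable.
have iB : P.-integrable setT (EFin \o (fun w => expR ((l + h) * xi w) +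
    expR ((l - h) * xi w) - 2 * expR (l * xi w))).
  by have := integrableB measurableT (iD (l + h) (l - h)) (iZ 2 l); apply: eq_integrable.
have -> : mgf (l + h) + mgf (l - h) - 2 * mgf l = \int[P]_w (expR ((l + h) * xi w) +
    expR ((l - h) * xi w) - 2 * expR (l * xi w)).
  by rewrite RintegralB// RintegralD// RintegralZl.
have -> : 4 * h ^+ 2 * (mgf (b + 2) + mgf (- (b + 2))) = \int[P]_w (4 * h ^+ 2 *
    (expR ((b + 2) * xi w) + expR (- (b + 2) * xi w))).
  by rewrite RintegralZl// RintegralD.
by apply: le_Rintegral => // w _; exact: expR_tilted_second_difference.
Qed.

(** [ln y <= y - 1] bounds the second difference of [cgf] by that of [mgf] divided by [mgf l], and
    [mgf_ge] keeps [mgf l] away from 0 for bounded [l]. *)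
Lemma cgf_cumulant_like : cumulant_like cgf mean.
Proof.
split.
- rewrite /cgf /mgf (_ : (fun w => _) = cst 1); last first.
    by apply/funext => w; rewrite mul0r expR0.
  by rewrite Rintegral_cst// [X in fine X]probability_setT mul1r ln1.
- move=> l; rewrite -[l * mean]expRK ler_ln ?posrE ?expR_gt0 ?mgf_gt0//.
  exact: mgf_ge.
move=> B; pose D := mgf (`|B| + 2) + mgf (- (`|B| + 2)).
have D0 : 0 < D by rewrite addr_gt0// mgf_gt0.
exists (4 * D * expR (`|B| * `|mean|)) => [|l h lB h1].
  by rewrite mulr_ge0 ?expR_ge0// mulr_ge0// ltW.
have {}lB : `|l| <= `|B| by exact: le_trans (ler_norm B).
have Ml := mgf_gt0 l.
have lnM l' : cgf l' - cgf l <= mgf l' / mgf l - 1.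
  rewrite /cgf -ln_div ?posrE ?mgf_gt0//.
  have r0 : 0 < mgf l' / mgf l by rewrite divr_gt0// mgf_gt0.
  by have := @le_ln1Dx R (mgf l' / mgf l - 1); rewrite subrKC; apply; lra.
have h2 := mgf_second_difference lB h1; rewrite -/D in h2.
have Mi : (mgf l)^-1 <= expR (`|B| * `|mean|).
  apply: (@le_trans _ _ (expR (l * mean))^-1).
    by rewrite lef_pV2 ?posrE ?expR_gt0// mgf_ge.
  rewrite -expRN ler_expR; apply: le_trans (ler_norm _) _.
  by rewrite normrN normrM ler_wpM2r.
have hp := lnM (l + h); have hm := lnM (l - h).
have {h2} : (mgf (l + h) + mgf (l - h) - 2 * mgf l) / mgf l <=
    4 * h ^+ 2 * D * expR (`|B| * `|mean|).
  apply: le_trans (ler_wpM2r _ h2) _; first by rewrite invr_ge0 ltW.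
  by apply: ler_wpM2l => //; rewrite mulr_ge0 ?(ltW D0)// mulr_ge0// sqr_ge0.
have -> : 4 * h ^+ 2 * D * expR (`|B| * `|mean|) =
  4 * D * expR (`|B| * `|mean|) * h ^+ 2 by ring.
apply: le_trans.
have -> : (mgf (l + h) + mgf (l - h) - 2 * mgf l) / mgf l =
    (mgf (l + h) / mgf l - 1) + (mgf (l - h) / mgf l - 1).
  by rewrite mulrBl mulrDl mulfK ?lt0r_neq0//; ring.
apply: le_trans (lerD hp hm); rewrite le_eqVlt; apply/orP; left; apply/eqP.
by move: (cgf (l + h)) (cgf (l - h)) (cgf l) => x y z; ring.
Qed.

Lemma deviation_legendre : deviation P xi = legendre cgf.
Proof.
apply/funext => z; congr ereal_sup; apply: eq_imagel => l _.
by rewrite /log_mgf mmt_gen_funE mgfE lne_EFin ?mgf_gt0.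
Qed.

End log_moment_generating_function.

Lemma sum_nat_blocks (V : nmodType) (F : nat -> nat -> V) p M :
  \sum_(0 <= k < M * p) F (k %/ p)%N k =
  \sum_(0 <= i < M) \sum_(i * p <= k < i.+1 * p) F i k.
Proof.
elim: M => [|M IH]; first by rewrite mul0n !big_geq.
rewrite big_nat_recr//= -IH (@big_cat_nat _ _ _ (M * p))/= ?leq_mul2r ?leqnSn ?orbT//.
congr (_ + _); apply: eq_big_nat => k /andP[Mk kM].
have p0 : (0 < p)%N by case: (p) Mk kM => //; rewrite !muln0 => _; rewrite ltn0.
congr (F _ k); apply/eqP; rewrite eqn_leq leq_divRL// Mk andbT.
by rewrite -ltnS ltn_divLR.
Qed.

Lemma measure_bigcup_geometric d (T : measurableType d) (R : realType)
    (m : {measure set T -> \bar R}) (F : nat -> set T) (K r : R) :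
  (forall k, measurable (F k)) -> 0 <= K -> 0 <= r < 1 ->
  (forall k, (m (F k) <= (K * r ^+ k)%:E)%E) ->
  (m (\bigcup_k F k) <= (K / (1 - r))%:E)%E.
Proof.
move=> mF K0 /andP[r0 r1] mK.
have r1' : 0 < 1 - r by rewrite subr_gt0.
have mUF : measurable (\bigcup_k F k) by exact: bigcup_measurable.
apply: (@le_trans _ _ (\sum_(0 <= k <oo) m (F k))%E).
  exact: generalized_Boole_inequality.
apply: lime_le; first exact: is_cvg_nneseries.
apply: nearW => n; apply: (@le_trans _ _ (\sum_(0 <= k < n) (K * r ^+ k)%:E)%E).
  exact: lee_sum.
rewrite sumEFin lee_fin -mulr_sumr ler_wpM2l//.
suff -> : \sum_(0 <= k < n) r ^+ k = (1 - r ^+ n) / (1 - r).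
  rewrite ler_pdivrMr// mulVf ?lt0r_neq0//; have := exprn_ge0 n r0; lra.
elim: n => [|n IH]; first by rewrite big_geq// expr0 subrr mul0r.
by rewrite big_nat_recr//= IH exprS; field; exact: lt0r_neq0.
Qed.

(** * Chernoff bounds for weighted sums of the steps *)

Section walk.
Context (d0 : measure_display) (T0 : measurableType d0) (R : realType)
  (P0 : probability T0 R) (xi : {RV P0 >-> R})
  (d : measure_display) (T : measurableType d) (P : probability T R)
  (X : nat -> {RV P >-> R}).
Hypothesis xi_mgf : forall l : R, (mmt_gen_fun P0 xi l < +oo)%E.
Hypothesis iX : mutually_independent X.
Hypothesis X_copies : forall (i : nat) (A : set R), measurable A ->
  distribution P (X i) A = distribution P0 xi A.
Local Notation A := (cgf xi).
Local Notation a := (mean xi).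

Lemma copies_integral k (f : R -> R) : measurable_fun setT f -> (forall x, 0 <= f x) ->
  (\int[P]_w (f (X k w))%:E = \int[P0]_w (f (xi w))%:E)%E.
Proof.
move=> mf f0; have mf' : measurable_fun setT (EFin \o f) by exact/measurable_EFinP.
have f0' y : (0 <= (EFin \o f) y)%E by rewrite lee_fin.
have := ge0_integral_distribution (X k) mf' f0'; rewrite /comp/= => <-.
have := ge0_integral_distribution xi mf' f0'; rewrite /comp/= => <-.
by apply: eq_measure_integral => B mB _; exact: X_copies.
Qed.

Lemma walk_measurable (c : nat -> R) (g : R -> R) N : measurable_fun setT g ->
  measurable_fun setT (fun w => \sum_(k < N) c k * g (X k w)).
Proof.
move=> mg; apply: measurable_sum => k; apply: measurable_funM => //.
exact: measurableT_comp mg _.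
Qed.

Lemma expectation_expR (c psi : nat -> R) (g : R -> R) N : measurable_fun setT g ->
  (forall k, (\int[P]_w (expR (c k * g (X k w)))%:E = (expR (psi k))%:E)%E) ->
  (\int[P]_w (expR (\sum_(k < N) c k * g (X k w)))%:E =
   (expR (\sum_(k < N) psi k))%:E)%E.
Proof.
move=> mg cpsi; have mexp k : measurable_fun setT (fun x : R => expR (c k * g x)).
  by apply: measurableT_comp; [exact: measurable_expR|exact: measurable_funM].
have := @expectation_prod _ _ _ _ _ iX N (fun k x => expR (c k * g x))
  (fun k => expR (psi k)) mexp (fun _ _ => expR_ge0 _) cpsi.
by rewrite -expR_sum => <-; apply: eq_integral => w _; rewrite expR_sum.
Qed.

Lemma markov_expR (Y : T -> R) (b K : R) : measurable_fun setT Y ->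
  (\int[P]_w (expR (Y w))%:E <= (expR K)%:E)%E ->
  (P [set w | (b <= Y w)%R] <= (expR (K - b))%:E)%E.
Proof.
move=> mY YK; have mexp : measurable_fun setT (fun w => expR (Y w)).
  by apply: measurableT_comp => //; exact: measurable_expR.
have mS : measurable [set w | b <= Y w].
  by rewrite -[X in measurable X]setTI; exact: measurable_fun_le.
apply: (@le_trans _ _ (\int[P]_w ((expR (- b))%:E * (expR (Y w))%:E))%E).
  rewrite -(setIT [set w | _]) -integral_indic//.
  apply: ge0_le_integral => //.
  - by apply/measurable_EFinP; exact: measurable_indic.
  - by apply: measurable_funeM; exact/measurable_EFinP.
  move=> w _; rewrite [leRHS](_ : _ = (expR (- b) * expR (Y w))%:E)// lee_fin indicE.
  case: (boolP (w \in _)) => [/set_mem/= bY|_]; last by rewrite mulr_ge0 ?expR_ge0.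
  rewrite -expRD -[leLHS]expR0 ler_expR; lra.
rewrite ge0_integralZl//; last exact/measurable_EFinP.
by rewrite addrC expRD EFinM lee_pmul2l// lte_fin expR_gt0.
Qed.

Lemma walk_expectation (c : nat -> R) N :
  (\int[P]_w (expR (\sum_(k < N) c k * X k w))%:E = (expR (\sum_(k < N) A (c k)))%:E)%E.
Proof.
apply: (@expectation_expR c (A \o c) id) => // k.
rewrite (@copies_integral k (fun x => expR (c k * x))); last 2 first.
- by apply: measurableT_comp; [exact: measurable_expR|exact: measurable_funM].
- by move=> x; exact: expR_ge0.
by rewrite mgfE// lnK// posrE mgf_gt0.
Qed.

Lemma walk_chernoff (c : nat -> R) N b :
  (P [set w | (b <= \sum_(k < N) c k * X k w)%R] <=
   (expR (\sum_(k < N) A (c k) - b))%:E)%E.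
Proof.
apply: markov_expR; first exact: (@walk_measurable c id).
by rewrite walk_expectation.
Qed.

Definition abs_cgf (c : R) : R := ln (\int[P0]_w expR (c * `|xi w|)).

Lemma abs_cgf0 : abs_cgf 0 = 0.
Proof.
rewrite /abs_cgf (_ : (fun w => _) = cst 1); last first.
  by apply/funext => w; rewrite mul0r expR0.
by rewrite Rintegral_cst// [X in fine X]probability_setT mul1r ln1.
Qed.

Lemma expR_abs_measurable (c : R) : measurable_fun setT (fun x : R => expR (c * `|x|)).
Proof.
apply: measurableT_comp; first exact: measurable_expR.
by apply: measurable_funM => //; exact: measurableT_comp.
Qed.

Lemma abs_expectation (c : R) k : 0 <= c ->
  (\int[P]_w (expR (c * `|X k w|))%:E = (expR (abs_cgf c))%:E)%E.
Proof.
move=> c0; rewrite (@copies_integral k (fun x => expR (c * `|x|))); last 2 first.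
- exact: expR_abs_measurable.
- by move=> x; exact: expR_ge0.
have mabs : measurable_fun setT (fun w => expR (c * `|xi w|)).
  exact: measurableT_comp (expR_abs_measurable c) _.
have iabs : P0.-integrable setT (EFin \o (fun w => expR (c * `|xi w|))).
  apply: (le_integrable measurableT _ _ (integrableD measurableT
    (expR_integrable xi_mgf c) (expR_integrable xi_mgf (- c)))).
    exact/measurable_EFinP.
  move=> w _; rewrite /= lee_fin (ger0_norm (expR_ge0 _)).
  rewrite (ger0_norm (addr_ge0 (expR_ge0 _) (expR_ge0 _))).
  exact: expR_norm_le.
have i1 : (1 <= \int[P0]_w (expR (c * `|xi w|))%:E)%E.
  apply: (@le_trans _ _ (\int[P0]_w (cst 1%:E) w)%E).
    by rewrite integral_cst// mul1e [leRHS]probability_setT.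
  apply: ge0_le_integral => //; first exact/measurable_EFinP.
  move=> w _; rewrite lee_fin -[leLHS]expR0 ler_expR mulr_ge0//.
have fin := integrable_fin_num measurableT iabs.
rewrite /abs_cgf /Rintegral -[LHS]fineK// lnK// posrE.
by apply: (@lt_le_trans _ _ 1) => //; rewrite -lee_fin fineK.
Qed.

Lemma abs_chernoff (c : nat -> R) N b : (forall k, 0 <= c k) ->
  (P [set w | (b <= \sum_(k < N) c k * `|X k w|)%R] <=
   (expR (\sum_(k < N) abs_cgf (c k) - b))%:E)%E.
Proof.
move=> c0; have mn : measurable_fun setT (fun x : R => `|x|) by [].
apply: markov_expR; first exact: (@walk_measurable c (fun x => `|x|)).
rewrite (@expectation_expR c (abs_cgf \o c) (fun x => `|x|))// => k.
exact: abs_expectation.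
Qed.

Let mask (l : R) u (k : nat) : R := if (u <= k)%N then l else 0.

Lemma sum_mask l u v (F : nat -> R) :
  \sum_(k < v) mask l u k * F k = l * \sum_(u <= k < v) F k.
Proof.
rewrite big_geq_mkord mulr_sumr [RHS]big_mkcond/=; apply: eq_bigr => k _.
by rewrite /mask; case: ifP => _; rewrite ?mul0r.
Qed.

Lemma sum_cgf_mask (B : R -> R) l u v : B 0 = 0 -> (u <= v)%N ->
  \sum_(k < v) B (mask l u k) = (v - u)%:R * B l.
Proof.
move=> B0 uv; have := sum_mask (B l) u v (fun=> 1).
rewrite sumr_const_nat mulrC => <-; apply: eq_bigr => k _.
by rewrite mulr1 /mask; case: ifP.
Qed.

Lemma range_chernoff l u v b : (u <= v)%N ->
  (P [set w | (b <= l * \sum_(u <= k < v) X k w)%R] <=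
   (expR ((v - u)%:R * A l - b))%:E)%E.
Proof.
move=> uv; have := walk_chernoff (mask l u) v b.
rewrite sum_cgf_mask//; last by have [] := cgf_cumulant_like xi_mgf.
by under eq_set => w do rewrite (sum_mask l u v (fun k => X k w)).
Qed.

Lemma range_abs_chernoff l u v b : 0 <= l -> (u <= v)%N ->
  (P [set w | (b <= l * \sum_(u <= k < v) `|X k w|)%R] <=
   (expR ((v - u)%:R * abs_cgf l - b))%:E)%E.
Proof.
move=> l0 uv; have := @abs_chernoff (mask l u) v b.
rewrite sum_cgf_mask//; last exact: abs_cgf0.
under eq_set => w do rewrite (sum_mask l u v (fun k => `|X k w|)).
by apply => k; rewrite /mask; case: ifP.
Qed.

End walk.

(** * Reduction to block averages *)

Section tame_sequences.
Context {R : realType}.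
Implicit Types (s v : nat -> R) (a delta e K x : R) (n p M k : nat).

(** One clause for each source of error: an incomplete block, the time after the [M] blocks, and the
    replacement of [x n] by [n]. *)
Definition tame a delta K n p M s : Prop :=
  [/\ forall i, (i < M)%N -> \sum_(i * p <= k < i.+1 * p) `|s k| <= delta * n%:R,
      forall j, `|\sum_(M * p <= k < M * p + j) s k - a * j%:R| <=
        delta * (M * p + j)%:R
    & forall k, \sum_(0 <= j < k) `|s j| <= K * (n + k)%:R].

(** A complete block costs at most [p e]. An incomplete one costs [delta n] for [s] and
    [p e + delta n] for [v]; its [p e] still fits into [M p e], since fewer than [M] blocks are
    complete. *)
Lemma tame_blocks a delta K n p M s v e : (0 < p)%N -> 0 <= e -> 0 <= delta ->
  tame a delta K n p M s ->
  (forall i, (i < M)%N ->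
    `|\sum_(i * p <= k < i.+1 * p) s k - p%:R * v i| <= p%:R * e) ->
  (forall i, (M <= i)%N -> v i = a) ->
  forall k, `|\sum_(0 <= j < k) s j - \sum_(0 <= j < k) v (j %/ p)%N| <=
    M%:R * (p%:R * e) + 2 * delta * (n + k)%:R.
Proof.
move=> p0 e0 d0 [t1 t2 _] sv vM k; rewrite -sumrB.
have pe0 : 0 <= p%:R * e by exact: mulr_ge0.
have head q : (q <= M)%N ->
    `|\sum_(0 <= j < q * p) (s j - v (j %/ p)%N)| <= q%:R * (p%:R * e).
  move=> qM; rewrite (sum_nat_blocks (fun i j => s j - v i)).
  apply: le_trans (ler_norm_sum _ _ _) _.
  have -> : q%:R * (p%:R * e) = \sum_(0 <= i < q) p%:R * e.
    by rewrite sumr_const_nat subn0 mulr_natl.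
  rewrite big_nat [leRHS]big_nat; apply: ler_sum => i /andP[_ iq].
  rewrite sumrB sumr_const_nat -mulnBl subSnn mul1n -[v i *+ p]mulr_natl.
  exact: sv (leq_trans iq qM).
have [Mk|kM] := leqP (M * p) k.
  rewrite (@big_cat_nat _ _ _ (M * p))//=; apply: le_trans (ler_normD _ _) _.
  apply: lerD; first exact: head.
  have vE j : (M * p <= j)%N -> v (j %/ p)%N = a by move=> Mj; rewrite vM// leq_divRL.
  rewrite (eq_big_nat _ _ (F2 := fun j => s j - a)); last first.
    by move=> j /andP[/vE ->].
  rewrite sumrB sumr_const_nat -[a *+ _]mulr_natr; have := t2 (k - M * p)%N.
  rewrite subnKC// => /le_trans; apply; apply: ler_pM => //.
    by rewrite ler_peMl// ler1n.
  by rewrite ler_nat leq_addl.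
have qM : (k %/ p < M)%N by rewrite ltn_divLR.
have qk : (k %/ p * p <= k)%N by exact: leq_trunc_div.
have kq : (k <= (k %/ p).+1 * p)%N by rewrite ltnW// ltn_ceil.
rewrite (@big_cat_nat _ _ _ (k %/ p * p))//=; apply: le_trans (ler_normD _ _) _.
apply: le_trans (lerD (head _ (ltnW qM)) (lexx _)) _.
have vE j : (k %/ p * p <= j < k)%N -> v (j %/ p)%N = v (k %/ p)%N.
  move=> /andP[qj jk]; congr v; apply/eqP; rewrite eqn_leq.
  by rewrite leq_div2r ?(ltnW jk)//= (leq_divRL (k %/ p) j p0).
rewrite (eq_big_nat _ _ (F2 := fun j => s j - v (k %/ p)%N)); last first.
  by move=> j /vE ->.
rewrite sumrB sumr_const_nat; apply: le_trans (lerD (lexx _) (ler_normB _ _)) _.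
have T1 := t1 _ qM; have SV := sv _ qM.
have h1 : `|\sum_(k %/ p * p <= j < k) s j| <= delta * n%:R.
  apply: le_trans (ler_norm_sum _ _ _) _; apply: le_trans T1.
  rewrite [leRHS](@big_cat_nat _ _ _ k)//= lerDl.
  by apply: sumr_ge0 => j _.
have h2 : p%:R * `|v (k %/ p)%N| <= p%:R * e + delta * n%:R.
  have -> : p%:R * `|v (k %/ p)%N| = `|p%:R * v (k %/ p)%N|.
    by rewrite normrM ger0_norm.
  have hs : `|\sum_(k %/ p * p <= j < (k %/ p).+1 * p) s j| <= delta * n%:R.
    exact: le_trans (ler_norm_sum _ _ _) T1.
  move: SV hs; move: (\sum_(_ <= _ < _) _) (p%:R * v _) => y z SV hs.
  have := ler_normD (y - z) (- y); rewrite addrAC subrr add0r !normrN; lra.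
have h3 : `|v (k %/ p)%N *+ (k - k %/ p * p)| <= p%:R * `|v (k %/ p)%N|.
  rewrite -[v _ *+ _]mulr_natl normrM ger0_norm// ler_wpM2r// ler_nat leq_subLR.
  by rewrite addnC -mulSn.
have h4 : (k %/ p)%:R * (p%:R * e) + p%:R * e <= M%:R * (p%:R * e).
  rewrite -{2}[p%:R * e]mul1r -mulrDl; apply: ler_wpM2r => //.
  by rewrite natr1 ler_nat.
have h5 : delta * n%:R <= delta * (n + k)%:R.
  by rewrite ler_wpM2l// ler_nat leq_addr.
lra.
Qed.

Lemma tame_walk a delta K n p M s v e x : (0 < n)%N -> (0 < p)%N -> 0 <= e ->
  0 <= delta -> 0 < x ->
  tame a delta K n p M s -> `|n%:R / x - 1| * K <= delta ->
  M%:R * (p%:R * e) <= delta * n%:R ->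
  (forall i, (i < M)%N ->
    `|\sum_(i * p <= k < i.+1 * p) s k - p%:R * v i| <= p%:R * e) ->
  (forall i, (M <= i)%N -> v i = a) ->
  forall k, `|(\sum_(j < k) s j) / x - block_nodes v p n k| <=
    4 * delta * (1 + k%:R / n%:R).
Proof.
move=> n0 p0 e0 d0 x0 ts xK Me sv vM k; have n0' : 0 < n%:R :> R by rewrite ltr0n.
have := tame_blocks p0 e0 d0 ts sv vM k; have [_ _ /(_ k)] := ts.
rewrite /block_nodes -(big_mkord xpredT s) -(big_mkord xpredT (fun j => v (j %/ p)%N)).
move: (\sum_(0 <= j < k) v _) => B; set S := \sum_(0 <= j < k) s j => SK SB.
have {}SK : `|S| <= K * (n + k)%:R by apply: le_trans (ler_norm_sum _ _ _) _.
(* The first term is the normalisation error, at most [delta (n + k)]; the block error adds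
   [delta n + 2 delta (n + k)], whence the factor 4. *)
have -> : S / x - B / n%:R = (S * (n%:R / x - 1) + (S - B)) / n%:R.
  by field; rewrite !lt0r_neq0.
rewrite normrM normfV (gtr0_norm n0') ler_pdivrMr//.
have -> : 4 * delta * (1 + k%:R / n%:R) * n%:R = 4 * delta * (n + k)%:R.
  by rewrite natrD; field; rewrite lt0r_neq0.
apply: le_trans (ler_normD _ _) _; rewrite normrM.
have h1 : `|S| * `|n%:R / x - 1| <= delta * (n + k)%:R.
  apply: le_trans (ler_wpM2r (normr_ge0 _) SK) _.
  by rewrite mulrAC ler_wpM2r// mulrC.
have h5 : delta * n%:R <= delta * (n + k)%:R.
  by rewrite ler_wpM2l// ler_nat leq_addr.
lra.
Qed.

End tame_sequences.

Section tame_event.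
Context (d0 : measure_display) (T0 : measurableType d0) (R : realType)
  (P0 : probability T0 R) (xi : {RV P0 >-> R})
  (d : measure_display) (T : measurableType d) (P : probability T R)
  (X : nat -> {RV P >-> R}).
Hypothesis xi_mgf : forall l : R, (mmt_gen_fun P0 xi l < +oo)%E.
Hypothesis iX : mutually_independent X.
Hypothesis X_copies : forall (i : nat) (A : set R), measurable A ->
  distribution P (X i) A = distribution P0 xi A.
Local Notation A := (cgf xi).
Local Notation a := (mean xi).
Implicit Types (delta Q : R) (n m p M N : nat).

Lemma measurable_superlevel (f : T -> R) b : measurable_fun setT f ->
  measurable [set w | b <= f w].
Proof.
by move=> mf; rewrite -[X in measurable X]setTI; exact: measurable_fun_le.
Qed.

Lemma measurable_sum_nat (g : R -> R) u v : measurable_fun setT g ->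
  measurable_fun setT (fun w => \sum_(u <= k < v) g (X k w)).
Proof.
by move=> mg; apply: measurable_sum => k; exact: measurableT_comp mg _.
Qed.

Lemma abs_block_event delta Q : 0 < delta -> exists m0, forall M n m p, (m0 <= m)%N ->
  (0 < m)%N -> p%:R * m%:R <= 2 * n%:R :> R ->
  exists E, [/\ measurable E, (P E <= (M%:R * expR (- (n%:R * Q)))%:E)%E &
    forall w, ~ E w -> forall i, (i < M)%N ->
      \sum_(i * p <= k < i.+1 * p) `|X k w| <= delta * n%:R].
Proof.
(* [c * delta] is [|Q| + 1], and [m >= 2 |B|] keeps the cost [p B] of the exponential moment below
   [n]; the exponent is then at most [- n |Q|]. *)
move=> del0; pose c := (`|Q| + 1) / delta; pose B := abs_cgf xi c.
have c0 : 0 < c by rewrite divr_gt0// ltr_wpDl.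
exists (Num.truncn (2 * `|B|)).+1 => M n m p m0m m0 pm.
have Bm : 2 * `|B| <= m%:R.
  by apply: le_trans (ltW (truncnS_gt _)) _; rewrite ler_nat.
have pB : p%:R * B <= n%:R.
  have m0' : 0 < m%:R :> R by rewrite ltr0n.
  have h1 : p%:R * B <= p%:R * `|B| by rewrite ler_wpM2l// ler_norm.
  have h2 : p%:R * `|B| * m%:R <= 2 * n%:R * `|B|.
    by rewrite mulrAC ler_wpM2r.
  have h3 : 2 * `|B| * n%:R <= m%:R * n%:R by rewrite ler_wpM2r.
  rewrite -(ler_pM2r m0'); have := ler_wpM2r (ltW m0') h1; lra.
pose F i := [set w | c * (delta * n%:R) <= c * \sum_(i * p <= k < i.+1 * p) `|X k w|].
have mF i : measurable (F i).
  apply: measurable_superlevel; apply: measurable_funM => //.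
  exact: (@measurable_sum_nat (fun x => `|x|)).
exists (\big[setU/set0]_(i < M) F i); split.
- by apply: bigsetU_measurable => i _; exact: mF.
- apply: le_trans (Boole_inequality P _) _; first by move=> i _; exact: mF.
  rewrite (_ : (M%:R * _)%:E = \sum_(i < M) (expR (- (n%:R * Q)))%:E)%E; last first.
    by rewrite sumEFin sumr_const card_ord mulr_natl.
  apply: lee_sum => i _.
  apply: le_trans (range_abs_chernoff xi_mgf iX X_copies _ (ltW c0) _) _.
    by rewrite leq_mul2r leqnSn orbT.
  rewrite lee_fin ler_expR -mulnBl subSnn mul1n -/B mulrA /c divfK ?lt0r_neq0//.
  by have := ler_wpM2r (ler0n R n) (ler_norm Q); lra.
move=> w nE i iM; rewrite leNgt; apply/negP => lt; apply: nE.
rewrite -bigcup_mkord; exists i => //; rewrite /F/= ler_pM2l//; exact: ltW.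
Qed.

(** The cumulant costs at most half of the part [c delta j] of the threshold; the other half makes
    the bounds geometric in [j], so they can be summed, and [c delta N] supplies [n Q]. *)
Lemma tail_event delta Q : 0 < delta -> exists m0 C, 0 <= C /\ forall N n,
  m0%:R * n%:R <= N%:R :> R ->
  exists E, [/\ measurable E, (P E <= (C * expR (- (n%:R * Q)))%:E)%E &
    forall w, ~ E w -> forall j,
      `|\sum_(N <= k < N + j) X k w - a * j%:R| <= delta * (N + j)%:R].
Proof.
move=> del0; have del20 : 0 < delta / 2 by rewrite divr_gt0.
have [c c0 [ac ac']] := cumulant_slope (cgf_cumulant_like xi_mgf) del20.
pose r := expR (- (c * delta / 2)).
have r1 : 0 <= r < 1 by rewrite expR_ge0/= expR_lt1 oppr_lt0 divr_gt0// mulr_gt0.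
have r1' : 0 < 1 - r by case/andP: r1; rewrite subr_gt0.
exists (Num.truncn (`|Q| / (c * delta))).+1, (2 / (1 - r)); split => [|N n mN].
  by rewrite divr_ge0// ltW.
have QN : n%:R * Q <= c * delta * N%:R.
  have cd0 : 0 < c * delta by exact: mulr_gt0.
  apply: le_trans (ler_wpM2l (ltW cd0) mN).
  rewrite mulrA mulrC ler_wpM2r//; apply: le_trans (ler_norm _) _.
  by rewrite -ler_pdivrMl// mulrC; exact: ltW (truncnS_gt _).
(* [s] is 1 or -1, the direction of the deviation; hence the 2 in the constant. *)
pose F (s : R) j := [set w | c * (delta * (N + j)%:R) + s * c * (a * j%:R) <=
  s * c * \sum_(N <= k < N + j) X k w].
have mF s j : measurable (F s j).
  by apply: measurable_superlevel; apply: measurable_funM => //; exact: (@measurable_sum_nat id).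
have PF s : A (s * c) - s * c * a <= delta / 2 * c ->
    (P (\bigcup_j F s j) <= (expR (- (n%:R * Q)) / (1 - r))%:E)%E.
  move=> sA; apply: measure_bigcup_geometric => // j.
  apply: le_trans (range_chernoff xi_mgf iX X_copies _ _ _) _; first exact: leq_addr.
  rewrite addKn lee_fin /r -expRM_natl -expRD ler_expR natrD.
  move: (ler_wpM2r (ler0n R j) sA) QN => {ac ac' sA}.
  by move: (A (s * c)) (mean xi) => y b; lra.
have {ac} PF1 : (P (\bigcup_j F 1%R j) <= (expR (- (n%:R * Q)) / (1 - r))%:E)%E.
  by apply: PF; rewrite mul1r.
have {ac' PF} PFN : (P (\bigcup_j F (-1)%R j) <= (expR (- (n%:R * Q)) / (1 - r))%:E)%E.
  by apply: PF; rewrite mulN1r mulNr opprK.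
exists ((\bigcup_j F 1 j) `|` (\bigcup_j F (-1) j)); split.
- by apply: measurableU; exact: bigcup_measurable.
- apply: le_trans (measureU2 _ _ _) _; [exact: bigcup_measurable..|].
  apply: le_trans (leeD PF1 PFN) _.
  by rewrite -EFinD lee_fin; move: (expR _) => y; lra.
move=> w nE j; rewrite leNgt; apply/negP => lt; apply: nE.
have [h|h] := leP 0 (\sum_(N <= k < N + j) X k w - a * j%:R).
  left; exists j => //; rewrite /F/= mul1r -mulrDr ler_pM2l//.
  by move: lt; rewrite ger0_norm//; move: (mean xi) => b; lra.
right; exists j => //; rewrite /F/= mulN1r !mulNr -mulrN -mulrDr -mulrN ler_pM2l//.
by move: lt; rewrite ltr0_norm//; move: (mean xi) => b; lra.
Qed.

Lemma growth_event Q : exists K C, [/\ 0 <= K, 0 <= C & forall n,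
  exists E, [/\ measurable E, (P E <= (C * expR (- (n%:R * Q)))%:E)%E &
    forall w, ~ E w -> forall k, \sum_(0 <= j < k) `|X j w| <= K * (n + k)%:R]].
Proof.
(* [K] makes the exponent [k B - K (n + k)] at most [- n Q - k], so the bounds sum geometrically
   over [k]. *)
pose B := abs_cgf xi 1; pose K := `|B| + `|Q| + 1.
have r1 : 0 <= expR (-1 : R) < 1 by rewrite expR_ge0/= expR_lt1 oppr_lt0.
have r1' : 0 < 1 - expR (-1 : R) by case/andP: r1; rewrite subr_gt0.
exists K, (1 / (1 - expR (-1))); split; [by rewrite !addr_ge0|by rewrite divr_ge0// ltW|].
move=> n; pose F k := [set w | K * (n + k)%:R <= 1 * \sum_(0 <= j < k) `|X j w|].
have mF k : measurable (F k).
  apply: measurable_superlevel; apply: measurable_funM => //.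
  exact: (@measurable_sum_nat (fun x => `|x|)).
exists (\bigcup_k F k); split.
- exact: bigcup_measurable.
- rewrite mul1r mulrC; apply: measure_bigcup_geometric => // k.
  apply: le_trans (range_abs_chernoff xi_mgf iX X_copies _ ler01 _) _ => //.
  rewrite subn0 -/B lee_fin -expRM_natl -expRD ler_expR natrD /K.
  have := ler_wpM2r (ler0n R k) (ler_norm B); have := ler_wpM2r (ler0n R n) (ler_norm Q).
  have := mulr_ge0 (normr_ge0 B) (ler0n R n); have := mulr_ge0 (normr_ge0 Q) (ler0n R k).
  have := ler0n R n; lra.
move=> w nE k; rewrite leNgt; apply/negP => lt; apply: nE.
by exists k => //; rewrite /F/= mul1r; exact: ltW.
Qed.

Lemma tame_event delta Q : 0 < delta -> exists m0 K, 0 <= K /\ forall S m,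
  (m0 <= S)%N -> (m0 <= m)%N -> (0 < m)%N -> \forall n \near \oo,
  exists E, [/\ measurable E, (P E <= (expR (- (n%:R * Q)))%:E)%E &
    forall w, ~ E w ->
      tame a delta K n (n %/ m).+1 (S * m) (fun k => X k w)].
Proof.
(* The extra unit in [Q + 1] gives a factor [expR (- n)] that absorbs the constants [S m], [C2] and
   [C3]. *)
move=> del0; have [m1 h1] := abs_block_event (Q + 1) del0.
have [m2 [C2 [C20 h2]]] := tail_event (Q + 1) del0.
have [K [C3 [K0 C30 h3]]] := growth_event (Q + 1).
exists (maxn m1 m2), K; split=> // S m; rewrite !geq_max => /andP[_ mS] /andP[mm _] m0.
exists (maxn m (Num.truncn ((S * m)%:R + C2 + C3)).+1) => // n /=.
rewrite geq_max => /andP[mn Cn].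
have pm : (n %/ m).+1%:R * m%:R <= 2 * n%:R :> R.
  rewrite -natrM mulSn -natrM ler_nat mul2n -addnn leq_add//; exact: leq_trunc_div.
have [E1 [mE1 PE1 hE1]] := h1 (S * m)%N n m (n %/ m).+1 mm m0 pm.
have mN : m2%:R * n%:R <= (S * m * (n %/ m).+1)%:R :> R.
  rewrite -natrM ler_nat -mulnA leq_mul// mulnC ltnW//; exact: ltn_ceil.
have [E2 [mE2 PE2 hE2]] := h2 _ _ mN; have [E3 [mE3 PE3 hE3]] := h3 n.
have mE12 : measurable (E1 `|` E2) by exact: measurableU.
exists (E1 `|` E2 `|` E3); split; first exact: measurableU.
  apply: le_trans (measureU2 _ mE12 mE3) _.
  apply: le_trans (leeD (measureU2 _ mE1 mE2) (lexx _)) _.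
  apply: le_trans (leeD (leeD PE1 PE2) PE3) _.
  rewrite -!EFinD lee_fin -!mulrDl mulrDr mulr1 opprD expRD.
  rewrite -[leRHS]mulr1 [leLHS]mulrC -mulrA ler_wpM2l ?expR_ge0//.
  rewrite expRN ler_pdivrMl ?expR_gt0// mulr1.
  apply: le_trans (ltW (truncnS_gt _)) _.
  apply: (@le_trans _ _ n%:R); first by rewrite ler_nat.
  by have := expR_ge1Dx (n%:R : R); lra.
move=> w nE; split.
- by apply: hE1 => h; apply: nE; left; left.
- by apply: hE2 => h; apply: nE; left; right.
by apply: hE3 => h; apply: nE; right.
Qed.

End tame_event.

(** * Estimates for block averages *)

Section cumulant_tilt.
Context {R : realType}.
Implicit Types (A g : R -> R) (a z K e t : R).

Lemma approximate_minimizer g K t : (forall l, - K <= g l) -> 0 < t ->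
  exists l, forall l', g l <= g l' + t.
Proof.
move=> gK t0; have hi : has_inf (range g).
  by split; [exists (g 0), 0|exists (- K) => _ [l _ <-]].
have [_ [l _ <-] gl] := inf_adherent t0 hi; exists l => l'.
apply: le_trans (ltW gl) _; rewrite lerD2r; apply: ge_inf; first by case: hi.
by exists l'.
Qed.

(* Minimise [A l - l z + (e1/2) |l|] up to a small error, where [e1] is so small
   that the penalty costs at most [eta]; semiconcavity turns the approximate
   minimality into an upper bound on the difference quotients of [A] at [l]. *)
Lemma cumulant_tilt A a z K e eta : cumulant_like A a ->
  (forall l, l * z - A l <= K) -> 0 < e -> 0 < eta ->
  exists l e1 t, [/\ 0 < e1 <= e, 0 < t, e1 * `|l| <= eta,
    A (l + t) - A l - t * z < e1 * t & A (l - t) - A l + t * z < e1 * t].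
Proof.
move=> [_ _ semi] AK e0 eta0; have eta8 : 0 < eta / 8 by rewrite divr_gt0.
(* A reference point near the unpenalised infimum: [e1] makes the penalty small there, and
   comparison with it bounds [e1 * |l|] by [eta] at the penalised minimiser. *)
have [l|l0 l0min] := @approximate_minimizer (fun l => A l - l * z) K _ _ eta8.
  by have := AK l; lra.
pose e1 := Num.min e (eta / (8 * (`|l0| + 1))).
have l01 : 0 < `|l0| + 1 by rewrite ltr_wpDl.
have e10 : 0 < e1 by rewrite lt_min e0 divr_gt0// mulr_gt0.
have e1l0 : e1 * `|l0| <= eta / 8.
  apply: (@le_trans _ _ (e1 * (`|l0| + 1))); first by rewrite (ler_wpM2l (ltW e10))// lerDl.
  rewrite -ler_pdivlMr//; rewrite -mulrA -invfM.
  by rewrite ge_min lexx orbT.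
(* The radius [eta / e1] is known before the minimiser, so [C] and [t] are fixed first and the
   accuracy [tau] can be small compared with [e1 * t]. *)
have [C C0 AC] := semi (eta / e1).
pose t := Num.min 1 (e1 / (8 * (C + 1))).
have C1 : 0 < C + 1 by rewrite ltr_wpDl.
have t0 : 0 < t by rewrite lt_min ltr01 divr_gt0// mulr_gt0.
have t1 : t <= 1 by rewrite ge_min lexx.
have Ct : C * t ^+ 2 <= e1 * t / 8.
  have : (C + 1) * t <= e1 / 8.
    rewrite mulrC -ler_pdivlMr// -mulrA -invfM ge_min lexx orbT.
    by [].
  move=> /(ler_wpM2r (ltW t0)); have := sqr_ge0 t; rewrite expr2; lra.
pose tau := Num.min (e1 * t / 8) (eta / 8).
have tau0 : 0 < tau by rewrite lt_min eta8 divr_gt0// mulr_gt0.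
have tau1 : tau <= e1 * t / 8 by rewrite ge_min lexx.
have tau2 : tau <= eta / 8 by rewrite ge_min lexx orbT.
have [l|l lmin] := @approximate_minimizer
    (fun l => A l - l * z + e1 / 2 * `|l|) K _ _ tau0.
  have : 0 <= e1 / 2 * `|l| by rewrite mulr_ge0// divr_ge0// ltW.
  by have := AK l; lra.
have le1 : e1 * `|l| <= eta by have := lmin l0; have := l0min l; lra.
have hl : `|l| <= eta / e1 by rewrite ler_pdivlMr// mulrC.
have ht : `|t| <= 1 by rewrite gtr0_norm.
have {}AC := AC _ _ hl ht.
have np : e1 / 2 * `|l + t| <= e1 / 2 * `|l| + e1 / 2 * t.
  by rewrite -mulrDr ler_wpM2l ?divr_ge0 ?(ltW e10)// -{2}(gtr0_norm t0) ler_normD.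
have nm : e1 / 2 * `|l - t| <= e1 / 2 * `|l| + e1 / 2 * t.
  by rewrite -mulrDr ler_wpM2l ?divr_ge0 ?(ltW e10)// -{2}(gtr0_norm t0) ler_normB.
have et : 0 < e1 * t by exact: mulr_gt0.
have hp := lmin (l + t); have hm := lmin (l - t).
exists l, e1, t; split=> //; first by rewrite e10 ge_min lexx.
  by move: AC hp hm; move: (A (l + t)) (A (l - t)) (A l) => x y u; lra.
by move: AC hp hm; move: (A (l + t)) (A (l - t)) (A l) => x y u; lra.
Qed.

End cumulant_tilt.

Lemma measure_bigsetU_le d (T : measurableType d) (R : realType)
    (m : {measure set T -> \bar R}) (I : finType) (Q : pred I) (F : I -> set T) (c : R) :
  0 <= c -> (forall i, measurable (F i)) -> (forall i, Q i -> (m (F i) <= c%:E)%E) ->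
  measurable (\big[setU/set0]_(i | Q i) F i) /\
  (m (\big[setU/set0]_(i | Q i) F i) <= (#|I|%:R * c)%:E)%E.
Proof.
move=> c0 mF mc; have mU : measurable (\big[setU/set0]_(i | Q i) F i).
  by apply: bigsetU_measurable.
split=> //; apply: (@le_trans _ _ (\sum_(i | Q i) c%:E)%E); last first.
  rewrite sumEFin lee_fin sumr_const -[c *+ _]mulr_natl ler_wpM2r// ler_nat.
  exact: max_card.
have [] // : measurable (\big[setU/set0]_(i | Q i) F i) /\
    (m (\big[setU/set0]_(i | Q i) F i) <= (\sum_(i | Q i) c%:E))%E.
elim/big_rec2: _ => [|i x U Qi [mU' mx]]; first by split; rewrite ?measure0.
split; first exact: measurableU.
apply: le_trans (measureU2 m (mF i) mU') _; apply: leeD => //; exact: mc.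
Qed.

(** * Exponential tilting of blocks *)

Section blocks.
Context (d0 : measure_display) (T0 : measurableType d0) (R : realType)
  (P0 : probability T0 R) (xi : {RV P0 >-> R})
  (d : measure_display) (T : measurableType d) (P : probability T R)
  (X : nat -> {RV P >-> R}).
Hypothesis xi_mgf : forall l : R, (mmt_gen_fun P0 xi l < +oo)%E.
Hypothesis iX : mutually_independent X.
Hypothesis X_copies : forall (i : nat) (A : set R), measurable A ->
  distribution P (X i) A = distribution P0 xi A.
Local Notation A := (cgf xi).
Local Notation a := (mean xi).
Implicit Types (l v : nat -> R) (M p : nat).

Definition block_sum p i w : R := \sum_(i * p <= k < i.+1 * p) X k w.

Lemma block_sum_measurable p i : measurable_fun setT (block_sum p i).
Proof. by apply: measurable_sum. Qed.

Lemma sum_block_sum l p M w :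
  \sum_(k < M * p) l (k %/ p)%N * X k w = \sum_(i < M) l i * block_sum p i w.
Proof.
rewrite -(big_mkord xpredT (fun k => l (k %/ p)%N * X k w)).
rewrite (sum_nat_blocks (fun i k => l i * X k w)) big_mkord.
by apply: eq_bigr => i _; rewrite mulr_sumr.
Qed.

Lemma sum_block_const (f : nat -> R) p M :
  \sum_(k < M * p) f (k %/ p)%N = p%:R * \sum_(i < M) f i.
Proof.
rewrite -(big_mkord xpredT (fun k => f (k %/ p)%N)) sum_blocks big_mkord.
by rewrite mulr_sumr; apply: eq_bigr => i _; rewrite mulr_natl.
Qed.

Lemma block_expectation l p M :
  (\int[P]_w (expR (\sum_(i < M) l i * block_sum p i w))%:E =
   (expR (p%:R * \sum_(i < M) A (l i)))%:E)%E.
Proof.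
have := walk_expectation xi_mgf iX X_copies (fun k => l (k %/ p)%N) (M * p).
rewrite (sum_block_const (A \o l)) => <-.
by apply: eq_integral => w _; rewrite sum_block_sum.
Qed.

Lemma block_chernoff l p M b :
  (P [set w | (b <= \sum_(i < M) l i * block_sum p i w)%R] <=
   (expR (p%:R * \sum_(i < M) A (l i) - b))%:E)%E.
Proof.
have := walk_chernoff xi_mgf iX X_copies (fun k => l (k %/ p)%N) (M * p) b.
rewrite (sum_block_const (A \o l)).
by under eq_set => w do rewrite sum_block_sum.
Qed.

Lemma sum_single (S : nat -> R) M i t : (i < M)%N ->
  \sum_(j < M) (t * (val j == i)%:R) * S j = t * S i.
Proof.
move=> iM; rewrite (bigD1 (Ordinal iM))//= eqxx mulr1 big1 ?addr0// => j ji.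
rewrite (_ : (val j == i) = false) ?mulr0 ?mul0r//.
by apply: contra_neqF ji => /eqP ji; exact/val_inj.
Qed.

Lemma sum_single_shift (f : R -> R) l M i t : (i < M)%N ->
  \sum_(j < M) f (l j + t * (val j == i)%:R) =
  \sum_(j < M) f (l j) + (f (l i + t) - f (l i)).
Proof.
move=> iM; rewrite (bigD1 (Ordinal iM))//= [in RHS](bigD1 (Ordinal iM))//= eqxx mulr1.
rewrite (eq_bigr (fun j : 'I_M => f (l j))); last first.
  move=> j ji; rewrite (_ : (val j == i) = false) ?mulr0 ?addr0//.
  by apply: contra_neqF ji => /eqP ji; exact/val_inj.
by ring.
Qed.

Lemma tilted_block_expectation l p M i t b : (i < M)%N ->
  (\int[P]_w (expR (\sum_(j < M) l j * block_sum p j w + t * block_sum p i w - b))%:E =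
   (expR (p%:R * \sum_(j < M) A (l j) + p%:R * (A (l i + t) - A (l i)) - b))%:E)%E.
Proof.
move=> iM; pose lt j := l j + t * (j == i)%:R.
have ltS w : \sum_(j < M) lt j * block_sum p j w =
    \sum_(j < M) l j * block_sum p j w + t * block_sum p i w.
  rewrite -(sum_single (fun j => block_sum p j w) t iM) -big_split/=.
  by apply: eq_bigr => j _; rewrite mulrDl.
have := block_expectation lt p M; rewrite /lt (sum_single_shift A l t iM) mulrDr -/lt => lE.
transitivity (\int[P]_w ((expR (- b))%:E *
    (expR (\sum_(j < M) lt j * block_sum p j w))%:E))%E.
  by apply: eq_integral => w _; rewrite ltS -EFinM -expRD addrC.
rewrite ge0_integralZl//.
- by rewrite lE -EFinM -expRD addrC.
- apply/measurable_EFinP; apply: measurableT_comp; first exact: measurable_expR.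
  apply: measurable_sum => j; apply: measurable_funM => //.
  exact: block_sum_measurable.
Qed.

Definition near_blocks p M (v : nat -> R) (e : nat -> R) : set T :=
  [set w | forall i, (i < M)%N -> `|block_sum p i w - p%:R * v i| <= p%:R * e i].

Lemma near_blocks_measurable p M v e : measurable (near_blocks p M v e).
Proof.
apply: bigcap_measurableType => i _.
rewrite -[X in measurable X]setTI; apply: measurable_fun_le => //.
apply: measurableT_comp => //; apply: measurable_funB => //.
exact: block_sum_measurable.
Qed.

(* The expectation [exp (p sum_i A (l i))] of [exp (sum_i l i * block_sum i)] is carried
   by [near_blocks]: where block [i] is off target, upwards or downwards, tilting it
   further by [t i] shows that the contribution has a share of at most [exp (- p k)]. *)
Lemma block_tilt l v (e t : nat -> R) p M k :
  (forall i, (i < M)%N -> [/\ 0 < t i, 0 <= e i,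
    A (l i + t i) - A (l i) - t i * v i <= e i * t i - k &
    A (l i - t i) - A (l i) + t i * v i <= e i * t i - k]) ->
  M%:R * 2 * expR (- (p%:R * k)) <= 1 / 2 ->
  ((expR (- (p%:R * \sum_(i < M) (l i * v i - A (l i) + e i * `|l i|))) / 2)%:E <=
   P (near_blocks p M v e))%E.
Proof.
move=> lt Mk; set G := near_blocks p M v e; have mG : measurable G by exact: near_blocks_measurable.
pose W w := \sum_(i < M) l i * block_sum p i w.
pose L := p%:R * \sum_(i < M) A (l i).
pose U := p%:R * \sum_(i < M) (l i * v i + e i * `|l i|).
(* An index [j] names a block and a direction. [s j] is the extra tilt and [b j] the level it passes
   when that block is off target in that direction, so that there [D j] dominates [expR W]. *)
pose s (j : 'I_M * bool) := if j.2 then t j.1 else - t j.1.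
pose b (j : 'I_M * bool) := p%:R * (s j * v j.1 + t j.1 * e j.1).
pose D j w := expR (W w + s j * block_sum p j.1 w - b j).
have mW : measurable_fun setT W.
  apply: measurable_sum => i; apply: measurable_funM => //.
  exact: block_sum_measurable.
have mD j : measurable_fun setT (EFin \o D j).
  apply/measurable_EFinP; apply: measurableT_comp; first exact: measurable_expR.
  apply: measurable_funB => //; apply: measurable_funD => //.
  by apply: measurable_funM => //; exact: block_sum_measurable.
have mGE : measurable_fun setT (fun w => (expR U)%:E * (\1_G w)%:E)%E.
  by apply: measurable_funeM; apply/measurable_EFinP; exact: measurable_indic.
have D0 j w : (0 <= (EFin \o D j) w)%E by rewrite lee_fin expR_ge0.
have mSD : measurable_fun setT (fun w => \sum_j (EFin \o D j) w)%E.
  by apply: emeasurable_sum.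
have key : ((expR L)%:E <= (expR U)%:E * P G + \sum_(j : 'I_M * bool) (expR (L - p%:R * k))%:E)%E.
  rewrite -block_expectation.
  apply: (@le_trans _ _ (\int[P]_w ((expR U)%:E * (\1_G w)%:E + \sum_j (EFin \o D j) w))%E).
    apply: ge0_le_integral => //.
    - apply/measurable_EFinP; apply: measurableT_comp => //; exact: measurable_expR.
    - by apply: emeasurable_funD.
    move=> w _; rewrite sumEFin indicE -EFinM -EFinD lee_fin -/(W w).
    have SD0 : 0 <= \sum_j D j w by apply: sumr_ge0 => j _; exact: expR_ge0.
    case: (boolP (w \in G)) => [/set_mem Gw|/negP Gw].
      rewrite mulr1 -[leLHS]addr0; apply: lerD => //.
      rewrite ler_expR /U mulr_sumr; apply: ler_sum => i _.
      have := Gw i (ltn_ord i); have := ler_norm (l i * (block_sum p i w - p%:R * v i)).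
      rewrite normrM mulrBr => h1 /(ler_wpM2l (normr_ge0 (l i))) h2; lra.
    rewrite mulr0 add0r; have {Gw} [i [iM Gi]] : exists i, (i < M)%N /\
        p%:R * e i < `|block_sum p i w - p%:R * v i|.
      apply: contrapT => nG; apply: Gw; apply/mem_set => i iM.
      by rewrite leNgt; apply/negP => h; apply: nG; exists i.
    have [ti _ _ _] := lt i iM.
    pose j : 'I_M * bool := (Ordinal iM, 0 <= block_sum p i w - p%:R * v i).
    apply: (@le_trans _ _ (D j w)); last first.
      rewrite (bigD1 j)//= lerDl; apply: sumr_ge0 => j' _; exact: expR_ge0.
    rewrite ler_expR -addrA lerDl subr_ge0 /b /s /j/=; case: ifPn => h.
      move: Gi; rewrite ger0_norm// => /ltW/(ler_wpM2l (ltW ti)); lra.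
    rewrite -ltNge in h; move: Gi; rewrite ltr0_norm// => /ltW/(ler_wpM2l (ltW ti)); lra.
  rewrite ge0_integralD//; last by move=> w _; apply: sume_ge0.
  apply: leeD.
    rewrite ge0_integralZl//; last exact/measurable_EFinP/measurable_indic.
    by rewrite integral_indic// setIT.
  rewrite ge0_integral_sum//; apply: lee_sum => -[i c] _.
  rewrite tilted_block_expectation//= lee_fin ler_expR -/L -addrA lerD2l /b /s/=.
  have [_ _ h1 h2] := lt i (ltn_ord i); have p0 := ler0n R p.
  case: c => /=.
    move: (ler_wpM2l p0 h1) => {h1 h2 Mk}; move: (A (l i + t i)) (A (l i)) => x y; lra.
  move: (ler_wpM2l p0 h2) => {h1 h2 Mk}; move: (A (l i - t i)) (A (l i)) => x y; lra.
have PG : P G = (fine (P G))%:E by rewrite fineK//; exact: fin_num_measure.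
move: key; rewrite PG; move: (fine (P G)) => g.
rewrite sumEFin sumr_const card_prod card_ord card_bool -[_ *+ (M * 2)]mulr_natl -EFinM -EFinD.
rewrite !lee_fin expRD natrM => h.
(* By the hypothesis on [k], the off-target terms take at most half of [expR L]. *)
have {}h : expR L <= 2 * (expR U * g).
  by have := ler_wpM2r (expR_ge0 L) Mk; lra.
have -> : - (p%:R * \sum_(i < M) (l i * v i - A (l i) + e i * `|l i|)) = L - U.
  rewrite /L /U -mulrBr -sumrB -mulrN -sumrN; congr (_ * _)%R.
  by apply: eq_bigr => i _; move: (A (l i)) => y; ring.
rewrite expRD expRN ler_pdivrMr// mulrC ler_pdivrMl ?expR_gt0//; lra.
Qed.

End blocks.

Lemma positive_lower_bound (R : realType) (k : nat -> R) M :
  (forall i, (i < M)%N -> 0 < k i) ->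
  exists2 k0, 0 < k0 & forall i, (i < M)%N -> k0 <= k i.
Proof.
elim: M => [_|M IH kM]; first by exists 1.
have [i iM|k0 k00 hk0] := IH; first exact/kM/ltnW.
exists (Num.min k0 (k M)) => [|i]; first by rewrite lt_min k00 kM.
rewrite ltnS leq_eqVlt => /predU1P[->|iM]; rewrite ge_min ?lexx ?orbT//.
by rewrite hk0.
Qed.

Section block_estimates.
Context (d0 : measure_display) (T0 : measurableType d0) (R : realType)
  (P0 : probability T0 R) (xi : {RV P0 >-> R})
  (d : measure_display) (T : measurableType d) (P : probability T R)
  (X : nat -> {RV P >-> R}).
Hypothesis xi_mgf : forall l : R, (mmt_gen_fun P0 xi l < +oo)%E.
Hypothesis iX : mutually_independent X.
Hypothesis X_copies : forall (i : nat) (A : set R), measurable A ->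
  distribution P (X i) A = distribution P0 xi A.
Local Notation A := (cgf xi).
Local Notation a := (mean xi).
Implicit Types (l v : nat -> R) (M p : nat).

Lemma near_blocks_lower v M e eta : 0 < e -> 0 < eta ->
  (forall i, (i < M)%N -> exists K, forall l : R, l * v i - A l <= K) ->
  exists l, \forall p \near \oo,
    ((expR (- (p%:R * \sum_(i < M) (l i * v i - A (l i) + eta))) / 2)%:E <=
     P (near_blocks X p M v (fun=> e)))%E.
Proof.
move=> e0 eta0 vK; have cA := cgf_cumulant_like xi_mgf.
pose good i (q : R * R * R) := let: (l, e1, t) := q in
  [/\ 0 < e1 <= e, 0 < t, e1 * `|l| <= eta,
    A (l + t) - A l - t * v i < e1 * t & A (l - t) - A l + t * v i < e1 * t].
have /choice[q hq] i : exists q, (i < M)%N -> good i q.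
  have [iM|_] := ltnP i M; last by exists (0, 0, 0).
  have [K AK] := vK i iM; have [l [e1 [t h]]] := cumulant_tilt cA AK e0 eta0.
  by exists (l, e1, t).
pose l i := (q i).1.1; pose e1 i := (q i).1.2; pose t i := (q i).2.
have {}hq i : (i < M)%N -> [/\ 0 < e1 i <= e, 0 < t i, e1 i * `|l i| <= eta,
    A (l i + t i) - A (l i) - t i * v i < e1 i * t i &
    A (l i - t i) - A (l i) + t i * v i < e1 i * t i].
  by move=> /hq; rewrite /good /l /e1 /t; case: (q i) => -[].
pose k i := Num.min (e1 i * t i - (A (l i + t i) - A (l i) - t i * v i))
  (e1 i * t i - (A (l i - t i) - A (l i) + t i * v i)).
(* The strict inequalities leave a gap in each block, with a common positive lower bound;
   [p k0 >= 4 M] then meets the smallness condition of [block_tilt]. *)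
have [i iM|k0 k00 hk] := @positive_lower_bound _ k M.
  by have [_ _ _ h1 h2] := hq i iM; rewrite lt_min !subr_gt0 h1.
exists l; exists (Num.truncn (4 * M%:R / k0)).+1 => // p /= Mp.
have pk : 4 * M%:R <= p%:R * k0.
  rewrite -ler_pdivrMr//; apply: le_trans (ltW (truncnS_gt _)) _.
  by rewrite ler_nat.
have Mexp : M%:R * 2 * expR (- (p%:R * k0)) <= 1 / 2.
  rewrite expRN ler_pdivrMr ?expR_gt0//.
  have := expR_ge1Dx (p%:R * k0); lra.
have lt i : (i < M)%N -> [/\ 0 < t i, 0 <= e1 i,
    A (l i + t i) - A (l i) - t i * v i <= e1 i * t i - k0 &
    A (l i - t i) - A (l i) + t i * v i <= e1 i * t i - k0].
  move=> iM; have [/andP[/ltW e10 _] t0 _ _ _] := hq i iM.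
  by have := hk i iM; rewrite le_min => /andP[h1 h2]; rewrite !lerBrDl -!lerBrDr.
apply: le_trans (le_trans _ (block_tilt xi_mgf iX X_copies lt Mexp)) _.
  rewrite lee_fin ler_pM2r ?invr_gt0// ler_expR lerN2 ler_wpM2l//.
  by apply: ler_sum => i _; rewrite lerD2l; have [] := hq i (ltn_ord i).
apply: le_measure; [apply/mem_set; exact: near_blocks_measurable..|].
move=> w h i iM; apply: le_trans (h i iM) _; apply: ler_wpM2l => //.
by have [/andP[]] := hq i iM.
Qed.

(* The multipliers of the wrong sign contribute a nonpositive amount, so that
   they can be replaced by 0. *)
Lemma signed_blocks_upper (sg : nat -> R) l v p M (r : R) :
  (forall i, sg i * sg i = 1) -> (forall i, (i < M)%N -> 0 <= sg i * (v i - a)) ->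
  r <= p%:R * \sum_(i < M) (l i * v i - A (l i)) ->
  (P [set w | forall i, (i < M)%N -> (0 <= sg i * (block_sum X p i w - p%:R * v i))%R] <=
   (expR (- r))%:E)%E.
Proof.
move=> sg2 va rl; have [A0 Aa _] := cgf_cumulant_like xi_mgf.
pose l' i := if 0 <= sg i * l i then l i else 0.
have sgE x y i : sg i * x * (sg i * y) = x * y.
  by rewrite mulrACA sg2 mul1r.
have l'l : \sum_(i < M) (l i * v i - A (l i)) <= \sum_(i < M) (l' i * v i - A (l' i)).
  apply: ler_sum => i _; rewrite /l'; case: ifPn => [_|]; first exact: lexx.
  rewrite -ltNge => h.
  rewrite A0 mul0r subr0; apply: (@le_trans _ _ (l i * (v i - a))).
    by rewrite mulrBr lerD2l lerN2.
  by rewrite -(sgE (l i) (v i - a) i) nmulr_rle0// va.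
pose b := p%:R * \sum_(i < M) l' i * v i.
apply: le_trans (le_trans _ (block_chernoff xi_mgf iX X_copies l' p M b)) _; last first.
  rewrite lee_fin ler_expR lerNr opprB; apply: le_trans rl _.
  rewrite /b -mulrBr -sumrB; exact: ler_wpM2l.
apply: le_measure.
- apply/mem_set; apply: bigcap_measurableType => i _; apply: measurable_superlevel.
  apply: measurable_funM => //; apply: measurable_funB => //.
  exact: block_sum_measurable.
- apply/mem_set; apply: measurable_superlevel; apply: measurable_sum => i.
  by apply: measurable_funM => //; exact: block_sum_measurable.
move=> w h /=; rewrite /b mulr_sumr; apply: ler_sum => i _.
rewrite -subr_ge0 mulrCA -mulrBr -(sgE _ _ i) mulr_ge0 ?h//.
by rewrite /l'; case: ifP => // _; rewrite mulr0.
Qed.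

End block_estimates.

(** * Block paths approximating a given path *)

Section block_approximation.
Context {R : realType}.
Variables (A : R -> R) (a : R).
Hypothesis cA : cumulant_like A a.
Implicit Types (f : R -> R) (r delta : R) (n m p q k S : nat).

Definition block_slope f m M i : R :=
  if (i < M)%N then m%:R * (f (i.+1%:R / m%:R) - f (i%:R / m%:R)) else a.

Lemma sum_block_slope f m M p q : (q <= M)%N -> f 0 = 0 ->
  \sum_(0 <= j < q * p) block_slope f m M (j %/ p)%N = p%:R * (m%:R * f (q%:R / m%:R)).
Proof.
move=> qM f0; rewrite (sum_blocks (block_slope f m M)).
rewrite (eq_big_nat _ _
  (F2 := fun i => p%:R * m%:R * (f (i.+1%:R / m%:R) - f (i%:R / m%:R)))); last first.
  move=> i /andP[_ iq]; rewrite /block_slope (leq_trans iq qM).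
  by rewrite -[LHS]mulr_natl mulrA.
rewrite -mulr_sumr (telescope_sumr (fun i => f (i%:R / m%:R)))//.
by rewrite mul0r f0 subr0 mulrA.
Qed.

(** Slopes are sampled over times [1 / m] but used for times [p / n], so the clock is off by the
    factor [rho = p m / n], between 1 and [1 + m / n]. This distortion, the oscillation over a block
    and the tail are estimated separately. *)
Lemma block_nodes_close r delta : 0 < delta -> exists m0, forall S m f,
  (m0 <= S)%N -> (m0 <= m)%N -> (0 < m)%N -> energy_le A f r ->
  \forall n \near \oo, forall k,
    `|block_nodes (block_slope f m (S * m)) (n %/ m).+1 n k - f (k%:R / n%:R)| <=
    4 * delta * (1 + k%:R / n%:R).
Proof.
move=> del0; have [T T0 ftail] := energy_le_tail cA r del0.
have [d d0 fequi] := energy_le_equicontinuous A r del0.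
exists (maxn (Num.truncn T).+1 (Num.truncn (4 / d)).+1) => S m f.
rewrite !geq_max => /andP[TS _] /andP[_ dm] m0 fr; set M := (S * m)%N.
have f0 : f 0 = 0 by case: fr.
have {}TS : T <= S%:R.
  by apply: le_trans (ltW (truncnS_gt _)) _; rewrite ler_nat.
have m0' : 0 < m%:R :> R by rewrite ltr0n.
have {}dm : m%:R^-1 < d / 4.
  rewrite invf_plt ?posrE ?divr_gt0// invf_div.
  by apply: lt_le_trans (truncnS_gt _) _; rewrite ler_nat.
pose F0 := r + S%:R * (`|A 1| + `|A (- 1)|).
have fF u : 0 <= u -> u <= S%:R -> `|f u| <= F0.
  move=> u0 uS; have := energy_le_increment fr (lexx 0) u0 ltr01.
  rewrite f0 !subr0 divr1 => /le_trans; apply; rewrite lerD2l.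
  by rewrite ler_wpM2r// addr_ge0.
have F00 : 0 <= F0 by apply: le_trans (fF 0 (lexx 0) _); rewrite ?ler0n.
exists (maxn m (maxn (Num.truncn (m%:R * F0 / delta)).+1
  (Num.truncn (M%:R * 4 / d)).+1)) => // n /=; rewrite !geq_max => /and3P[mn Fn Mn] k.
have n0 : (0 < n)%N by exact: leq_trans mn.
have n0' : 0 < n%:R :> R by rewrite ltr0n.
have {}Fn : m%:R / n%:R * F0 <= delta.
  rewrite mulrAC ler_pdivrMr// -ler_pdivrMl// mulrC.
  by apply: le_trans (ltW (truncnS_gt _)) _; rewrite ler_nat.
have {}Mn : M%:R / n%:R <= d / 4.
  rewrite ler_pdivrMr// -ler_pdivrMl ?divr_gt0// invf_div mulrC mulrA.
  by apply: le_trans (ltW (truncnS_gt _)) _; rewrite ler_nat.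
set p := (n %/ m).+1; pose rho : R := p%:R * m%:R / n%:R.
have rho1 : 1 <= rho.
  by rewrite ler_pdivlMr// mul1r -natrM ler_nat ltnW// ltn_ceil.
have rhom : rho - 1 <= m%:R / n%:R.
  rewrite lerBlDr ler_pdivrMr// mulrDl divfK ?lt0r_neq0// mul1r -natrM -natrD ler_nat.
  by rewrite mulSn leq_add2l; exact: leq_trunc_div.
have rho2 : rho <= 2.
  suff : m%:R / n%:R <= 1 :> R by move: rhom; lra.
  by rewrite ler_pdivrMr// mul1r ler_nat.
set u := k%:R / n%:R; have u0 : 0 <= u by rewrite divr_ge0.
have Mm : M%:R = S%:R * m%:R :> R by rewrite natrM.
rewrite /block_nodes -(big_mkord xpredT (fun j => block_slope f m M (j %/ p)%N)).
have [Mk|kM] := leqP (M * p) k.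
  have Su : S%:R * rho <= u.
    by rewrite /rho mulrA ler_pM2r ?invr_gt0// mulrCA -natrM -natrM mulnC ler_nat.
  have Su' : S%:R <= u by apply: le_trans Su; rewrite ler_peMr.
  rewrite (@big_cat_nat _ _ _ (M * p))//= sum_block_slope//.
  rewrite (eq_big_nat _ _ (F2 := fun=> a)); last first.
    by move=> j /andP[Mj _]; rewrite /block_slope ltnNge leq_divRL ?Mj.
  rewrite sumr_const_nat -[a *+ _]mulr_natr natrB// natrM Mm mulfK ?lt0r_neq0//.
  (* Beyond the blocks both terms are deviations from the drift, at the times [S] and [u]. *)
  have -> : (p%:R * (m%:R * f S%:R) + a * (k%:R - S%:R * m%:R * p%:R)) / n%:R - f u =
      rho * (f S%:R - a * S%:R) - (f u - a * u).
    by rewrite /rho /u; field; rewrite lt0r_neq0.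
  have h1 := ftail f fr _ TS; have h2 := ftail f fr _ (le_trans TS Su').
  have h3 : `|rho * (f S%:R - a * S%:R)| <= 2 * (delta * S%:R).
    by rewrite normrM ger0_norm ?ler_pM//; lra.
  have := ler_normB (rho * (f S%:R - a * S%:R)) (f u - a * u).
  have := mulr_ge0 (ltW del0) u0; have := ler_wpM2l (ltW del0) Su'; lra.
have p0 : (0 < p)%N by [].
have qM : (k %/ p < M)%N by rewrite ltn_divLR.
have qk : (k %/ p * p <= k)%N by exact: leq_trunc_div.
have kq : (k < (k %/ p).+1 * p)%N by exact: ltn_ceil.
rewrite (@big_cat_nat _ _ _ (k %/ p * p))//= sum_block_slope ?(ltnW qM)//.
rewrite (eq_big_nat _ _ (F2 := fun=> block_slope f m M (k %/ p))); last first.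
  move=> j /andP[qj jk]; congr block_slope; apply/eqP; rewrite eqn_leq.
  by rewrite leq_div2r ?(ltnW jk)//= (leq_divRL (k %/ p) j p0).
rewrite sumr_const_nat /block_slope qM; move: (k %/ p)%N qM qk kq => q qM qk kq.
set g := f (q%:R / m%:R); set g' := f (q.+1%:R / m%:R).
pose tau : R := (k - q * p)%:R * m%:R / n%:R.
(* The clock error over complete blocks, the incomplete block, and the change of [f] from the node
   [q / m] to [u]; they cost [delta], [2 delta] and [delta]. *)
have -> : (p%:R * (m%:R * g) + m%:R * (g' - g) *+ (k - q * p)) / n%:R - f u =
    (rho - 1) * g + tau * (g' - g) + (g - f u).
  by rewrite -[_ *+ _]mulr_natr /rho /tau; field; rewrite lt0r_neq0.
have qS : q%:R / m%:R <= S%:R :> R by rewrite ler_pdivrMr// -Mm ler_nat ltnW.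
have q0 : 0 <= q%:R / m%:R :> R by rewrite divr_ge0.
have h1 : `|(rho - 1) * g| <= delta.
  rewrite normrM ger0_norm ?subr_ge0//; apply: le_trans Fn.
  by apply: ler_pM => //; [rewrite subr_ge0|exact: fF].
have h2 : `|tau * (g' - g)| <= 2 * delta.
  have tau0 : 0 <= tau by rewrite divr_ge0// mulr_ge0.
  rewrite normrM (ger0_norm tau0); apply: ler_pM => //.
    apply: le_trans rho2; rewrite /tau /rho ler_pM2r ?invr_gt0// ler_pM2r// ler_nat.
    by rewrite leq_subLR addnC -mulSn ltnW.
  apply: ltW; apply: (fequi f fr) => //.
  rewrite -mulrBl -natrB// subSnn div1r gtr0_norm ?invr_gt0//.
  by apply: lt_trans dm _; rewrite ltr_pdivrMr//; lra.
have h3 : `|g - f u| <= delta.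
  apply: ltW; rewrite distrC; apply: (fequi f fr) => //.
  have uq : q%:R / m%:R <= u.
    rewrite ler_pdivrMr// /u mulrAC ler_pdivlMr// -!natrM ler_nat.
    apply: (@leq_trans (q * p * m)); last by rewrite leq_mul2r qk orbT.
    by rewrite -mulnA leq_mul2l mulnC ltnW ?orbT// mulnC ltn_ceil.
  rewrite ger0_norm ?subr_ge0//.
  have uq' : u <= q.+1%:R / m%:R * rho.
    have -> : q.+1%:R / m%:R * rho = (q.+1 * p)%:R / n%:R.
      by rewrite natrM /rho; field; rewrite !lt0r_neq0.
    by rewrite ler_pM2r ?invr_gt0// ler_nat ltnW.
  have q1 : q.+1%:R / m%:R * (rho - 1) <= M%:R / n%:R.
    apply: (@le_trans _ _ (M%:R / m%:R * (m%:R / n%:R))).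
      apply: ler_pM => //; first by rewrite subr_ge0.
      by rewrite ler_pM2r ?invr_gt0// ler_nat.
    by rewrite mulrA divfK ?lt0r_neq0.
  have q2 : q.+1%:R / m%:R = q%:R / m%:R + m%:R^-1 :> R.
    by rewrite -natr1 mulrDl mul1r.
  move: uq' q1; rewrite mulrBr mulr1 q2; lra.
have := ler_normD ((rho - 1) * g + tau * (g' - g)) (g - f u).
have := ler_normD ((rho - 1) * g) (tau * (g' - g)).
have := mulr_ge0 (ltW del0) u0; lra.
Qed.

End block_approximation.

(** * The two bounds *)

Section log_asymptotics.
Context {R : realType}.
Implicit Types (q : \bar R) (n : nat) (z : R).
Local Open Scope ereal_scope.

Lemma scaled_lne_ge q n z : (0 < n)%N -> (expR (n%:R * z))%:E <= q ->
  z%:E <= (n%:R^-1)%:E * lne q.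
Proof.
move=> n0 hq; have n0' : (0 < n%:R :> R)%R by rewrite ltr0n.
have q0 : 0 <= q by apply: le_trans hq; rewrite lee_fin expR_ge0.
have hl : (n%:R * z)%:E <= lne q.
  rewrite -(expRK (n%:R * z)%R) -lne_EFin ?expR_gt0// lee_lne ?in_itv/= ?leey ?andbT//.
apply: le_trans (lee_wpmul2l _ hl); last by rewrite lee_fin invr_ge0.
by rewrite -EFinM mulKf// gt_eqF.
Qed.

Lemma scaled_lne_le q n z : (0 < n)%N -> 0 <= q -> q <= (expR (n%:R * z))%:E ->
  (n%:R^-1)%:E * lne q <= z%:E.
Proof.
move=> n0 q0 hq; have n0' : (0 < n%:R :> R)%R by rewrite ltr0n.
have hl : lne q <= (n%:R * z)%:E.
  rewrite -(expRK (n%:R * z)%R) -lne_EFin ?expR_gt0// lee_lne ?in_itv/= ?leey ?andbT//.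
apply: le_trans (lee_wpmul2l _ hl) _; first by rewrite lee_fin invr_ge0.
by rewrite -EFinM mulKf// gt_eqF.
Qed.

End log_asymptotics.

(** * The lower bound near a path of finite rate *)

Section lower_bound.
Context (d0 : measure_display) (T0 : measurableType d0) (R : realType)
  (P0 : probability T0 R) (xi : {RV P0 >-> R})
  (d : measure_display) (T : measurableType d) (P : probability T R)
  (X : nat -> {RV P >-> R}) (x : nat -> R).
Hypothesis xi_mgf : forall l : R, (mmt_gen_fun P0 xi l < +oo)%E.
Hypothesis iX : mutually_independent X.
Hypothesis X_copies : forall (i : nat) (A : set R), measurable A ->
  distribution P (X i) A = distribution P0 xi A.
Hypothesis x_gt0 : forall n : nat, (0 < n)%N -> 0 < x n.
Hypothesis x_equiv : x n / n%:R @[n --> \oo] --> (1 : R).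
Local Notation A := (cgf xi).
Local Notation a := (mean xi).

Lemma scaling_error (K delta : R) : 0 <= K -> 0 < delta ->
  \forall n \near \oo, `|n%:R / x n - 1| * K <= delta.
Proof.
move=> K0 del0; have K1 : 0 < K + 1 by rewrite ltr_wpDl.
have nx : (x n / n%:R)^-1 @[n --> \oo] --> (1 : R).
  by rewrite -[X in _ --> X]invr1; apply: cvgV => //; exact: oner_neq0.
have dK : 0 < delta / (K + 1) by rewrite divr_gt0.
have /cvgrPdist_le/(_ _ dK) := nx; apply: filterS => n; rewrite invf_div distrC => h.
apply: le_trans (ler_wpM2r K0 h) _; rewrite mulrAC ler_pdivrMr//.
by rewrite ler_wpM2l ?(ltW del0)// lerDl.
Qed.

Lemma walk_lower (f : Cspace (0 : R)) (B : set (Cspace (0 : R))) (r g : R) :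
  nbhs f B -> energy_le A (extend f) r -> 0 < g ->
  \forall n \near \oo,
    ((expR (n%:R * - (r + g)))%:E <= mu_ext P (walk_path 0 X x n @^-1` B))%E.
Proof.
move=> /nbhs_rho[e0 e00 e0B] fr g0; have cA := cgf_cumulant_like xi_mgf.
have r0 := energy_le_ge0 fr.
(* [4 delta] from the walk and [4 delta] from [f], doubled by interpolation, make
   [16 delta = e0 / 2]. *)
pose delta := e0 / 32; have del0 : 0 < delta by rewrite divr_gt0.
have [m1 [K [K0 hE]]] := tame_event xi_mgf iX X_copies (r + g + 1) del0.
have [m2 hf] := block_nodes_close cA r del0.
have del80 : 0 < 8 * delta by rewrite mulr_gt0.
have [dd dd0 fequi] := energy_le_equicontinuous A r del80.
pose S := maxn m1 m2; pose m := (maxn m1 m2).+1; pose M := (S * m)%N.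
have S1 : 0 < S%:R + 1 :> R by rewrite ltr_wpDl.
have m0' : 0 < m%:R :> R by rewrite ltr0n.
(* Since [M p <= 2 (S + 1) n], the tolerance [e] costs at most [delta n] over all blocks, and [eta]
   at most [n g / 2] in the exponent. *)
pose e := delta / (2 * (S%:R + 1)); pose eta := g / (4 * (S%:R + 1)).
have e_gt0 : 0 < e by rewrite divr_gt0// mulr_gt0.
have eta_gt0 : 0 < eta by rewrite divr_gt0// mulr_gt0.
pose v := block_slope a (extend f) m M.
have m1S : (m1 <= S)%N by exact: leq_maxl.
have m2S : (m2 <= S)%N by exact: leq_maxr.
have m1m : (m1 <= m)%N by exact: leqW.
have m2m : (m2 <= m)%N by exact: leqW.
have vE i : (i < M)%N -> v i = m%:R * (extend f (i.+1%:R / m%:R) - extend f (i%:R / m%:R)).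
  by rewrite /v /block_slope => ->.
have mV0 : 0 < m%:R^-1 :> R by rewrite invr_gt0.
have vK i : (i < M)%N -> exists K', forall l : R, l * v i - A l <= K'.
  move=> iM; exists (m%:R * r) => l; rewrite vE//.
  have im : (i%:R / m%:R : R) <= i.+1%:R / m%:R by rewrite ler_pM2r// ler_nat.
  have := energy_le_itv fr l (divr_ge0 (ler0n _ _) (ler0n _ _)) im.
  rewrite -mulrBl -natrB// subSnn div1r -(ler_pM2l m0') mulrBr mulVKf ?gt_eqF//.
  by rewrite mulrCA.
have [l hl] := near_blocks_lower xi_mgf iX X_copies e_gt0 eta_gt0 vK.
have lsum : \sum_(i < M) (l i * v i - A (l i)) <= m%:R * r.
  have := energy_le_mesh fr mV0 M l; rewrite -(ler_pM2l m0') => /(le_trans _); apply.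
  rewrite big_mkord mulr_sumr; apply: ler_sum => i _; rewrite vE//.
  by rewrite [leRHS]mulrBr mulVKf ?gt_eqF// mulrCA.
case: hl => N _ hN; have := hE S m m1S m1m (ltn0Sn _); have := hf S m _ m2S m2m (ltn0Sn _) fr.
have := scaling_error K0 del0.
pose N' := maxn (maxn m (N * m)) (maxn (Num.truncn (dd^-1)).+1
  (Num.truncn ((3 + m%:R * r) * 2 / g)).+1).
have : \forall n \near \oo, (N' <= n)%N by exists N'.
move=> large /(filterI large); apply: filterS3 => n [].
rewrite !geq_max => /andP[/andP[mn Nmn] /andP[ddn gn]] xn fn.
move=> [E [mE PE hwE]].
have n0 : (0 < n)%N by exact: leq_trans mn.
have n0' : 0 < n%:R :> R by rewrite ltr0n.
set p := (n %/ m).+1; have Np : (N <= p)%N by rewrite leqW// leq_divRL.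
have pm : p%:R * m%:R <= 2 * n%:R :> R.
  by rewrite -natrM mulSn -natrM ler_nat mul2n -addnn leq_add//; exact: leq_trunc_div.
have pm' : p%:R * m%:R <= n%:R + m%:R :> R.
  by rewrite -natrM mulSn -natrD ler_nat addnC leq_add2r; exact: leq_trunc_div.
have {hN Np} := hN p Np; set G := near_blocks _ _ _ _ _ => PG.
have mG : measurable G by exact: near_blocks_measurable.
have Mp : M%:R * p%:R <= 2 * (S%:R + 1) * n%:R :> R.
  rewrite /M natrM -mulrA [m%:R * _]mulrC.
  have := ler_wpM2l (ler0n R S) pm; lra.
have sub : G `\` E `<=` walk_path 0 X x n @^-1` B.
  move=> w [Gw nEw]; apply: e0B; apply: rho_ball_sym.
  apply: (@rho_ballW _ _ _ (2 * (8 * delta))) => [|t t0]; first by rewrite /delta; lra.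
  rewrite extend_polygonal//; apply: polyline_close => //; first exact: ltW.
    move=> k; have := fn k; have tw := hwE w nEw.
    have Me : M%:R * (p%:R * e) <= delta * n%:R.
      rewrite mulrA /e mulrA ler_pdivrMr; last by rewrite mulr_gt0.
      by have := ler_wpM2r (ltW del0) Mp; lra.
    have := tame_walk n0 (ltn0Sn _) (ltW e_gt0) (ltW del0) (x_gt0 n0) tw xn Me Gw _ k.
    rewrite /random_walk -/p -/v -/M => h1 h2.
    have {}h1 := h1 _; rewrite -(subrKA (block_nodes v p n k)).
    apply: le_trans (ler_normD _ _) _.
    have -> : 8 * delta * (1 + k%:R / n%:R) =
      4 * delta * (1 + k%:R / n%:R) + 4 * delta * (1 + k%:R / n%:R) by lra.
    apply: lerD => //; apply: h1 => i Mi; by rewrite /v /block_slope ltnNge Mi.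
  move=> u1 u2 u10 u20 u12; apply: ltW; apply: (fequi _ fr) => //.
  apply: le_lt_trans u12 _; rewrite invf_plt ?posrE//.
  by apply: lt_le_trans (truncnS_gt _) _; rewrite ler_nat.
have mGE : measurable (G `\` E) by exact: measurableD.
apply: le_trans (le_mu_ext P sub); rewrite [leRHS]measurable_mu_extE//.
apply: (@le_trans _ _ (P (G `\` E))); last exact: lexx.
have PGE : (P G <= P (G `\` E) + P E)%E.
  apply: le_trans (measureU2 _ mGE mE).
  apply: le_measure; [exact/mem_set|apply/mem_set; exact: measurableU|].
  by move=> w Gw; have [Ew|nEw] := pselect (E w); [right|left].
have fin C : measurable C -> P C = (fine (P C))%:E.
  by move=> mC; rewrite fineK//; exact: fin_num_measure.
move: PG PE PGE; rewrite (fin _ mG) (fin _ mE) (fin _ mGE).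
move: (fine (P G)) (fine (P E)) (fine (P (G `\` E))) => pG pE pGE.
rewrite -EFinD !lee_fin => PG PE PGE.
(* [expR 3 >= 4]: one factor 2 offsets the half in [near_blocks_lower], the other leaves room to
   subtract the probability of [E]. *)
have slack : 3 <= n%:R * (g / 2) - m%:R * r.
  rewrite lerBrDr mulrA ler_pdivlMr// -ler_pdivrMr//.
  by apply: le_trans (ltW (truncnS_gt _)) _; rewrite ler_nat.
have exponent : n%:R * - (r + g) + 3 <= - (p%:R * \sum_(i < M) (l i * v i - A (l i) + eta)).
  rewrite big_split/= sumr_const card_ord mulrDr -[eta *+ _]mulr_natl.
  have h1 := ler_wpM2l (ler0n R p) lsum; have h2 := ler_wpM2r r0 pm'.
  have h3 : p%:R * (M%:R * eta) <= n%:R * (g / 2).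
    rewrite mulrA [p%:R * _]mulrC /eta mulrA ler_pdivrMr; last by rewrite mulr_gt0.
    by have := ler_wpM2r (ltW g0) Mp; lra.
  move: h1; move: (\sum_(i < M) _) => y; lra.
have e1 : expR (n%:R * - (r + g)) * 4 <= expR (- (p%:R * \sum_(i < M) (l i * v i - A (l i) + eta))).
  apply: (@le_trans _ _ (expR (n%:R * - (r + g) + 3))); last by rewrite ler_expR.
  rewrite expRD ler_wpM2l ?expR_ge0//; have := expR_ge1Dx (3 : R); lra.
have e2 : expR (- (n%:R * (r + g + 1))) <= expR (n%:R * - (r + g)).
  by rewrite ler_expR; lra.
move: PG e1; move: (expR (- (p%:R * \sum_(i < M) _))) => y; lra.
Qed.

End lower_bound.

Lemma compact_separation (R : realType) (M : pseudoMetricType R) (K F : set M) :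
  compact K -> closed F -> (forall g, K g -> ~ F g) ->
  exists2 e : R, 0 < e & forall g f, K g -> ball g e f -> ~ F f.
Proof.
move=> /compact_near_coveringP cK cF KF.
have /cK : forall g, K g ->
    \forall g' \near g & e \near (0 : R)^'+, forall f, ball g' e f -> ~ F f.
  move=> g Kg; have : nbhs g (~` F).
    by apply: open_nbhs_nbhs; split; [exact: closed_openC|exact: KF].
  move=> /nbhs_ballP[e /= e0 eF]; have e20 : 0 < e / 2 by rewrite divr_gt0.
  exists (ball g (e / 2), [set e' | e' < e / 2]) => /=.
    by split; [exact: nbhsx_ballx|exact: nbhs_right_lt].
  move=> [g' e'] /= [gg' e'e] f g'f; apply: eF; rewrite (splitr e).
  by apply: ball_triangle gg' _; apply: le_ball g'f; exact: ltW.
move=> h.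
have [e [/= e0 he]] : exists e : R, 0 < e /\ forall g f, K g -> ball g e f -> ~ F f.
  apply: (@filter_ex _ _ (at_right_proper_filter (0 : R))).
  apply: filterI; first exact: nbhs_right_gt.
  by apply: filterS h => e he g f Kg; exact: (he g Kg).
by exists e.
Qed.

(** Truncation acts on [|y|], so the remainder keeps the sign of [y]: the grid value lies between 0
    and [y]. *)
Lemma round_down (R : realType) (y e : R) (s := (-1) ^+ (y < 0)%R : R)
    (k := Num.truncn (`|y| / e)) : 0 < e ->
  0 <= s * (y - s * (e * k%:R)) /\ `|y - s * (e * k%:R)| <= e.
Proof.
move=> e0; have ss z : s * (s * z) = z by rewrite mulrA -expr2 sqrr_sign mul1r.
have sy : s * y = `|y| by rewrite /s -normrEsign.
have /andP[k1 k2] : k%:R <= `|y| / e < k.+1%:R by apply: truncn_itv; rewrite divr_ge0// ltW.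
move: k1 k2; rewrite ler_pdivlMr// ltr_pdivrMr// -natr1 mulrDl mul1r mulrC => k1 k2.
have s1 : 0 <= s * (y - s * (e * k%:R)) by rewrite mulrBr ss sy subr_ge0.
split=> //; rewrite -[leLHS]mul1r -[X in X * _](_ : `|s| = 1); last by rewrite normr_sign.
by rewrite -normrM ger0_norm// mulrBr ss sy; move: k2; lra.
Qed.

(** * The upper bound for closed sets *)

Section upper_bound.
Context (d0 : measure_display) (T0 : measurableType d0) (R : realType)
  (P0 : probability T0 R) (xi : {RV P0 >-> R})
  (d : measure_display) (T : measurableType d) (P : probability T R)
  (X : nat -> {RV P >-> R}) (x : nat -> R).
Hypothesis xi_mgf : forall l : R, (mmt_gen_fun P0 xi l < +oo)%E.
Hypothesis iX : mutually_independent X.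
Hypothesis X_copies : forall (i : nat) (A : set R), measurable A ->
  distribution P (X i) A = distribution P0 xi A.
Hypothesis x_gt0 : forall n : nat, (0 < n)%N -> 0 < x n.
Hypothesis x_equiv : x n / n%:R @[n --> \oo] --> (1 : R).
Local Notation A := (cgf xi).
Local Notation a := (mean xi).
Local Notation I := (rate_function P0 xi (kappa := 0)).

(** If no multipliers gave a dual sum above [r], the block path would have rate at most [r]; the
    multipliers so obtained feed Chernoff's inequality. *)
Lemma block_path_upper (v sg : nat -> R) n p M (r : R) : (0 < n)%N -> (0 < p)%N ->
  (forall i, sg i * sg i = 1) -> (forall i, (i < M)%N -> 0 <= sg i * (v i - a)) ->
  (forall i, (M <= i)%N -> v i = a) ->
  (r%:E < I (polygonal_path 0 (block_nodes v p n) (ler0n R n)))%E ->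
  (P [set w | forall i, (i < M)%N -> (0 <= sg i * (block_sum X p i w - p%:R * v i))%R] <=
   (expR (- (n%:R * r)))%:E)%E.
Proof.
move=> n0 p0 sg2 va vM rI; have n0' : 0 < n%:R :> R by rewrite ltr0n.
have cA := cgf_cumulant_like xi_mgf; have [A0 _ _] := cA.
have [l rl] : exists l : nat -> R,
    r < \sum_(0 <= k < M) p%:R / n%:R * (l k * v k - A (l k)).
  apply: contrapT => nl; move: rI; rewrite ltNge => /negP; apply.
  apply: (block_path_rate (deviation_legendre xi_mgf) cA n0 p0 vM).
  apply: (@legendre_sum_le _ _ M v (fun=> p%:R / n%:R)) => // l.
  by rewrite leNgt; apply/negP => h; apply: nl; exists l.
apply: (signed_blocks_upper xi_mgf iX X_copies (l := l)) => //.
move: rl; rewrite big_mkord -mulr_sumr -mulrA mulrCA ltr_pdivlMl// => /ltW.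
by [].
Qed.

Lemma walk_upper (F : set (Cspace (0 : R))) (r : R) : closed F ->
  (forall f, F f -> (r%:E < I f)%E) ->
  exists2 C : R, 0 <= C & \forall n \near \oo,
    (mu_ext P (walk_path 0 X x n @^-1` F) <= (C * expR (- (n%:R * r)))%:E)%E.
Proof.
move=> cF FI; have cA := cgf_cumulant_like xi_mgf.
have cK : compact [set f | (I f <= r%:E)%E].
  exact: (@rate_function_compact R _ _ _ _ _ _ (deviation_legendre xi_mgf) cA r).
have [f Kf /FI|e0 e00 sep] := compact_separation cK cF; first by rewrite ltNge Kf.
pose delta := e0 / 8; have del0 : 0 < delta by rewrite divr_gt0.
have [m1 [K [K0 hE]]] := tame_event xi_mgf iX X_copies r del0.
pose S := m1; pose m := m1.+1; pose M := (S * m)%N.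
have S1 : 0 < S%:R + 1 :> R by rewrite ltr_wpDl.
pose e := delta / (2 * (S%:R + 1)).
have e_gt0 : 0 < e by rewrite divr_gt0// mulr_gt0.
(* On tame paths the centred block averages are at most [delta m + |a|] in absolute value, because
   [n <= p m]; so the grid is finite and does not depend on [n]. *)
pose J := (Num.truncn ((delta * m%:R + `|a|) / e)).+1.
pose idx : finType := {ffun 'I_M -> bool * 'I_J}.
pose sg (s : idx) i : R := if insub i is Some i' then (-1) ^+ (s i').1 else 1.
pose v (s : idx) i : R :=
  if insub i is Some i' then a + (-1) ^+ (s i').1 * (e * (s i').2%:R) else a.
have sg2 s i : sg s i * sg s i = 1.
  by rewrite /sg; case: insub => [i'|]; rewrite ?mulr1// -expr2 sqrr_sign.
have va s i : 0 <= sg s i * (v s i - a).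
  rewrite /sg /v; case: insub => [i'|]; last by rewrite subrr mulr0.
  by rewrite addrAC subrr add0r mulrA -expr2 sqrr_sign mul1r mulr_ge0// ltW.
have vM s i : (M <= i)%N -> v s i = a.
  by move=> Mi; rewrite /v insubF// ltnNge Mi.
exists (#|idx|%:R + 1); first by rewrite addr_ge0.
have := hE S m (leqnn _) (leqnSn _) (ltn0Sn _); have := scaling_error x_equiv K0 del0.
have : \forall n \near \oo, (m <= n)%N by exists m.
apply: filterS3 => n mn xn [E [mE PE hwE]].
have n0 : (0 < n)%N by exact: leq_trans mn.
have n0' : 0 < n%:R :> R by rewrite ltr0n.
set p := (n %/ m).+1; have p0 : 0 < p%:R :> R by rewrite ltr0n.
have pm : p%:R * m%:R <= 2 * n%:R :> R.
  by rewrite -natrM mulSn -natrM ler_nat mul2n -addnn leq_add//; exact: leq_trunc_div.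
have np : n%:R <= p%:R * m%:R :> R by rewrite -natrM ler_nat ltnW// ltn_ceil.
have Mp : M%:R * p%:R <= 2 * (S%:R + 1) * n%:R :> R.
  rewrite /M natrM -mulrA [m%:R * _]mulrC.
  have := ler_wpM2l (ler0n R S) pm; lra.
have Me : M%:R * (p%:R * e) <= delta * n%:R.
  rewrite mulrA /e mulrA ler_pdivrMr; last by rewrite mulr_gt0.
  by have := ler_wpM2r (ltW del0) Mp; lra.
pose path s : Cspace (0 : R) := polygonal_path 0 (block_nodes (v s) p n) (ler0n R n).
pose G s := [set w | forall i, (i < M)%N ->
  (0 <= sg s i * (block_sum X p i w - p%:R * v s i))%R].
have mG s : measurable (G s).
  apply: bigcap_measurableType => i _; apply: measurable_superlevel.
  apply: measurable_funM => //; apply: measurable_funB => //.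
  exact: block_sum_measurable.
have PG s : (r%:E < I (path s))%E -> (P (G s) <= (expR (- (n%:R * r)))%:E)%E.
  move=> rI; exact: (block_path_upper n0 (ltn0Sn _) (sg2 s) (fun i _ => va s i) (vM s) rI).
have [mU PU] := measure_bigsetU_le (expR_ge0 (- (n%:R * r))) mG PG.
have sub : walk_path 0 X x n @^-1` F `<=`
    E `|` \big[setU/set0]_(s | (r%:E < I (path s))%E) G s.
  move=> w Fw; have [|nEw] := pselect (E w); [by left|right].
  have tw := hwE w nEw; have [tw1 _ _] := tw.
  pose y i := block_sum X p i w / p%:R - a.
  have yJ i : (i < M)%N -> (Num.truncn (`|y i| / e) < J)%N.
    move=> iM; rewrite ltnS; apply: le_truncn; rewrite ler_pM2r ?invr_gt0//.
    apply: le_trans (ler_normB _ _) _; rewrite lerD2r normrM normfV (gtr0_norm p0).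
    rewrite ler_pdivrMr//; apply: le_trans (ler_norm_sum _ _ _) _.
    apply: le_trans (tw1 i iM) _.
    by rewrite -[leRHS]mulrA ler_wpM2l ?(ltW del0)// mulrC.
  pose s : idx := [ffun i : 'I_M => ((y i < 0)%R, insubd ord0 (Num.truncn (`|y i| / e)))].
  have sgE (i : 'I_M) : sg s i = (-1) ^+ (y i < 0)%R by rewrite /sg valK ffunE.
  have vE (i : 'I_M) : v s i = a + (-1) ^+ (y i < 0)%R * (e * (Num.truncn (`|y i| / e))%:R).
    by rewrite /v valK ffunE/= val_insubd yJ.
  have bE (i : 'I_M) : block_sum X p i w - p%:R * v s i =
      p%:R * (y i - (-1) ^+ (y i < 0)%R * (e * (Num.truncn (`|y i| / e))%:R)).
    rewrite vE /y; move: (_ * (e * _)) => z; move: (block_sum _ _ _ _) (mean xi) => b c.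
    by field; rewrite lt0r_neq0.
  have close : rho_ball (path s) e0 (walk_path 0 X x n w).
    apply: rho_ball_sym; apply: (@rho_ballW _ _ _ (4 * delta)) => [|t t0].
      by rewrite /delta; lra.
    rewrite !extend_polygonal//; apply: polyline_dist => // k.
    apply: (tame_walk n0 (ltn0Sn _) (ltW e_gt0) (ltW del0) (x_gt0 n0) tw xn Me) => //.
      move=> i iM; rewrite (bE (Ordinal iM)) normrM (gtr0_norm p0) ler_pM2l//.
      by have [] := round_down (y i) e_gt0.
    exact: vM.
  have rI : (r%:E < I (path s))%E.
    by rewrite ltNge; apply/negP => Ir; exact: (sep _ _ Ir close).
  rewrite (bigD1 s)//=; left => i iM; rewrite (sgE (Ordinal iM)) (bE (Ordinal iM)).
  by rewrite mulrCA mulr_ge0//; have [] := round_down (y i) e_gt0.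
apply: le_trans (le_mu_ext P sub) _; rewrite measurable_mu_extE; last exact: measurableU.
apply: le_trans (measureU2 P mE mU) _; apply: le_trans (leeD PE PU) _.
by rewrite -EFinD lee_fin addrC mulrDl mul1r.
Qed.

End upper_bound.

Theorem theorem4p1 (R : realType)
    (d0 : measure_display) (T0 : measurableType d0) (P0 : probability T0 R)
    (xi : {RV P0 >-> R})
    (d : measure_display) (T : measurableType d) (P : probability T R)
    (X : nat -> {RV P >-> R}) (x : nat -> R)
    (xi_nondegenerate : nondegenerate_rv P0 xi)
    (xi_mgf : forall l : R, (mmt_gen_fun P0 xi l < +oo)%E)
    (X_independent : mutually_independent X)
    (X_copies : forall (i : nat) (A : set R), measurable A ->
       distribution P (X i) A = distribution P0 xi A)
    (x_gt0 : forall n : nat, (0 < n)%N -> 0 < x n)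
    (x_equiv : x n / n%:R @[n --> \oo] --> (1 : R)) :
  satisfies_LDP P (walk_path (0 : R) X x)
    (rate_function P0 xi (kappa := 0)).
Proof.
have cA := cgf_cumulant_like xi_mgf; have devA := deviation_legendre xi_mgf.
have I0 := rate_function_ge0 devA cA.
have mu0 C : (0 <= mu_ext P C)%E by apply: mu_ext_ge0; exact: measure_ge0.
split; first exact: rate_function_good devA cA.
move=> B _; split.
  set J := ereal_inf _; set L := limn_esup _.
  have J0 : (0 <= J)%E by apply: le_ereal_inf_tmp => _ [f _ <-].
  have key (r e : R) : (r%:E < J)%E -> 0 < e -> (L <= (- r + e)%:E)%E.
    move=> rJ e0; have FI f : closure B f -> (r%:E < rate_function P0 xi f)%E.
      by move=> Bf; apply: lt_le_trans rJ _; apply: ereal_inf_lbound; exists f.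
    have [C C0 hC] := walk_upper xi_mgf X_independent X_copies x_gt0 x_equiv
      (@closed_closure _ B) FI.
    (* For [n e >= C] the constant disappears into the exponent, as [C <= expR (n e)]. *)
    apply: limn_esup_le; pose N := (Num.truncn (C / e)).+1.
    have : \forall n \near \oo, (N <= n)%N by exists N.
    apply: filterS2 hC => n nC Nn; have n0 : (0 < n)%N by exact: leq_trans Nn.
    apply: scaled_lne_le => //; apply: le_trans (le_mu_ext P _) (le_trans nC _).
      by move=> w; exact: subset_closure.
    rewrite lee_fin mulrDr mulrN [expR (_ + _)]expRD mulrC ler_wpM2l ?expR_ge0//.
    have : C <= n%:R * e.
      rewrite -ler_pdivrMr//; apply: le_trans (ltW (truncnS_gt _)) _.
      by rewrite ler_nat.
    by move=> Cn; apply: le_trans (expR_ge1Dx _); lra.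
  case: J J0 key => [r| |//] _ key.
    apply/lee_addgt0Pr => e e0; have e20 : 0 < e / 2 by rewrite divr_gt0.
    have := key (r - e / 2) (e / 2); rewrite lte_fin => /(_ _ e20) h.
    by apply: le_trans (h _) _; [lra|rewrite -EFinN -EFinD lee_fin; lra].
  (* The remaining case is [J = +oo], where [key] bounds [L] by every real number. *)
  suff -> : L = -oo%E by [].
  apply: eq_ninfty => r; have := key (1 - r) 1 (ltry _) ltr01.
  by rewrite opprB subrK.
rewrite leeNl; apply: le_ereal_inf_tmp => _ [f Bf <-].
case If : (rate_function P0 xi f) (I0 f) => [r| |] // _; last exact: leey.
have fr : energy_le (cgf xi) (extend f) r.
  by apply/(rate_function_leP devA cA); rewrite If.
apply/lee_addgt0Pr => g g0; rewrite leeNl -EFinD; apply: limn_einf_ge.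
have := walk_lower xi_mgf X_independent X_copies x_gt0 x_equiv Bf fr g0.
have : \forall n \near \oo, (0 < n)%N by exists 1%N.
by apply: filterS2 => n n0; exact: scaled_lne_ge.
Qed.
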